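(* Let $u\in X_p$, $z\in X_d$ be the solutions of the primal and adjoint weak problems, $\sigma=-A\nabla u-f_2$, $r=-(A\nabla z+bz+g_2)$, $\gamma=\mathcal J_p(u)$. Below, $C$ denotes positive constants independent of $h$ and $H$, possibly different at each occurrence. (1) Assume that $u_h\in X_p^h$ and $z_H\in X_d^H$ satisfy $\|u-u_h\|_1\le C\epsilon_{p,0}(h)$ and $\|z-z_H\|_1\le C\epsilon_{d,0}(H)$. Then $$|\gamma-\gamma_0(u_h,z_H)|\le C\epsilon_{p,0}(h)\epsilon_{d,0}(H).$$ If $\epsilon_{p,0}(h)\le Ch^{s_{p,0}}$ and $\epsilon_{d,0}(H)\le CH^{s_{d,0}}$, then $|\gamma-\gamma_0(u_h,z_H)|\le Ch^{s_{p,0}}H^{s_{d,0}}$. (2) Assume that $(\sigma_h,u_h)\in\Sigma_p^h\times X_p^h$ and $(r_H,z_H)\in\Sigma_d^H\times X_d^H$ satisfy $$\|\sigma-\sigma_h\|_0+\|u-u_h\|_1\le C\epsilon_{p,1}(h),\qquad\|r-r_H\|_0+\|z-z_H\|_1\le C\epsilon_{d,1}(H).$$ Then $$|\gamma-\gamma_1(u_h,\sigma_h,z_H,r_H)|\le C\epsilon_{p,1}(h)\epsilon_{d,1}(H).$$ If $\epsilon_{p,1}(h)\le Ch^{s_{p,1}}$ and $\epsilon_{d,1}(H)\le CH^{s_{d,1}}$, then $|\gamma-\gamma_1(u_h,\sigma_h,z_H,r_H)|\le Ch^{s_{p,1}}H^{s_{d,1}}$.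
   Context: Domain and coefficients: $\Omega\subset\mathbb R^d$, $d\ge2$, is a bounded Lipschitz domain with outward unit normal $n$ and $\partial\Omega=\overline{\Gamma_D}\cup\overline{\Gamma_N}$, where $\Gamma_D,\Gamma_N$ are disjoint relatively open subsets of $\partial\Omega$ and $|\Gamma_D|>0$. $A\in L^\infty(\Omega;\mathbb R^{d\times d})$ is symmetric with $a_0|\xi|^2\le\xi^TA(x)\xi\le a_1|\xi|^2$ for all $\xi\in\mathbb R^d$ and a.e. $x$, where $0<a_0\le a_1<\infty$; $b\in L^\infty(\Omega)^d$, $c\in L^\infty(\Omega)$. Data: $f_1,g_1\in L^2(\Omega)$, $f_2,g_2\in L^2(\Omega)^d$, $\psi_p,\psi_d\in L^2(\Gamma_N)$, $\phi_p,\phi_d\in H^{1/2}(\Gamma_D)$ (restrictions to $\Gamma_D$ of $H^{1/2}(\partial\Omega)$ functions). Notation: $(\cdot,\cdot)$ and $\|\cdot\|_0$ are the $L^2(\Omega)$ inner product and norm, $\|\cdot\|_1$ the $H^1(\Omega)$ norm, $\langle\cdot,\cdot\rangle_{\Gamma_N}$ the $L^2(\Gamma_N)$ pairing of traces. $H_D^1(\Omega)=\{v\in H^1(\Omega):v=0\text{ on }\Gamma_D\}$, $X_p=\{w\in H^1(\Omega):w=\phi_p\text{ on }\Gamma_D\}$, $X_d=\{v\in H^1(\Omega):v=\phi_d\text{ on }\Gamma_D\}$. For $\tau\in H(\mathrm{div};\Omega)$ and $\psi\in L^2(\Gamma_N)$, ''$\tau\cdot n=\psi$ on $\Gamma_N$''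 means $(\tau,\nabla s_0)+(\nabla\cdot\tau,s_0)=\langle\psi,s_0\rangle_{\Gamma_N}$ for all $s_0\in H_D^1(\Omega)$. $\Sigma_p=\{\tau\in H(\mathrm{div};\Omega):\tau\cdot n=\psi_p\text{ on }\Gamma_N\}$, $\Sigma_d=\{\rho\in H(\mathrm{div};\Omega):\rho\cdot n=\psi_d\text{ on }\Gamma_N\}$, assumed nonempty. For $t,s,w\in H^1(\Omega)$, $a(t,s)=(A\nabla t,\nabla s)+(b\cdot\nabla t+ct,s)$, $\ell(s)=(f_1,s)-(f_2,\nabla s)-\langle\psi_p,s\rangle_{\Gamma_N}$, $m(w)=(g_1,w)-(g_2,\nabla w)-\langle\psi_d,w\rangle_{\Gamma_N}$. Standing assumption (inf-sup): there is $\beta>0$ with $\beta=\inf_{0\ne w_0\in H_D^1(\Omega)}\sup_{0\ne v_0\in H_D^1(\Omega)}\frac{a(w_0,v_0)}{\|w_0\|_1\|v_0\|_1}=\inf_{0\ne v_0\in H_D^1(\Omega)}\sup_{0\ne w_0\in H_D^1(\Omega)}\frac{a(w_0,v_0)}{\|w_0\|_1\|v_0\|_1}$. Primal weak problem: $u\in X_p$, $a(u,s_0)=\ell(s_0)$ for all $s_0\in H_D^1(\Omega)$. Adjoint weak problem: $z\in X_d$, $a(s_0,z)=m(s_0)$ for all $s_0\in H_D^1(\Omega)$. Quantity of interest: $\mathcal J_p(u)=(g_1,u)-(g_2,\nabla u)-\langle\psi_d,u\rangle_{\Gamma_N}+\langle\sigma\cdot n,\phi_d\rangle_{\Gamma_D}$,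 where $\sigma=-A\nabla u-f_2\in H(\mathrm{div};\Omega)$ and $\langle\sigma\cdot n,\phi_d\rangle_{\Gamma_D}:=(\sigma,\nabla z_d)+(\nabla\cdot\sigma,z_d)-\langle\psi_p,z_d\rangle_{\Gamma_N}$ for any $z_d\in X_d$ (independent of the choice). Corrected quantities: $\gamma_0(w,v)=m(w)+\ell(v)-a(w,v)$, and $\gamma_1(w,\tau,v,\rho)=\widetilde m(\tau,w)+\widetilde\ell(\rho,v)-\widetilde a((\tau,w),(\rho,v))+(\tau+A\nabla w+f_2,A^{-1}\rho)+(A^{-1}\tau,\rho+g_2+A\nabla v+bv)$ with $\widetilde\ell(\rho,v)=(f_1,v)+(f_2,A^{-1}(\rho+bv+g_2))-\langle\psi_p,v\rangle_{\Gamma_N}$, $\widetilde m(\tau,w)=(g_1,w)+(A^{-1}(\tau+f_2),g_2)-\langle\psi_d,w\rangle_{\Gamma_N}$, $\widetilde a((\tau,w),(\rho,v))=(A^{-1}(\tau+f_2),\rho+g_2)+(cw,v)$. Approximation spaces: $X_p^h\subset X_p$, $X_d^H\subset X_d$ are affine approximation spaces (families indexed by $h>0$, $H>0$), and $\Sigma_p^h\times X_p^h\subset\Sigma_p\times X_p$, $\Sigma_d^H\times X_d^H\subset\Sigma_d\times X_d$ are conforming flux–potential spaces. Best-approximation errors: $\epsilon_{p,0}(h)=\inf_{w_h\in X_p^h}\|u-w_h\|_1$, $\epsilon_{d,0}(H)=\inf_{v_H\in X_d^H}\|z-v_H\|_1$, $\epsilon_{p,1}(h)=\inf_{(\tau_h,w_h)\in\Sigma_p^h\times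 X_p^h}(\|\sigma-\tau_h\|_0+\|u-w_h\|_1)$, $\epsilon_{d,1}(H)=\inf_{(\rho_H,v_H)\in\Sigma_d^H\times X_d^H}(\|r-\rho_H\|_0+\|z-v_H\|_1)$. *)

(* Defs.v *)
(* Points of R^d are row vectors. Functions are total on R^d; only their values on
   Omega (or on its boundary) matter, up to null sets. *)
From HB Require Import structures.
From mathcomp Require Import all_boot all_order all_algebra.
From mathcomp Require Import all_classical all_reals all_analysis.

Set Implicit Arguments.
Unset Strict Implicit.
Unset Printing Implicit Defensive.

Import Order.TTheory GRing.Theory Num.Theory.
Import numFieldNormedType.Exports.

Local Open Scope classical_set_scope.
Local Open Scope ring_scope.

Section Euclidean.
Context {R : realType} {d : nat}.
Implicit Types (u v : 'rV[R]_d) (X : set 'rV[R]_d).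

Definition dotv u v : R := \sum_(i < d) u ord0 i * v ord0 i.

(* The library norm on 'rV is the sup norm. *)
Definition enorm u : R := Num.sqrt (dotv u u).

(* M xi for xi written as a row vector. *)
Definition mxapp (M : 'M[R]_d) u : 'rV[R]_d := u *m M^T.

Definition bdry X : set 'rV[R]_d := closure X `\` interior X.

Definition ediam X : \bar R :=
  ereal_sup [set z : \bar R |
    exists x y, [/\ X x, X y & z = (enorm (x - y))%:E]].

End Euclidean.

(* Every set is measurable in this copy of T, so that [mu_ext zeta X] is the
   infimum of \sum_k zeta (F k) over all countable covers F of X. *)
Definition all_sets_type (T : pointedType) := g_sigma_algebraType [set: set T].
HB.instance Definition _ (T : pointedType) := Measurable.on (all_sets_type T).

Section CoverOuterMeasure.
Context {R : realType} {T : pointedType}.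
Variable zeta : set T -> \bar R.

Definition cover_ext (X : set T) : \bar R :=
  @mu_ext _ (all_sets_type T) R zeta X.

Hypotheses (zeta0 : zeta set0 = 0%E) (zeta_ge0 : forall X, (0 <= zeta X)%E).

Lemma cover_ext0 : cover_ext set0 = 0%E.
Proof. exact: mu_ext0. Qed.

Lemma cover_ext_ge0 X : (0 <= cover_ext X)%E.
Proof. exact: mu_ext_ge0. Qed.

Lemma le_cover_ext : {homo cover_ext : A B / A `<=` B >-> (A <= B)%E}.
Proof. by move=> A B AB; exact: le_mu_ext. Qed.

Lemma cover_ext_sigma_subadditive : sigma_subadditive cover_ext.
Proof. exact: (@mu_ext_sigma_subadditive _ (all_sets_type T) R zeta zeta_ge0). Qed.

End CoverOuterMeasure.

Section Lebesgue.
Context {R : realType} {d : nat}.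

Definition cbox (l r : 'rV[R]_d) : set 'rV[R]_d :=
  [set x | forall i, l ord0 i <= x ord0 i <= r ord0 i].

(* The volume of a closed box, 0 on the empty set, +oo on any other set. *)
Definition box_vol (X : set 'rV[R]_d) : \bar R :=
  if `[< X = set0 >] then 0%E
  else ereal_inf [set z : \bar R | exists l r,
    X = cbox l r /\ z = (\prod_(i < d) (r ord0 i - l ord0 i))%:E].

Definition lebesgue_outer : set 'rV[R]_d -> \bar R := cover_ext box_vol.

Let box_vol0 : box_vol set0 = 0%E.
Proof. by rewrite /box_vol; case: asboolP. Qed.

Let box_vol_ge0 X : (0 <= box_vol X)%E.
Proof.
rewrite /box_vol; case: asboolP => [//|/eqP/set0P[x Xx]].
apply: le_ereal_inf_tmp => _ [l [r [XE ->]]]; rewrite lee_fin.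
apply: prodr_ge0 => i _; rewrite subr_ge0.
by move: Xx; rewrite XE => /(_ i) /andP[]; exact: le_trans.
Qed.

HB.instance Definition _ := isOuterMeasure.Build R 'rV[R]_d lebesgue_outer
  (cover_ext0 box_vol0 box_vol_ge0) (cover_ext_ge0 box_vol_ge0)
  (@le_cover_ext _ _ box_vol) (cover_ext_sigma_subadditive box_vol_ge0).

Definition lebesgue_om : {outer_measure set 'rV[R]_d -> \bar R} :=
  lebesgue_outer.

(* R^d with the Lebesgue measurable sets. *)
Definition Rd := caratheodory_type lebesgue_om.

Definition leb : {measure set Rd -> \bar R} := lebesgue_om.

End Lebesgue.
Arguments Rd R d : clear implicits.
Arguments leb R d : clear implicits.

Section Hausdorff.
Context {R : realType} {d : nat}.
Variable n : nat.

Definition unit_ball_vol : R := fine (leb R n [set x : 'rV[R]_n | enorm x <= 1]).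

Definition hausdorff_gauge (delta : R) (X : set 'rV[R]_d) : \bar R :=
  if `[< X = set0 >] then 0%E
  else if (ediam X <= delta%:E)%E
  then (unit_ball_vol * (fine (ediam X) / 2) ^+ n)%:E
  else +oo%E.

(* Normalized so that n-dimensional Hausdorff measure is n-dimensional area. *)
Definition hausdorff_outer (X : set 'rV[R]_d) : \bar R :=
  ereal_sup [set cover_ext (hausdorff_gauge delta) X
            | delta in [set delta : R | 0 < delta]].

Let gauge0 delta : hausdorff_gauge delta set0 = 0%E.
Proof. by rewrite /hausdorff_gauge; case: asboolP. Qed.

Let gauge_ge0 delta X : (0 <= hausdorff_gauge delta X)%E.
Proof.
rewrite /hausdorff_gauge; case: asboolP => [//|/eqP/set0P[x Xx]].
case: ifPn => _; last exact: leey.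
rewrite lee_fin mulr_ge0 ?fine_ge0// exprn_ge0// divr_ge0// fine_ge0//.
apply: ereal_sup_ubound; exists x, x; split => //.
rewrite subrr /enorm /dotv big1 ?sqrtr0// => i _.
by rewrite mxE mul0r.
Qed.

Lemma hausdorff_outer0 : hausdorff_outer set0 = 0%E.
Proof.
apply/eqP; rewrite eq_le; apply/andP; split.
  apply: ge_ereal_sup => _ [delta _ <-].
  by rewrite (cover_ext0 (gauge0 delta) (gauge_ge0 delta)).
apply: ereal_sup_ubound; exists 1 => //=.
exact: (cover_ext0 (gauge0 1) (gauge_ge0 1)).
Qed.

Lemma hausdorff_outer_ge0 X : (0 <= hausdorff_outer X)%E.
Proof.
apply: (@le_trans _ _ (cover_ext (hausdorff_gauge 1) X)).
  exact: (cover_ext_ge0 (gauge_ge0 1)).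
by apply: ereal_sup_ubound; exists 1 => //=.
Qed.

Lemma le_hausdorff_outer :
  {homo hausdorff_outer : A B / A `<=` B >-> (A <= B)%E}.
Proof.
move=> A B AB; apply: ge_ereal_sup => _ [delta delta0 <-].
apply: (le_trans (@le_cover_ext _ _ (hausdorff_gauge delta) _ _ AB)).
by apply: ereal_sup_ubound; exists delta.
Qed.

Lemma hausdorff_outer_sigma_subadditive : sigma_subadditive hausdorff_outer.
Proof.
move=> F; apply: ge_ereal_sup => _ [delta delta0 <-].
apply: (le_trans (cover_ext_sigma_subadditive (gauge_ge0 delta) _)).
apply: lee_nneseries => [k *|k *].
  exact: (cover_ext_ge0 (gauge_ge0 delta) (F k)).
by apply: ereal_sup_ubound; exists delta.
Qed.

HB.instance Definition _ := isOuterMeasure.Build R 'rV[R]_d hausdorff_outer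
  hausdorff_outer0 hausdorff_outer_ge0 le_hausdorff_outer
  hausdorff_outer_sigma_subadditive.

Definition hausdorff_om : {outer_measure set 'rV[R]_d -> \bar R} :=
  hausdorff_outer.

End Hausdorff.

(* R^d with the sets that are measurable for the surface measure H^(d-1). *)
Definition Sd (R : realType) (d : nat) :=
  caratheodory_type (@hausdorff_om R d d.-1).

Definition surf (R : realType) (d : nat) : {measure set (Sd R d) -> \bar R} :=
  @hausdorff_om R d d.-1.

Section LebesgueSpaces.
Context {R : realType} {disp : measure_display} {T : measurableType disp}.
Variables (mu : {measure set T -> \bar R}) (D : set T).

Definition L2 (f : T -> R) : Prop :=
  measurable_fun D f /\ (\int[mu]_(x in D) (f x ^+ 2)%:E < +oo)%E.

Definition Linfty (f : T -> R) : Prop :=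
  measurable_fun D f /\ exists M : R, \forall x \ae mu, D x -> `|f x| <= M.

End LebesgueSpaces.

Section Domain.
Context {R : realType} {d : nat}.
Implicit Types Omega Gamma : set 'rV[R]_d.

(* Near each boundary point Omega is, in the rigid coordinates given by a unit
   vector e and the hyperplane orthogonal to e, one side of the graph of a
   Lipschitz function g. *)
Definition lipschitz_boundary Omega : Prop :=
  forall x0, bdry Omega x0 ->
  exists (e : 'rV[R]_d) (g : 'rV[R]_d -> R) (L r k : R),
    [/\ enorm e = 1, 0 < r, 0 < k,
        forall y y', `|g y - g y'| <= L * enorm (y - y') &
        forall y t, dotv y e = 0 -> enorm y < r -> `|t| < k ->
          (Omega (x0 + y + t *: e) <-> g y < t)].

Definition bounded_lipschitz_domain Omega : Prop :=
  [/\ Omega !=set0, open Omega, connected Omega, bounded_set Omega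
    & lipschitz_boundary Omega].

Definition relatively_open (Gamma X : set 'rV[R]_d) : Prop :=
  exists2 U : set 'rV[R]_d, open U & Gamma = X `&` U.

Definition partial (i : 'I_d) (f : 'rV[R]_d -> R) : 'rV[R]_d -> R :=
  fun x => 'D_(delta_mx ord0 i) f x.

Definition smooth (f : 'rV[R]_d -> R) : Prop :=
  forall s : seq 'I_d,
    continuous (foldr partial f s) /\
    forall i x, derivable (foldr partial f s) x (delta_mx ord0 i).

Definition test_fun Omega (phi : 'rV[R]_d -> R) : Prop :=
  [/\ smooth phi, compact (closure [set x | phi x != 0])
    & closure [set x | phi x != 0] `<=` Omega].

End Domain.

Section Sobolev.
Context {R : realType} {d : nat}.
Variable Omega : set 'rV[R]_d.
Implicit Types (u v : 'rV[R]_d -> R) (F G : 'rV[R]_d -> 'rV[R]_d).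

Definition ip u v : R := \int[leb R d]_(x in Omega) (u x * v x).
Definition ipv F G : R := \int[leb R d]_(x in Omega) dotv (F x) (G x).
Definition norm0 u : R := Num.sqrt (ip u u).
Definition norm0v F : R := Num.sqrt (ipv F F).

Definition L2v F : Prop := forall i, L2 (leb R d) Omega (fun x => F x ord0 i).

Definition is_weak_grad u G : Prop :=
  forall phi, test_fun Omega phi -> forall i,
    ip u (partial i phi) = - ip (fun x => G x ord0 i) phi.

Definition is_weak_div F q : Prop :=
  forall phi, test_fun Omega phi ->
    ipv F (fun x => \row_i partial i phi x) = - ip q phi.

(* The weak gradient and divergence are determined a.e. on Omega; [get] picks
   a representative. *)
Definition wgrad u : 'rV[R]_d -> 'rV[R]_d :=
  get [set G | L2v G /\ is_weak_grad u G].

Definition wdiv F : 'rV[R]_d -> R :=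
  get [set q | L2 (leb R d) Omega q /\ is_weak_div F q].

Definition H1 u : Prop :=
  L2 (leb R d) Omega u /\ exists G, L2v G /\ is_weak_grad u G.

Definition Hdiv F : Prop :=
  L2v F /\ exists q, L2 (leb R d) Omega q /\ is_weak_div F q.

Definition norm1 u : R := Num.sqrt (norm0 u ^+ 2 + norm0v (wgrad u) ^+ 2).

(* The trace operator H^1(Omega) -> L^2(bdry Omega): the bounded linear operator
   that restricts functions continuous up to the boundary. On a bounded
   Lipschitz domain it exists and is unique up to surface-null sets. *)
Definition is_trace (tr : ('rV[R]_d -> R) -> 'rV[R]_d -> R) : Prop :=
  [/\ forall u, H1 u -> L2 (surf R d) (bdry Omega) (tr u),
      forall (t : R) u v, H1 u -> H1 v ->
        \forall x \ae surf R d, bdry Omega x ->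
          tr (fun y => t * u y + v y) x = t * tr u x + tr v x,
      exists C : R, forall u, H1 u ->
        Num.sqrt (\int[surf R d]_(x in bdry Omega) (tr u x ^+ 2))
          <= C * norm1 u &
      forall u, H1 u -> {within closure Omega, continuous u} ->
        \forall x \ae surf R d, bdry Omega x -> tr u x = u x].

(* Sobolev-Slobodeckij space on the (d-1)-dimensional boundary: the exponent is
   (d - 1) + 2 * (1/2) = d. *)
Definition H12_bdry (g : 'rV[R]_d -> R) : Prop :=
  L2 (surf R d) (bdry Omega) g /\
  (\int[surf R d]_(x in bdry Omega) \int[surf R d]_(y in bdry Omega)
     ((g x - g y) ^+ 2 / enorm (x - y) ^+ d)%:E < +oo)%E.

Definition H12 (Gamma : set 'rV[R]_d) (phi : 'rV[R]_d -> R) : Prop :=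
  exists2 g, H12_bdry g & \forall x \ae surf R d, Gamma x -> phi x = g x.

End Sobolev.

Record bvp (R : realType) (d : nat) := Bvp {
  Omega : set 'rV[R]_d;
  GammaD : set 'rV[R]_d;
  GammaN : set 'rV[R]_d;
  tr : ('rV[R]_d -> R) -> 'rV[R]_d -> R;
  cA : 'rV[R]_d -> 'M[R]_d;
  cb : 'rV[R]_d -> 'rV[R]_d;
  cc : 'rV[R]_d -> R;
  f1 : 'rV[R]_d -> R;
  f2 : 'rV[R]_d -> 'rV[R]_d;
  g1 : 'rV[R]_d -> R;
  g2 : 'rV[R]_d -> 'rV[R]_d;
  psip : 'rV[R]_d -> R;
  psid : 'rV[R]_d -> R;
  phip : 'rV[R]_d -> R;
  phid : 'rV[R]_d -> R }.

Section Problem.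
Context {R : realType} {d : nat}.
Variable P : bvp R d.
Implicit Types (t s u v w z : 'rV[R]_d -> R) (tau rho : 'rV[R]_d -> 'rV[R]_d).

Local Notation "'grad' u" := (wgrad (Omega P) u) (at level 10).
Local Notation "( u ; v )" := (ip (Omega P) u v).
Local Notation "<( F ; G )>" := (ipv (Omega P) F G).

(* Pointwise A F and A^-1 F for a vector field F. *)
Definition Aapp F : 'rV[R]_d -> 'rV[R]_d := fun x => mxapp (cA P x) (F x).
Definition Ainv F : 'rV[R]_d -> 'rV[R]_d := fun x => mxapp (invmx (cA P x)) (F x).

Definition bscale v : 'rV[R]_d -> 'rV[R]_d := fun x => v x *: cb P x.

Definition pairN (psi v : 'rV[R]_d -> R) : R :=
  \int[surf R d]_(x in GammaN P) (psi x * tr P v x).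

Definition XD (phi : 'rV[R]_d -> R) : set ('rV[R]_d -> R) :=
  [set w | H1 (Omega P) w /\
    \forall x \ae surf R d, GammaD P x -> tr P w x = phi x].

Definition H1D := XD (fun=> 0).
Definition Xp := XD (phip P).
Definition Xd := XD (phid P).

Definition normal_pairing tau (psi s : 'rV[R]_d -> R) : R :=
  <(tau ; grad s)> + (wdiv (Omega P) tau ; s) - pairN psi s.

Definition SigmaN (psi : 'rV[R]_d -> R) : set ('rV[R]_d -> 'rV[R]_d) :=
  [set tau | Hdiv (Omega P) tau /\ forall s0, H1D s0 ->
    <(tau ; grad s0)> + (wdiv (Omega P) tau ; s0) = pairN psi s0].

Definition Sigmap := SigmaN (psip P).
Definition Sigmad := SigmaN (psid P).

Definition aform t s : R :=
  <(Aapp (grad t) ; grad s)> +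
  (fun x => dotv (cb P x) (grad t x) + cc P x * t x ; s).

Definition ell s : R := (f1 P ; s) - <(f2 P ; grad s)> - pairN (psip P) s.

Definition mfun w : R := (g1 P ; w) - <(g2 P ; grad w)> - pairN (psid P) w.

Definition inf_sup (beta : R) : Prop :=
  beta%:E = ereal_inf [set ereal_sup
      [set (aform w v / (norm1 (Omega P) w * norm1 (Omega P) v))%:E
      | v in [set v | H1D v /\ norm1 (Omega P) v != 0]]
    | w in [set w | H1D w /\ norm1 (Omega P) w != 0]] /\
  beta%:E = ereal_inf [set ereal_sup
      [set (aform w v / (norm1 (Omega P) w * norm1 (Omega P) v))%:E
      | w in [set w | H1D w /\ norm1 (Omega P) w != 0]]
    | v in [set v | H1D v /\ norm1 (Omega P) v != 0]].

Record standing_assumptions : Prop := StandingAssumptions {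
  sa_dim : (2 <= d)%N;
  sa_dom : bounded_lipschitz_domain (Omega P);
  sa_openD : relatively_open (GammaD P) (bdry (Omega P));
  sa_openN : relatively_open (GammaN P) (bdry (Omega P));
  sa_disj : GammaD P `&` GammaN P = set0;
  sa_cover : bdry (Omega P) = closure (GammaD P) `|` closure (GammaN P);
  sa_posD : (0 < surf R d (GammaD P))%E;
  sa_trace : is_trace (Omega P) (tr P);
  sa_Abnd : forall i j, Linfty (leb R d) (Omega P) (fun x => cA P x i j);
  sa_Asym : \forall x \ae leb R d, Omega P x -> (cA P x)^T = cA P x;
  sa_Aell : exists a0 a1 : R, [/\ 0 < a0, a0 <= a1 &
    \forall x \ae leb R d, Omega P x -> forall xi : 'rV[R]_d,
      a0 * enorm xi ^+ 2 <= dotv xi (mxapp (cA P x) xi) <= a1 * enorm xi ^+ 2];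
  sa_b : forall i, Linfty (leb R d) (Omega P) (fun x => cb P x ord0 i);
  sa_c : Linfty (leb R d) (Omega P) (cc P);
  sa_f1 : L2 (leb R d) (Omega P) (f1 P);
  sa_g1 : L2 (leb R d) (Omega P) (g1 P);
  sa_f2 : L2v (Omega P) (f2 P);
  sa_g2 : L2v (Omega P) (g2 P);
  sa_psip : L2 (surf R d) (GammaN P) (psip P);
  sa_psid : L2 (surf R d) (GammaN P) (psid P);
  sa_phip : H12 (Omega P) (GammaD P) (phip P);
  sa_phid : H12 (Omega P) (GammaD P) (phid P);
  sa_Sigmap : Sigmap !=set0;
  sa_Sigmad : Sigmad !=set0;
  sa_infsup : exists2 beta : R, 0 < beta & inf_sup beta }.

Definition primal_solution u : Prop :=
  Xp u /\ forall s0, H1D s0 -> aform u s0 = ell s0.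

Definition adjoint_solution z : Prop :=
  Xd z /\ forall s0, H1D s0 -> aform s0 z = mfun s0.

Definition flux_p u : 'rV[R]_d -> 'rV[R]_d := - Aapp (grad u) - f2 P.

Definition flux_d z : 'rV[R]_d -> 'rV[R]_d :=
  - (Aapp (grad z) + bscale z + g2 P).

(* zd is any element of [Xd]; the value does not depend on it when u is the
   primal solution. *)
Definition Jp zd u : R :=
  (g1 P ; u) - <(g2 P ; grad u)> - pairN (psid P) u +
  normal_pairing (flux_p u) (psip P) zd.

Definition gamma0 w v : R := mfun w + ell v - aform w v.

Definition ell_tilde rho v : R :=
  (f1 P ; v) + <(f2 P ; Ainv (rho + bscale v + g2 P))> - pairN (psip P) v.

Definition m_tilde tau w : R :=
  (g1 P ; w) + <(Ainv (tau + f2 P) ; g2 P)> - pairN (psid P) w.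

Definition a_tilde tau w rho v : R :=
  <(Ainv (tau + f2 P) ; rho + g2 P)> + (fun x => cc P x * w x ; v).

Definition gamma1 w tau v rho : R :=
  m_tilde tau w + ell_tilde rho v - a_tilde tau w rho v
  + <(tau + Aapp (grad w) + f2 P ; Ainv rho)>
  + <(Ainv tau ; rho + g2 P + Aapp (grad v) + bscale v)>.

Definition err0 u w : R := norm1 (Omega P) (u - w).

Definition err1 sigma tau u w : R :=
  norm0v (Omega P) (sigma - tau) + norm1 (Omega P) (u - w).

Definition best0 u (X : set ('rV[R]_d -> R)) : R := inf [set err0 u w | w in X].

Definition best1 sigma u (S : set ('rV[R]_d -> 'rV[R]_d))
    (X : set ('rV[R]_d -> R)) : R :=
  inf [set err1 sigma q.1 u q.2 | q in S `*` X].

End Problem.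

Definition affine_space (R : realType) (d : nat)
    (X : set ('rV[R]_d -> R)) : Prop :=
  X !=set0 /\
  forall (t : R) v w, X v -> X w -> X (fun x => (1 - t) * v x + t * w x).

(* Main.v *)
(* The estimates follow from two algebraic identities.  Write
   [F, G] for the pairing (A^-1 F, G).  For w in X_p and v in X_d, the two
   weak problems give
     gamma - gamma_0(w, v) = a(u - w, z - v),
   and, for all fluxes tau and rho,
     gamma_1(w, tau, v, rho) - gamma_0(w, v)
       = [tau + f_2 + A grad w, rho + g_2 + b v + A grad v],
   where the two arguments vanish at (sigma, u) and (r, z), so that they equal
     - ((sigma - tau) + A grad (u - w))  and
     - ((r - rho) + b (z - v) + A grad (z - v)).
   Boundedness of the two bilinear forms concludes.

   Since gradients and divergences are arbitrary representatives of the weak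
   ones, their linearity and the identity div sigma = f_1 - b . grad u - c u
   rest on the lemma of du Bois-Reymond: a square-integrable function
   orthogonal to all test functions vanishes almost everywhere.  It is
   obtained by exhausting open boxes with products of dilated copies of
   exp(-1/s), which determines the integral on all boxes, hence on all Borel
   sets, hence on all Lebesgue sets.  Integration by parts for test functions
   comes from the translation invariance of Lebesgue measure.  Additivity of
   the boundary pairings requires Gamma_N to be measurable for the surface
   measure, which is Caratheodory's criterion for metric outer measures. *)
Require Import Defs.
From mathcomp Require Import all_boot all_order all_algebra.
From mathcomp Require Import all_classical all_reals all_analysis.
From mathcomp Require Import measurable_realfun ring lra.

Set Implicit Arguments.
Unset Strict Implicit.
Unset Printing Implicit Defensive.

Import Order.TTheory GRing.Theory Num.Theory.
Import numFieldNormedType.Exports.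

Local Open Scope classical_set_scope.
Local Open Scope ring_scope.

(** * Square-integrable functions *)

(** The shape of the proof is dictated by total integrals: [Rintegral] assigns a real to every
    function but is additive only on integrable ones, and [wgrad], [wdiv] and traces are linear only
    almost everywhere. Each algebraic step on pairings therefore carries square-integrability
    certificates, and the identities for gamma_0 and gamma_1 are reduced early to identities over
    scalars or over an abstract space of fields.

    The weight A^-1 is what makes the flux correction a product: by symmetry (A grad w, grad v) =
    [A grad w, A grad v], so the principal part of a is itself a value of the pairing and completes
    it to a product of two residuals.

    The constants of the bilinear bounds come from the coefficients and the dimension, before any
    approximation is introduced; this makes them independent of h and H. Fields are estimated
    coordinate by coordinate, hence the factors d. *)

Lemma exists_invS_lt (R : realType) (e : R) : 0 < e ->
  exists n : nat, n.+1%:R^-1 < e.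
Proof.
move=> e0; exists (Num.bound e^-1); rewrite invf_plt ?posrE//.
by rewrite (lt_le_trans (archi_boundP _)) ?invr_ge0 ?(ltW e0)// ler_nat.
Qed.

Section MeasurePreserving.
Context {R : realType} {disp : measure_display} {T : measurableType disp}.
Variables (mu : {measure set T -> \bar R}) (phi : T -> T).
Hypotheses (mphi : measurable_fun setT phi)
  (phi_mu : forall A, measurable A -> mu (phi @^-1` A) = mu A).

Lemma integral_measure_preserving (f : T -> \bar R) : measurable_fun setT f ->
  mu.-integrable setT (f \o phi) ->
  (\int[mu]_x f (phi x) = \int[mu]_x f x)%E.
Proof.
move=> mf intf.
rewrite -[LHS](@integral_pushforward _ _ _ _ _ phi mphi mu setT f)//.
apply: eq_measure_integral => A mA _. exact: phi_mu.
Qed.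

End MeasurePreserving.

Section AlmostEverywhere.
Context {R : realType} {disp : measure_display} {T : measurableType disp}.
Variable mu : {measure set T -> \bar R}.
Implicit Types P Q S : T -> Prop.

Lemma ae_imply P Q : (forall x, P x -> Q x) ->
  (\forall x \ae mu, P x) -> \forall x \ae mu, Q x.
Proof. by move=> PQ; apply: filterS. Qed.

Lemma ae_imply2 P Q S : (forall x, P x -> Q x -> S x) ->
  (\forall x \ae mu, P x) -> (\forall x \ae mu, Q x) -> \forall x \ae mu, S x.
Proof. by move=> PQS; apply: filterS2. Qed.

End AlmostEverywhere.

Section L2theory.
Context {R : realType} {disp : measure_display} {T : measurableType disp}.
Variables (mu : {measure set T -> \bar R}) (D : set T).
Hypothesis mD : measurable D.
Implicit Types f g h : T -> R.

Local Notation L2 := (L2 mu D).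
Local Notation Linfty := (Linfty mu D).

Lemma L2_sqr_integrable f : L2 f -> mu.-integrable D (EFin \o (fun x => f x ^+ 2)).
Proof.
move=> [mf foo]; apply/integrableP; split.
  by apply/measurable_EFinP; exact: measurable_funX.
under eq_integral do rewrite /= ger0_norm ?sqr_ge0//.
exact: foo.
Qed.

(** The integrable majorant is [f ^+ 2 + g ^+ 2], because the square of |f| - |g| is nonnegative. *)
Lemma L2_mul_integrable f g : L2 f -> L2 g ->
  mu.-integrable D (EFin \o (fun x => f x * g x)).
Proof.
move=> Lf Lg; have [mf _] := Lf; have [mg _] := Lg.
have := integrableD mD (L2_sqr_integrable Lf) (L2_sqr_integrable Lg).
apply: le_integrable => //.
  by apply/measurable_EFinP; exact: measurable_funM.
move=> x Dx /=; rewrite lee_fin [leRHS]ger0_norm ?addr_ge0 ?sqr_ge0//.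
rewrite normrM -(real_normK (num_real (f x))) -(real_normK (num_real (g x))).
have := sqr_ge0 (`|f x| - `|g x|).
have : 0 <= `|f x| * `|g x| by rewrite mulr_ge0.
nra.
Qed.

Lemma L2D f g : L2 f -> L2 g -> L2 (fun x => f x + g x).
Proof.
move=> Lf Lg; have [mf _] := Lf; have [mg _] := Lg.
split; first exact: measurable_funD.
have i1 := L2_sqr_integrable Lf.
have i2 := L2_sqr_integrable Lg.
have i3 := L2_mul_integrable Lf Lg.
have := integrableD mD (integrableD mD i1 i2) (integrableD mD i3 i3).
move=> /integrableP[mF]; apply: le_lt_trans.
apply: ge0_le_integral => //=.
- by move=> x _; rewrite lee_fin sqr_ge0.
- by apply/measurable_EFinP; apply: measurable_funX; exact: measurable_funD.
- by apply/measurable_EFinP/measurableT_comp => //; exact/measurable_EFinP.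
- move=> x _; rewrite lee_fin; apply: le_trans (ler_norm _).
  by rewrite sqrrD mulr2n; lra.
Qed.

Lemma L2Z (k : R) f : L2 f -> L2 (fun x => k * f x).
Proof.
move=> Lf; have [mf _] := Lf; split.
  by apply: measurable_funM => //; exact: measurable_cst.
have := integrableZl mD (k ^+ 2) (L2_sqr_integrable Lf).
move=> /integrableP[_]; apply: le_lt_trans.
apply: ge0_le_integral => //=.
- by move=> x _; rewrite lee_fin sqr_ge0.
- apply/measurable_EFinP; apply: measurable_funX.
  by apply: measurable_funM => //; exact: measurable_cst.
- apply/measurable_EFinP/measurableT_comp => //.
  apply: measurable_funM; first exact: measurable_cst.
  exact: measurable_funX.
- move=> x _; rewrite lee_fin; apply: le_trans (ler_norm _).
  by rewrite exprMn.
Qed.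

Lemma L2N f : L2 f -> L2 (fun x => - f x).
Proof.
by move=> /(L2Z (-1)); congr L2; apply/funext => x; rewrite mulN1r.
Qed.

Lemma L2B f g : L2 f -> L2 g -> L2 (fun x => f x - g x).
Proof. by move=> Lf /L2N; exact: L2D. Qed.

Lemma L2_0 : L2 (fun=> 0).
Proof.
split; first exact: measurable_cst.
under eq_integral do rewrite expr0n/=.
by rewrite integral0.
Qed.

Lemma L2_sum (I : Type) (s : seq I) (F : I -> T -> R) :
  (forall i, L2 (F i)) -> L2 (fun x => \sum_(i <- s) F i x).
Proof.
move=> LF; elim: s => [|i s IH].
  by under eq_fun do rewrite big_nil; exact: L2_0.
by under eq_fun do rewrite big_cons; exact: L2D.
Qed.

Lemma L2_Linfty_mul f g : Linfty f -> L2 g -> L2 (fun x => f x * g x).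
Proof.
move=> [mf [M fM]] Lg; have [mg _] := Lg; split; first exact: measurable_funM.
have := integrableZl mD (M ^+ 2) (L2_sqr_integrable Lg).
move=> /integrableP[_]; apply: le_lt_trans.
apply: ae_ge0_le_integral => //=.
- by move=> x _; rewrite lee_fin sqr_ge0.
- by apply/measurable_EFinP; apply: measurable_funX; exact: measurable_funM.
- apply/measurable_EFinP/measurableT_comp => //.
  apply: measurable_funM; first exact: measurable_cst.
  exact: measurable_funX.
- apply: filterS fM => x fM Dx; rewrite lee_fin; apply: le_trans (ler_norm _).
  rewrite exprMn ler_wpM2r ?sqr_ge0//.
  have h := fM Dx; rewrite -(real_normK (num_real (f x))).
  by rewrite lerXn2r ?nnegrE//; exact: le_trans h.
Qed.

Lemma integrable_cst_finite (C : R) : (mu D < +oo)%E ->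
  mu.-integrable D (fun=> C%:E).
Proof.
move=> Doo; apply: (@measurable_bounded_integrable _ _ _ mu (cst C)) => //.
exists `|C|; split => [|y Cy x _ /=]; first exact: num_real.
exact: ltW.
Qed.

Lemma L2_bounded f (C : R) : (mu D < +oo)%E -> measurable_fun D f ->
  (forall x, D x -> `|f x| <= C) -> L2 f.
Proof.
move=> Doo mf fC; split => //.
have /integrableP[_] : mu.-integrable D (EFin \o (fun x => f x ^+ 2)).
  apply: measurable_bounded_integrable => //; first exact: measurable_funX.
  exists (C ^+ 2); split => [|y Cy x Dx /=]; first exact: num_real.
  rewrite (le_trans _ (ltW Cy))// normrX lerXn2r ?nnegrE ?fC//.
  by rewrite (le_trans _ (fC _ Dx)).
by under eq_integral do rewrite /= ger0_norm ?sqr_ge0//.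
Qed.

(** Convertible with [ip] for Lebesgue measure on Omega, and with [pairN] for surface measure on
    Gamma_N, so that one theory serves both. *)
Definition L2ip f g : R := \int[mu]_(x in D) (f x * g x).

Lemma L2ipC f g : L2ip f g = L2ip g f.
Proof. by apply: eq_Rintegral => x _; rewrite mulrC. Qed.

Lemma L2ipDl f g h : L2 f -> L2 g -> L2 h ->
  L2ip (fun x => f x + g x) h = L2ip f h + L2ip g h.
Proof.
move=> Lf Lg Lh; rewrite /L2ip -RintegralD//; try exact: L2_mul_integrable.
by apply: eq_Rintegral => x _; rewrite mulrDl.
Qed.

Lemma L2ipZl k f h : L2 f -> L2 h -> L2ip (fun x => k * f x) h = k * L2ip f h.
Proof.
move=> Lf Lh; rewrite /L2ip -RintegralZl//; last exact: L2_mul_integrable.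
by apply: eq_Rintegral => x _; rewrite mulrA.
Qed.

Lemma L2ipNl f h : L2 f -> L2 h -> L2ip (fun x => - f x) h = - L2ip f h.
Proof.
move=> Lf Lh; rewrite -mulN1r -L2ipZl//.
by apply: eq_Rintegral => x _; rewrite mulN1r.
Qed.

Lemma ae_eq_L2ip f g f' g' : measurable_fun D f -> measurable_fun D g ->
  measurable_fun D f' -> measurable_fun D g' ->
  (\forall x \ae mu, D x -> f x = f' x) ->
  (\forall x \ae mu, D x -> g x = g' x) -> L2ip f g = L2ip f' g'.
Proof.
move=> mf mg mf' mg' ff' gg'; congr fine; apply: ae_eq_integral => //.
- by apply/measurable_EFinP; exact: measurable_funM.
- by apply/measurable_EFinP; exact: measurable_funM.
- apply: filterS2 ff' gg' => x fx gx Dx /=.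
  by rewrite fx// gx.
Qed.

Lemma L2ip_ge0 f : 0 <= L2ip f f.
Proof. by apply: Rintegral_ge0 => x _; rewrite -expr2 sqr_ge0. Qed.

(** The quadratic polynomial t |-> |f + t g|^2 is nonnegative, which bounds its discriminant. *)
Lemma L2_cauchy_schwarz f g : L2 f -> L2 g ->
  `|L2ip f g| <= Num.sqrt (L2ip f f) * Num.sqrt (L2ip g g).
Proof.
move=> Lf Lg.
set a := L2ip f f; set b := L2ip f g; set c := L2ip g g.
have a0 : 0 <= a := L2ip_ge0 f.
have c0 : 0 <= c := L2ip_ge0 g.
have H (t : R) : 0 <= a + 2 * t * b + t ^+ 2 * c.
  have Ltg := L2Z t Lg; have Lftg := L2D Lf Ltg.
  have := L2ip_ge0 (fun x => f x + t * g x).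
  rewrite L2ipDl// L2ipZl// ![L2ip _ (fun x => f x + _)]L2ipC.
  rewrite !L2ipDl// !L2ipZl// (L2ipC g f) -/a -/b -/c.
  by congr (_ <= _); ring.
have bac : b ^+ 2 <= a * c.
  have [c00|cn0] := eqVneq c 0.
    have [->|bn0] := eqVneq b 0; first by rewrite expr0n/= mulr_ge0.
    (* For [c = 0] the polynomial is affine in t, and this t would give it the value -1. *)
    have := H (- (a + 1) / (2 * b)).
    rewrite c00 mulr0 addr0.
    have -> : 2 * (- (a + 1) / (2 * b)) * b = - (a + 1) by field.
    by lra.
  have cp : 0 < c by rewrite lt_neqAle eq_sym cn0.
  (* The minimizer of the polynomial. *)
  have := H (- b / c).
  have -> : a + 2 * (- b / c) * b + (- b / c) ^+ 2 * c = (a * c - b ^+ 2) / c.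
    by field.
  by rewrite pmulr_lge0 ?invr_gt0// subr_ge0.
rewrite -sqrtrM// -[leLHS]ger0_norm// -sqrtr_sqr ler_sqrt ?mulr_ge0//.
by rewrite real_normK ?num_real.
Qed.

Lemma sqrt_L2ip_triangle f g : L2 f -> L2 g ->
  Num.sqrt (L2ip (fun x => f x + g x) (fun x => f x + g x)) <=
  Num.sqrt (L2ip f f) + Num.sqrt (L2ip g g).
Proof.
move=> Lf Lg; have Lfg := L2D Lf Lg.
rewrite -[leRHS]ger0_norm ?addr_ge0 ?sqrtr_ge0// -sqrtr_sqr.
rewrite ler_sqrt ?sqr_ge0// sqrrD !sqr_sqrtr ?L2ip_ge0//.
rewrite L2ipDl// ![L2ip _ (fun x => f x + _)]L2ipC !L2ipDl//.
rewrite (L2ipC g f).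
have := le_trans (ler_norm _) (L2_cauchy_schwarz Lf Lg).
by rewrite mulr2n; lra.
Qed.

End L2theory.

(** * Matrix and vector fields *)

Section MeasurableMatrix.
Context {R : realType} {disp : measure_display} {T : measurableType disp}.
Variable D : set T.
Hypothesis mD : measurable D.

Lemma measurable_fun_sumr (I : Type) (s : seq I) (f : I -> T -> R) :
  (forall i, measurable_fun D (f i)) ->
  measurable_fun D (fun x => \sum_(i <- s) f i x).
Proof.
move=> mf; elim: s => [|i s IH].
  by under eq_fun do rewrite big_nil; exact: measurable_cst.
by under eq_fun do rewrite big_cons; exact: measurable_funD.
Qed.

Lemma measurable_fun_prodr (I : Type) (s : seq I) (f : I -> T -> R) :
  (forall i, measurable_fun D (f i)) ->
  measurable_fun D (fun x => \prod_(i <- s) f i x).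
Proof.
move=> mf; elim: s => [|i s IH].
  by under eq_fun do rewrite big_nil; exact: measurable_cst.
by under eq_fun do rewrite big_cons; exact: measurable_funM.
Qed.

Lemma measurable_fun_det n (M : T -> 'M[R]_n) :
  (forall i j, measurable_fun D (fun x => M x i j)) ->
  measurable_fun D (fun x => \det (M x)).
Proof.
move=> mM; apply: measurable_fun_sumr => s.
apply: measurable_funM; first exact: measurable_cst.
by apply: measurable_fun_prodr => i.
Qed.

(** Inversion is continuous off 0, and the single point 0 is split off. *)
Lemma measurable_invr : measurable_fun [set: R] (@GRing.inv R).
Proof.
rewrite -(setUCr [set 0 : R]); apply/measurable_funU => //.
  by apply: measurableC; exact: measurable_set1.
split; first exact: measurable_fun_set1.
apply: open_continuous_measurable_fun.
  by apply: closed_openC; exact: closed_eq.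
by move=> x /[!inE] /eqP x0; exact: inv_continuous.
Qed.

(** By convention [invmx] returns a singular matrix unchanged, so the entries follow the adjugate
    formula where the determinant is nonzero and are those of [M] elsewhere. *)
Lemma measurable_fun_invmx n (M : T -> 'M[R]_n) :
  (forall i j, measurable_fun D (fun x => M x i j)) ->
  forall i j, measurable_fun D (fun x => invmx (M x) i j).
Proof.
move=> mM i j; have mdet := measurable_fun_det mM.
rewrite (_ : (fun x => _) = (fun x => if ~~ (\det (M x) == 0)
    then (\det (M x))^-1 * cofactor (M x) j i else M x i j)); last first.
  apply/funext => x; rewrite /invmx unitmxE unitfE.
  by case: ifPn => // _; rewrite !mxE.
apply: measurable_fun_if => //.
- apply: measurable_neg; apply: measurable_fun_eqr => //; exact: measurable_cst.
- apply: (@measurable_funS _ _ _ _ D) => //.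
  apply: measurable_funM; first exact: measurableT_comp measurable_invr _.
  apply: measurable_funM; first exact: measurable_cst.
  apply: measurable_fun_det => a b.
  by under eq_fun do rewrite !mxE; exact: mM.
- by apply: (@measurable_funS _ _ _ _ D) => // x [].
Qed.

End MeasurableMatrix.

Section Dotv.
Context {R : realType} {d : nat}.
Implicit Types (u v w : 'rV[R]_d) (M : 'M[R]_d).

Lemma dotvE u v : dotv u v = (u *m v^T) ord0 ord0.
Proof. by rewrite mxE; apply: eq_bigr => i _; rewrite mxE. Qed.

Lemma dotv_delta u j : dotv u (delta_mx ord0 j) = u ord0 j.
Proof.
rewrite /dotv (bigD1 j)//= mxE !eqxx mulr1 big1 ?addr0// => l /negPf lj.
by rewrite mxE lj andbF mulr0.
Qed.

Lemma dotvC u v : dotv u v = dotv v u.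
Proof. by apply: eq_bigr => i _; rewrite mulrC. Qed.

Lemma dotv_ge0 u : 0 <= dotv u u.
Proof. by apply: sumr_ge0 => i _; rewrite -expr2 sqr_ge0. Qed.

Lemma sqr_enorm u : enorm u ^+ 2 = dotv u u.
Proof. by rewrite sqr_sqrtr// dotv_ge0. Qed.

Lemma dotv_eq0 u : dotv u u = 0 -> u = 0.
Proof.
move=> /eqP; rewrite psumr_eq0 => [/allP h|i _]; last by rewrite -expr2 sqr_ge0.
apply/rowP => i; rewrite mxE; apply/eqP.
by have := h i (mem_index_enum _); rewrite -expr2 sqrf_eq0.
Qed.

Lemma sqr_coord_le_dotv u i : u ord0 i ^+ 2 <= dotv u u.
Proof.
by rewrite /dotv (bigD1 i)//= -expr2 lerDl sumr_ge0// => j _; rewrite -expr2 sqr_ge0.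
Qed.

Lemma dotv_mxapp M u v : dotv (mxapp M u) v = dotv u (mxapp M^T v).
Proof. by rewrite !dotvE /mxapp trmx_mul !trmxK mulmxA. Qed.

Lemma mxappE M u i : mxapp M u ord0 i = \sum_j M i j * u ord0 j.
Proof. by rewrite mxE; apply: eq_bigr => j _; rewrite mxE mulrC. Qed.

Lemma mxappD M u v : mxapp M (u + v) = mxapp M u + mxapp M v.
Proof. exact: mulmxDl. Qed.

Lemma mxappN M u : mxapp M (- u) = - mxapp M u.
Proof. exact: mulNmx. Qed.

Lemma mxapp_Kinv M u : M \in unitmx -> mxapp M (mxapp (invmx M) u) = u.
Proof. by move=> uM; rewrite /mxapp trmx_inv mulmxKV// unitmx_tr. Qed.

Variables (M : 'M[R]_d) (a0 : R).
Hypotheses (a00 : 0 < a0)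
  (ellM : forall xi, a0 * enorm xi ^+ 2 <= dotv xi (mxapp M xi)).

(** A vector v of the kernel satisfies a0 |v|^2 <= 0. *)
Lemma elliptic_unitmx : M \in unitmx.
Proof.
rewrite unitmxE unitfE; apply/negP => /eqP d0.
have /det0P[v vn0 vM] : \det M^T == 0 by rewrite det_tr d0.
have := ellM v; rewrite /mxapp vM sqr_enorm.
have -> : dotv v 0 = 0 by apply: big1 => i _; rewrite mxE mulr0.
rewrite pmulr_rle0// => h; move/negP: vn0; apply; apply/eqP/dotv_eq0.
by apply/eqP; rewrite eq_le h dotv_ge0.
Qed.

(** Let w be the j-th column of the inverse. Ellipticity at w reads a0 |w|^2 <= w_j, which first
    gives a0 w_j <= 1 and then (a0 w_i)^2 <= a0^2 |w|^2 <= a0 w_j <= 1. *)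
Lemma elliptic_invmx_le i j : `|invmx M i j| <= a0^-1.
Proof.
pose w := mxapp (invmx M) (delta_mx ord0 j).
have wE k : w ord0 k = invmx M k j.
  rewrite mxappE (bigD1 j)//= mxE !eqxx mulr1 big1 ?addr0// => l /negPf lj.
  by rewrite mxE lj andbF mulr0.
have := ellM w; rewrite mxapp_Kinv ?elliptic_unitmx// sqr_enorm.
rewrite dotv_delta.
move=> h.
have hi := sqr_coord_le_dotv w i; have hj := sqr_coord_le_dotv w j.
rewrite -wE; set a := w ord0 i in hi *; set b := w ord0 j in h hj.
set s := dotv w w in h hi hj.
have b0 : 0 <= b by apply: le_trans h; rewrite mulr_ge0 ?dotv_ge0// ltW.
have ab : a0 * b <= 1.
  have [->|bn0] := eqVneq b 0; first by rewrite mulr0.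
  have bp : 0 < b by rewrite lt_neqAle eq_sym bn0.
  rewrite -(ler_pM2r bp) mul1r -mulrA -expr2.
  by apply: le_trans h; rewrite ler_pM2l.
have a2 : (a0 * a) ^+ 2 <= 1.
  rewrite exprMn expr2 -mulrA.
  apply: le_trans ab; rewrite ler_pM2l//.
  by apply: le_trans h; rewrite ler_pM2l.
rewrite -(ler_pM2l a00) mulfV ?gt_eqF//.
have : `|a0 * a| <= 1.
  by rewrite -(@ler_pXn2r _ 2)// ?nnegrE// real_normK ?num_real// expr1n.
by rewrite normrM (gtr0_norm a00).
Qed.

End Dotv.

(** * Norms and pairings of square-integrable vector fields *)

Section L2norm.
Context {R : realType} {disp : measure_display} {T : measurableType disp}.
Variables (mu : {measure set T -> \bar R}) (D : set T).
Hypothesis mD : measurable D.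
Implicit Types f g h : T -> R.

Local Notation L2 := (L2 mu D).
Local Notation Linfty := (Linfty mu D).

Lemma L2_subset (E : set T) f : measurable E -> E `<=` D -> L2 f -> Defs.L2 mu E f.
Proof.
move=> mE ED [mf foo]; split; first exact: measurable_funS mf.
apply: le_lt_trans foo; apply: ge0_subset_integral => //.
  by apply/measurable_EFinP; exact: measurable_funX.
by move=> x _; rewrite lee_fin sqr_ge0.
Qed.

Lemma Rintegral_sum (I : Type) (s : seq I) (f : I -> T -> R) :
  (forall i, mu.-integrable D (EFin \o f i)) ->
  mu.-integrable D (EFin \o (fun x => \sum_(i <- s) f i x)) /\
  \int[mu]_(x in D) (\sum_(i <- s) f i x) = \sum_(i <- s) \int[mu]_(x in D) f i x.
Proof.
move=> intf; elim: s => [|i s [IH1 IH2]].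
  split; first by under eq_fun do rewrite big_nil; exact: integrable0.
  rewrite big_nil; under eq_Rintegral do rewrite big_nil.
  by rewrite Rintegral_cst// mul0r.
split.
  rewrite (_ : EFin \o _ = (EFin \o f i) \+ (EFin \o (fun x => \sum_(j <- s) f j x))).
    exact: integrableD.
  by apply/funext => x /=; rewrite big_cons.
rewrite big_cons -IH2 -RintegralD//.
by apply: eq_Rintegral => x _; rewrite big_cons.
Qed.

Definition L2norm f := Num.sqrt (L2ip mu D f f).

Lemma L2norm_ge0 f : 0 <= L2norm f.
Proof. exact: sqrtr_ge0. Qed.

Lemma L2norm_sum_le (I : Type) (s : seq I) (f : I -> T -> R) :
  (forall i, L2 (f i)) ->
  L2norm (fun x => \sum_(i <- s) f i x) <= \sum_(i <- s) L2norm (f i).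
Proof.
move=> Lf; elim: s => [|i s IH].
  rewrite big_nil /L2norm /L2ip.
  under eq_Rintegral do rewrite big_nil mul0r.
  by rewrite Rintegral_cst// mul0r sqrtr0.
rewrite big_cons; apply: le_trans (lerD (lexx _) IH).
rewrite (_ : (fun x => _) = (fun x => f i x + \sum_(j <- s) f j x)).
  by apply: sqrt_L2ip_triangle => //; exact: L2_sum.
by apply/funext => x; rewrite big_cons.
Qed.

Lemma L2norm_Linfty_mul (m : T -> R) : Linfty m ->
  exists2 M : R, 0 <= M & forall f, L2 f -> L2norm (fun x => m x * f x) <= M * L2norm f.
Proof.
(* The almost everywhere bound [M] may be negative when [D] is null, hence the absolute value. *)
move=> Lm; have [mm [M mM]] := Lm; exists `|M| => // f Lf; have [mf _] := Lf.
have Lmf := L2_Linfty_mul mD Lm Lf; have [mmf _] := Lmf.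
rewrite -[`|M|]ger0_norm// -sqrtr_sqr -sqrtrM ?sqr_ge0// ler_sqrt; last first.
  by rewrite mulr_ge0 ?sqr_ge0// L2ip_ge0.
rewrite /L2ip -RintegralZl//; last exact: L2_mul_integrable.
have I1 := L2_mul_integrable mD Lmf Lmf.
have I2 := L2_mul_integrable mD Lf Lf.
have I3 : mu.-integrable D (EFin \o (fun x => `|M| ^+ 2 * (f x * f x))).
  by have := integrableZl mD (`|M| ^+ 2) I2.
rewrite /Rintegral fine_le ?integrable_fin_num//.
apply: ae_ge0_le_integral => //.
- by move=> x _; rewrite lee_fin -expr2 sqr_ge0.
- exact: measurable_int I1.
- by move=> x _; rewrite lee_fin mulr_ge0 ?sqr_ge0// -expr2 sqr_ge0.
- exact: measurable_int I3.
apply: filterS mM => x h Dx; rewrite lee_fin -!expr2 exprMn.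
rewrite ler_wpM2r ?sqr_ge0// -(real_normK (num_real (m x))).
by rewrite lerXn2r ?nnegrE// (le_trans (h Dx))// ler_norm.
Qed.

Context {d : nat}.
Implicit Types F G H : T -> 'rV[R]_d.

(** With [vip] and [vnorm], the versions of [L2v], [ipv] and [norm0v] over an arbitrary measure; for
    Lebesgue measure they are convertible with them. *)
Definition vL2 F := forall i, L2 (fun x => F x ord0 i).
Definition vip F G : R := \int[mu]_(x in D) dotv (F x) (G x).
Definition vnorm F : R := Num.sqrt (vip F F).

Lemma vL2D F G : vL2 F -> vL2 G -> vL2 (F + G).
Proof.
move=> LF LG i; rewrite (_ : (fun x => _) = (fun x => F x ord0 i + G x ord0 i)).
  exact: (L2D mD (LF i) (LG i)).
by apply/funext => x; rewrite mxE.
Qed.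

Lemma vL2N F : vL2 F -> vL2 (- F).
Proof.
move=> LF i; rewrite (_ : (fun x => _) = (fun x => - F x ord0 i)).
  exact: (L2N mD (LF i)).
by apply/funext => x; rewrite mxE.
Qed.

Lemma vL2_mxapp (M : T -> 'M[R]_d) F : (forall i j, Linfty (fun x => M x i j)) ->
  vL2 F -> vL2 (fun x => mxapp (M x) (F x)).
Proof.
move=> LM LF i; under eq_fun do rewrite mxappE.
by apply: L2_sum => // j; apply: L2_Linfty_mul.
Qed.

Lemma vL2_scale (b : T -> 'rV[R]_d) f : (forall i, Linfty (fun x => b x ord0 i)) ->
  L2 f -> vL2 (fun x => f x *: b x).
Proof.
move=> Lb Lf i; rewrite (_ : (fun x => _) = (fun x => b x ord0 i * f x)).
  exact: L2_Linfty_mul.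
by apply/funext => x; rewrite mxE mulrC.
Qed.

Lemma L2_dotv_Linfty (b : T -> 'rV[R]_d) F : (forall i, Linfty (fun x => b x ord0 i)) ->
  vL2 F -> L2 (fun x => dotv (b x) (F x)).
Proof. by move=> Lb LF; apply: L2_sum => // i; apply: L2_Linfty_mul. Qed.

Lemma vip_integrable F G : vL2 F -> vL2 G ->
  mu.-integrable D (EFin \o (fun x => dotv (F x) (G x))).
Proof.
move=> LF LG.
by have [] := @Rintegral_sum _ (index_enum 'I_d) (fun i x => F x ord0 i * G x ord0 i)
   (fun i => L2_mul_integrable mD (LF i) (LG i)).
Qed.

Lemma vipE F G : vL2 F -> vL2 G ->
  vip F G = \sum_i L2ip mu D (fun x => F x ord0 i) (fun x => G x ord0 i).
Proof.
move=> LF LG.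
by have [] := @Rintegral_sum _ (index_enum 'I_d) (fun i x => F x ord0 i * G x ord0 i)
   (fun i => L2_mul_integrable mD (LF i) (LG i)).
Qed.

Lemma vipC F G : vip F G = vip G F.
Proof. by apply: eq_Rintegral => x _; rewrite dotvC. Qed.

Lemma vipDl F G H : vL2 F -> vL2 G -> vL2 H -> vip (F + G) H = vip F H + vip G H.
Proof.
move=> LF LG LH; rewrite /vip -RintegralD//; try exact: vip_integrable.
apply: eq_Rintegral => x _; rewrite /dotv -big_split; apply: eq_bigr => i _.
by rewrite mxE mulrDl.
Qed.

Lemma vipNl F H : vL2 F -> vL2 H -> vip (- F) H = - vip F H.
Proof.
move=> LF LH; rewrite -mulN1r /vip -RintegralZl//; last exact: vip_integrable.
apply: eq_Rintegral => x _; rewrite mulN1r -sumrN; apply: eq_bigr => i _.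
by rewrite mxE mulNr.
Qed.

Lemma vipDr F G H : vL2 F -> vL2 G -> vL2 H -> vip H (F + G) = vip H F + vip H G.
Proof. by move=> LF LG LH; rewrite vipC vipDl// vipC (vipC G). Qed.

Lemma vipNr F H : vL2 F -> vL2 H -> vip H (- F) = - vip H F.
Proof. by move=> LF LH; rewrite vipC vipNl// vipC. Qed.

Lemma ae_eq_vip F G F' G' : vL2 F -> vL2 G -> vL2 F' -> vL2 G' ->
  (\forall x \ae mu, D x -> dotv (F x) (G x) = dotv (F' x) (G' x)) ->
  vip F G = vip F' G'.
Proof.
move=> LF LG LF' LG' h; congr fine; apply: ae_eq_integral => //.
- exact: measurable_int (vip_integrable LF LG).
- exact: measurable_int (vip_integrable LF' LG').
- by apply: filterS h => x h Dx /=; rewrite h.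
Qed.

Lemma ae_rowP F G : (forall i, \forall x \ae mu, D x -> F x ord0 i = G x ord0 i) ->
  \forall x \ae mu, D x -> F x = G x.
Proof.
move=> FG.
have : \forall x \ae mu, forall i : 'I_d, D x -> F x ord0 i = G x ord0 i.
  exact: filter_forall.
by apply: filterS => x h Dx; apply/rowP => i; exact: h.
Qed.

Lemma vip_ge0 F : 0 <= vip F F.
Proof. by apply: Rintegral_ge0 => x _; exact: dotv_ge0. Qed.

Lemma vnorm_ge0 F : 0 <= vnorm F.
Proof. exact: sqrtr_ge0. Qed.

Lemma L2norm_coord_le F i : vL2 F -> L2norm (fun x => F x ord0 i) <= vnorm F.
Proof.
move=> LF; rewrite ler_sqrt ?vip_ge0// vipE// (bigD1 i)//= lerDl.
by apply: sumr_ge0 => j _; exact: L2ip_ge0.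
Qed.

Lemma vnorm_le_sum F : vL2 F -> vnorm F <= \sum_i L2norm (fun x => F x ord0 i).
Proof.
move=> LF; have S0 : 0 <= \sum_i L2norm (fun x => F x ord0 i).
  by apply: sumr_ge0 => i _; exact: L2norm_ge0.
rewrite -[leRHS]ger0_norm// -sqrtr_sqr ler_sqrt ?sqr_ge0// vipE//.
elim: (index_enum _) => [|i s IH]; first by rewrite !big_nil expr0n.
rewrite !big_cons sqrrD sqr_sqrtr ?L2ip_ge0// -addrA lerD2l.
apply: (le_trans IH); rewrite lerDr mulrn_wge0// mulr_ge0 ?L2norm_ge0//.
by apply: sumr_ge0 => j _; exact: L2norm_ge0.
Qed.

(** Scalar Cauchy-Schwarz in each coordinate, each term then being bounded by the full norms. The
    loss of the factor d is harmless, only the existence of a constant being at stake. *)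
Lemma vip_le F G : vL2 F -> vL2 G -> `|vip F G| <= d%:R * (vnorm F * vnorm G).
Proof.
move=> LF LG; rewrite vipE//; apply: (le_trans (ler_norm_sum _ _ _)).
rewrite -[d in d%:R]card_ord mulr_natl -sumr_const; apply: ler_sum => i _.
apply: (le_trans (L2_cauchy_schwarz mD (LF i) (LG i))).
by apply: ler_pM; rewrite ?sqrtr_ge0//; exact: L2norm_coord_le.
Qed.

Lemma vnormD_le F G : vL2 F -> vL2 G -> vnorm (F + G) <= d%:R * (vnorm F + vnorm G).
Proof.
move=> LF LG; apply: (le_trans (vnorm_le_sum (vL2D LF LG))).
rewrite -[d in d%:R]card_ord mulr_natl -sumr_const; apply: ler_sum => i _.
rewrite (_ : (fun x => _) = (fun x => F x ord0 i + G x ord0 i)); last first.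
  by apply/funext => x; rewrite mxE.
apply: (le_trans (sqrt_L2ip_triangle mD (LF i) (LG i))).
by apply: lerD; exact: L2norm_coord_le.
Qed.

Lemma vnormN F : vnorm (- F) = vnorm F.
Proof.
congr Num.sqrt; apply: eq_Rintegral => x _; apply: eq_bigr => i _.
by rewrite mxE mulrNN.
Qed.

Lemma ae_eq_vnorm F G : vL2 F -> vL2 G -> (\forall x \ae mu, D x -> F x = G x) ->
  vnorm F = vnorm G.
Proof.
move=> LF LG FG; congr Num.sqrt; apply: ae_eq_vip => //.
by apply: filterS FG => x h Dx; rewrite h.
Qed.

Lemma vnorm_mxapp_le (M : T -> 'M[R]_d) : (forall i j, Linfty (fun x => M x i j)) ->
  exists2 K : R, 0 <= K & forall F, vL2 F ->
    vnorm (fun x => mxapp (M x) (F x)) <= K * vnorm F.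
Proof.
move=> LM.
have h (ij : 'I_d * 'I_d) : exists K, 0 <= K /\ forall f, L2 f ->
    L2norm (fun x => M x ij.1 ij.2 * f x) <= K * L2norm f.
  by have [K K0 KE] := L2norm_Linfty_mul (LM ij.1 ij.2); exists K.
(* One bound per entry is chosen before the field [F], so that the final constant is uniform in
   [F]. *)
have [K KE] := choice h.
exists (\sum_i \sum_j K (i, j)).
  by apply: sumr_ge0 => i _; apply: sumr_ge0 => j _; have [] := KE (i, j).
move=> F LF; apply: (le_trans (vnorm_le_sum (vL2_mxapp LM LF))).
rewrite mulr_suml; apply: ler_sum => i _.
under eq_fun do rewrite mxappE.
apply: le_trans (L2norm_sum_le _ _) _.
  by move=> j; apply: L2_Linfty_mul.
rewrite mulr_suml; apply: ler_sum => j _; have [K0 KL] := KE (i, j).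
apply: le_trans (KL _ (LF j)) _.
by rewrite ler_wpM2l//; exact: L2norm_coord_le.
Qed.

Lemma vnorm_scale_le (b : T -> 'rV[R]_d) : (forall i, Linfty (fun x => b x ord0 i)) ->
  exists2 K : R, 0 <= K & forall f, L2 f ->
    vnorm (fun x => f x *: b x) <= K * L2norm f.
Proof.
move=> Lb.
have h i : exists K, 0 <= K /\ forall f, L2 f ->
    L2norm (fun x => b x ord0 i * f x) <= K * L2norm f.
  by have [K K0 KE] := L2norm_Linfty_mul (Lb i); exists K.
have [K KE] := choice h.
exists (\sum_i K i); first by apply: sumr_ge0 => i _; have [] := KE i.
move=> f Lf; apply: (le_trans (vnorm_le_sum (vL2_scale Lb Lf))).
rewrite mulr_suml; apply: ler_sum => i _; have [_ KL] := KE i.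
rewrite (_ : (fun x => _) = (fun x => b x ord0 i * f x)); first exact: KL.
by apply/funext => x; rewrite mxE mulrC.
Qed.

Lemma L2norm_dotv_le (b : T -> 'rV[R]_d) : (forall i, Linfty (fun x => b x ord0 i)) ->
  exists2 K : R, 0 <= K & forall F, vL2 F ->
    L2norm (fun x => dotv (b x) (F x)) <= K * vnorm F.
Proof.
move=> Lb.
have h i : exists K, 0 <= K /\ forall f, L2 f ->
    L2norm (fun x => b x ord0 i * f x) <= K * L2norm f.
  by have [K K0 KE] := L2norm_Linfty_mul (Lb i); exists K.
have [K KE] := choice h.
exists (\sum_i K i); first by apply: sumr_ge0 => i _; have [] := KE i.
move=> F LF; apply: le_trans (L2norm_sum_le _ _) _.
  by move=> i; apply: L2_Linfty_mul.
rewrite mulr_suml; apply: ler_sum => i _; have [K0 KL] := KE i.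
apply: le_trans (KL _ (LF i)) _.
by rewrite ler_wpM2l//; exact: L2norm_coord_le.
Qed.

End L2norm.

(** * Lebesgue measure on R^d *)

Section CoverExt.
Context {R : realType} {T : pointedType}.
Variable zeta : set T -> \bar R.

Lemma cover_ext_le (F : (set T)^nat) (X : set T) : X `<=` \bigcup_k F k ->
  (cover_ext zeta X <= \sum_(k <oo) zeta (F k))%E.
Proof.
move=> XF; apply: ereal_inf_lbound; exists F => //; split => // k.
exact: sub_gen_smallest.
Qed.

Lemma le_cover_extP (X : set T) (c : \bar R) :
  (forall F : (set T)^nat, X `<=` \bigcup_k F k ->
    (c <= \sum_(k <oo) zeta (F k))%E) ->
  (c <= cover_ext zeta X)%E.
Proof. by move=> h; apply: le_ereal_inf_tmp => _ [F [_ XF] <-]; exact: h. Qed.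

Lemma cover_ext_adherent (X : set T) (e : R) : 0 < e ->
  cover_ext zeta X \is a fin_num ->
  exists2 F : (set T)^nat, X `<=` \bigcup_k F k &
    (\sum_(k <oo) zeta (F k) < cover_ext zeta X + e%:E)%E.
Proof.
move=> e0 fX; have [_ [F [_ XF] <-] h] := lb_ereal_inf_adherent e0 fX.
by exists F.
Qed.

End CoverExt.

Section LebesgueTheory.
Context {R : realType} {d : nat}.
Implicit Types (l r x v : 'rV[R]_d) (X F : set 'rV[R]_d).

Definition obox l r : set 'rV[R]_d :=
  [set x | forall i, l ord0 i < x ord0 i < r ord0 i].

Lemma box_vol_set0 : box_vol (set0 : set 'rV[R]_d) = 0%E.
Proof. by rewrite /box_vol; case: asboolP. Qed.

Lemma box_vol_ge0 X : (0 <= box_vol X)%E.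
Proof.
rewrite /box_vol; case: asboolP => [//|/eqP/set0P[x Xx]].
apply: le_ereal_inf_tmp => _ [l [r [XE ->]]]; rewrite lee_fin.
apply: prodr_ge0 => i _; rewrite subr_ge0.
by move: Xx; rewrite XE => /(_ i) /andP[]; exact: le_trans.
Qed.
Local Hint Resolve box_vol_ge0 : core.

Lemma box_vol_cbox l r : (forall i, l ord0 i <= r ord0 i) ->
  (box_vol (cbox l r) <= (\prod_(i < d) (r ord0 i - l ord0 i))%:E)%E.
Proof.
move=> lr; rewrite /box_vol; case: asboolP => _.
  by rewrite lee_fin; apply: prodr_ge0 => i _; rewrite subr_ge0.
by apply: ereal_inf_lbound; exists l, r.
Qed.

Lemma box_vol_lty F : (box_vol F < +oo)%E ->
  F = set0 \/ exists l r, F = cbox l r.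
Proof.
rewrite /box_vol; case: asboolP => [->|_]; first by left.
by move=> /ereal_inf_lt[_ [l [r [-> _]]] _]; right; exists l, r.
Qed.

Let upd r (i : 'I_d) (a : R) : 'rV[R]_d :=
  \row_j (if j == i then a else r ord0 j).

(** Cutting with two closed half-spaces keeps both pieces closed boxes; the face they share
    contributes no volume. If the hyperplane misses the box, one piece is empty. A set that is not a
    box has volume +oo. *)
Lemma box_vol_split F (i : 'I_d) (a : R) :
  (box_vol (F `&` [set x | ((x : 'rV_d) ord0 i <= a)%R]) +
   box_vol (F `&` [set x | (a <= (x : 'rV_d) ord0 i)%R]) <= box_vol F)%E.
Proof.
have [->|/set0P Fn0] := eqVneq F set0.
  by rewrite !set0I box_vol_set0 adde0.
rewrite {3}/box_vol; case: asboolP => [F0|_].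
  by move: Fn0; rewrite F0 => -[].
apply: le_ereal_inf_tmp => _ [l [r [FE ->]]].
subst F.
have lr j : l ord0 j <= r ord0 j.
  by move: Fn0 => -[x /(_ j)/andP[]]; exact: le_trans.
have [ali|lia] := ltP a (l ord0 i).
  rewrite (_ : cbox l r `&` _ = set0) ?box_vol_set0 ?add0e; last first.
    rewrite -subset0 => x [] => /(_ i)/andP[lx _] /= xa.
    by have := lt_le_trans ali lx; rewrite ltNge xa.
  rewrite (_ : cbox l r `&` _ = cbox l r); first exact: box_vol_cbox.
  apply/seteqP; split => x; first by case.
  by move=> lxr; split => //=; have /andP[lx _] := lxr i; lra.
have [ari|ria] := ltP (r ord0 i) a.
  rewrite [X in (_ + box_vol X)%E](_ : _ = set0) ?box_vol_set0 ?adde0; last first.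
    rewrite -subset0 => x [] => /(_ i)/andP[_ xr] /= xa.
    by lra.
  rewrite (_ : cbox l r `&` _ = cbox l r); first exact: box_vol_cbox.
  apply/seteqP; split => x; first by case.
  by move=> lxr; split => //=; have /andP[_ xr] := lxr i; lra.
rewrite (_ : cbox l r `&` _ = cbox l (upd r i a)); last first.
  apply/seteqP; split => x.
    move=> [xlr /= xa] j; rewrite mxE; case: eqP => [->|_]; last exact: xlr.
    by have /andP[-> _] := xlr i.
  move=> xlr; split.
    move=> j; have := xlr j; rewrite mxE; case: eqP => [->|//].
    by move=> /andP[-> xa]; apply: le_trans ria.
  by have := xlr i; rewrite mxE eqxx => /andP[].
rewrite [X in (_ + box_vol X)%E](_ : _ = cbox (upd l i a) r); last first.
  apply/seteqP; split => x.
    move=> [xlr /= xa] j; rewrite mxE; case: eqP => [->|_]; last exact: xlr.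
    by have /andP[_ ->] := xlr i; rewrite xa.
  move=> xlr; split.
    move=> j; have := xlr j; rewrite mxE; case: eqP => [->|//].
    by move=> /andP[xa ->]; rewrite (le_trans lia).
  by have := xlr i; rewrite mxE eqxx => /andP[].
apply: le_trans (leeD (box_vol_cbox _) (box_vol_cbox _)) _.
- by move=> j; rewrite mxE; case: eqP => [->|_].
- by move=> j; rewrite mxE; case: eqP => [->|_].
rewrite -EFinD lee_fin !(bigD1 (P := xpredT) i)//= !mxE eqxx.
set p := \prod_(j < d | j != i) (r ord0 j - l ord0 j).
rewrite [X in _ * X + _](_ : _ = p); last first.
  by apply: eq_bigr => j /negPf ji; rewrite mxE ji.
rewrite [X in _ + _ * X](_ : _ = p); last first.
  by apply: eq_bigr => j /negPf ji; rewrite mxE ji.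
by rewrite -mulrDl addrC addrA subrK.
Qed.

(** Splitting each member of a cover of [X] yields covers of both pieces. Inclusions instead of
    equalities allow one piece to be cut by an open half-space, as the complement in Caratheodory's
    condition is. *)
Lemma lebesgue_outer_split X X1 X2 (i : 'I_d) (a : R) :
  X1 `<=` X `&` [set x | (x : 'rV_d) ord0 i <= a] ->
  X2 `<=` X `&` [set x | (a <= (x : 'rV_d) ord0 i)%R] ->
  (lebesgue_outer X1 + lebesgue_outer X2 <= lebesgue_outer X)%E.
Proof.
move=> X1E X2E; apply: le_cover_extP => F XF.
apply: le_trans (lee_nneseries _ (fun k _ => box_vol_split (F k) i a)); last first.
  by move=> k *; rewrite adde_ge0.
rewrite nneseriesD//; apply: leeD; apply: cover_ext_le => x.
- by move=> /X1E[/XF[k _ Fkx] xa]; exists k.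
- by move=> /X2E[/XF[k _ Fkx] xa]; exists k.
Qed.

Lemma measurable_halfspace_le (i : 'I_d) (a : R) :
  measurable ([set x : 'rV[R]_d | x ord0 i <= a] : set (Rd R d)).
Proof.
apply: le_caratheodory_measurable => X.
apply: (@lebesgue_outer_split _ _ _ i a) => // x [Xx /= /negP].
by rewrite -ltNge => /ltW.
Qed.

Lemma measurable_halfspace_ge (i : 'I_d) (a : R) :
  measurable ([set x : 'rV[R]_d | a <= x ord0 i] : set (Rd R d)).
Proof.
apply: le_caratheodory_measurable => X; rewrite addeC.
apply: (@lebesgue_outer_split _ _ _ i a) => // x [Xx /= /negP].
by rewrite -ltNge => /ltW.
Qed.

Lemma measurable_cbox l r : measurable (cbox l r : set (Rd R d)).
Proof.
rewrite (_ : cbox l r = \bigcap_(i in [set: 'I_d])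
  ([set x | l ord0 i <= (x : 'rV_d) ord0 i] `&`
   [set x | (x : 'rV_d) ord0 i <= r ord0 i])).
  apply: fin_bigcap_measurable => // i _.
  apply: measurableI; first exact: measurable_halfspace_ge.
  exact: measurable_halfspace_le.
apply/seteqP; split => x; first by move=> xlr i _; apply/andP; exact: xlr.
by move=> xlr i; apply/andP; exact: xlr.
Qed.

Lemma measurable_obox l r : measurable (obox l r : set (Rd R d)).
Proof.
rewrite (_ : obox l r = \bigcap_(i in [set: 'I_d])
  (~` [set x | (x : 'rV_d) ord0 i <= l ord0 i] `&`
   ~` [set x | r ord0 i <= (x : 'rV_d) ord0 i])).
  apply: fin_bigcap_measurable => // i _.
  apply: measurableI; apply: measurableC; first exact: measurable_halfspace_le.
  exact: measurable_halfspace_ge.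
apply/seteqP; split => x.
  move=> xlr i _; have /andP[lx xr] := xlr i.
  by split => /=; apply/negP; rewrite -ltNge.
move=> xlr i; have [/= /negP lx /negP xr] := xlr i I.
by rewrite !ltNge lx xr.
Qed.

(** Rational corners make the boxes countable. The closed box must lie in [U] because it is what
    contains the support of a bump function on the open box. *)
Lemma open_cover_obox (U : set 'rV[R]_d) : open U -> forall x, U x ->
  exists p q : 'rV[rat]_d, obox (map_mx ratr p) (map_mx ratr q) x /\
     cbox (map_mx ratr p) (map_mx ratr q) `<=` U.
Proof.
move=> oU x Ux; have /nbhs_ballP[e /= e0 xeU] : nbhs x U by exact: open_nbhs_nbhs.
have hp i : exists q : rat, ratr q \in `](x ord0 i - e), (x ord0 i)[.
  by have [|q qi] := @rat_in_itvoo R (x ord0 i - e) (x ord0 i); [lra|exists q].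
have hq i : exists q : rat, ratr q \in `](x ord0 i), (x ord0 i + e)[.
  by have [|q qi] := @rat_in_itvoo R (x ord0 i) (x ord0 i + e); [lra|exists q].
have [p pE] := choice hp; have [q qE] := choice hq.
exists (\row_i p i), (\row_i q i); split.
  move=> i; rewrite !mxE; have := pE i; have := qE i; rewrite !in_itv/=.
  by move=> /andP[-> _] /andP[_ ->].
move=> y ypq; apply: xeU; split => // i j; rewrite (ord1 i).
have := ypq j; rewrite !mxE; have := pE j; have := qE j; rewrite !in_itv/=.
move=> /andP[q1 q2] /andP[p1 p2] /andP[y1 y2].
by rewrite /ball/= ltr_norml; apply/andP; split; lra.
Qed.

Lemma open_bigcup_obox (U : set 'rV[R]_d) : open U ->
  U = \bigcup_(pq in [set pq : 'rV[rat]_d * 'rV[rat]_d |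
     cbox (map_mx ratr pq.1) (map_mx ratr pq.2) `<=` U])
     obox (map_mx ratr pq.1) (map_mx ratr pq.2).
Proof.
move=> oU; apply/seteqP; split => [x Ux|x [[p q] /= pqU xpq]].
  by have [p [q [xpq pqU]]] := open_cover_obox oU Ux; exists (p, q).
by apply: pqU => i; have /andP[/ltW-> /ltW->] := xpq i.
Qed.

Lemma open_measurable_Rd (U : set 'rV[R]_d) : open U ->
  measurable (U : set (Rd R d)).
Proof.
move=> oU; rewrite (open_bigcup_obox oU) bigcup_mkcond.
apply: countable_bigcupT_measurable => // -[p q].
by case: ifPn => _; [exact: measurable_obox|exact: measurable0].
Qed.

Lemma measurable_fun_continuous (f : 'rV[R]_d -> R) : continuous f ->
  measurable_fun setT (f : Rd R d -> R).
Proof.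
move=> /continuousP cf; apply: (measurability _ (RGenOpens.measurableE R)).
move=> _ [_ [a [b ->] <-]]; rewrite setTI; apply: open_measurable_Rd.
exact/cf/interval_open.
Qed.

Lemma leb_cbox_lty l r : (leb R d (cbox l r) < +oo)%E.
Proof.
have [->|/set0P n0] := eqVneq (cbox l r) set0; first by rewrite measure0.
have lr i : l ord0 i <= r ord0 i.
  by have [x /(_ i)/andP[]] := n0; exact: le_trans.
pose F (k : nat) : set 'rV[R]_d := if k == 0 then cbox l r else set0.
have := @cover_ext_le R _ (@box_vol R d) F (cbox l r).
rewrite nneseries_recl// eseries0 ?adde0; last first.
  by case=> // n _ _; rewrite box_vol_set0.
move=> /(_ (bigcup_sup (i := 0%N) I)) /le_lt_trans; apply.
exact: le_lt_trans (box_vol_cbox lr) (ltry _).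
Qed.

Lemma ler_coord_norm x i : `|x ord0 i| <= `|x|.
Proof.
change (`|x ord0 i| <= mx_norm x); rewrite mx_normrE.
by apply: (le_bigmax _ (fun j : 'I_1 * 'I_d => `|x j.1 j.2|) (ord0, i)).
Qed.

Lemma bounded_subset_cbox X : bounded_set X ->
  exists M : R, 0 < M /\ X `<=` obox (const_mx (- M)) (const_mx M).
Proof.
move=> [M [Mreal XM]].
exists (`|M| + 2); split => [|x Xx i]; first by rewrite ltr_pwDr.
rewrite !mxE -ltr_norml.
have xM : `|x| <= `|M| + 1.
  by apply: XM => //; rewrite (le_lt_trans (ler_norm _))// ltrDl.
apply: (@le_lt_trans _ _ `|x|); last first.
  by apply: le_lt_trans xM _; rewrite ltrD2l ltr1n.
exact: ler_coord_norm.
Qed.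

Lemma bounded_leb_lty X : bounded_set X -> measurable (X : set (Rd R d)) ->
  (leb R d X < +oo)%E.
Proof.
move=> /bounded_subset_cbox[M [_ XM]] mX.
apply: le_lt_trans (leb_cbox_lty (const_mx (- M)) (const_mx M)).
apply: le_outer_measure => x /XM xM i.
by have /andP[/ltW-> /ltW->] := xM i.
Qed.

Definition shift_set v X : set 'rV[R]_d := [set x | X (x + v)].

Lemma shift_set_cbox v l r : shift_set v (cbox l r) = cbox (l - v) (r - v).
Proof.
by apply/seteqP; split => x /= xlr i; have := xlr i; rewrite !mxE; lra.
Qed.

Lemma box_vol_shift v F : (box_vol (shift_set v F) <= box_vol F)%E.
Proof.
have [->|/set0P Fn0] := eqVneq F set0.
  by rewrite (_ : shift_set v set0 = set0) ?box_vol_set0.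
rewrite {2}/box_vol; case: asboolP => [F0|_].
  by move: Fn0; rewrite F0 => -[].
apply: le_ereal_inf_tmp => _ [l [r [FE ->]]]; rewrite FE shift_set_cbox.
apply: le_trans (box_vol_cbox _) _.
  by move: Fn0; rewrite FE => -[x xlr] i; have := xlr i; rewrite !mxE; lra.
by rewrite lee_fin le_eqVlt; apply/orP; left; apply/eqP; apply: eq_bigr => i _;
  rewrite !mxE; ring.
Qed.

Lemma lebesgue_outer_shift v X :
  lebesgue_outer (shift_set v X) = lebesgue_outer X.
Proof.
have H w Y : (lebesgue_outer (shift_set w Y) <= lebesgue_outer Y)%E.
  apply: le_cover_extP => F YF.
  apply: le_trans (lee_nneseries _ (fun k _ => box_vol_shift w (F k))) => //.
  by apply: cover_ext_le => x /YF[k _ Fk]; exists k.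
apply/eqP; rewrite eq_le H/=.
have := H (- v) (shift_set v X); congr (lebesgue_outer _ <= _)%E.
by apply/seteqP; split => x; rewrite /shift_set/= subrK.
Qed.

(** Caratheodory's condition for the translate of [X], tested on [Y], is the condition for [X]
    tested on [Y] translated back. *)
Lemma measurable_shift v : measurable_fun setT ((fun x => x + v) : Rd R d -> Rd R d).
Proof.
move=> _ X mX; rewrite setTI.
suff : (@lebesgue_outer R d).-caratheodory (shift_set v X) by [].
move=> Y.
rewrite -(lebesgue_outer_shift (- v) Y) -(lebesgue_outer_shift (- v) (Y `&` _)).
rewrite -(lebesgue_outer_shift (- v) (Y `&` ~` _)).
have E Z : shift_set (- v) (Y `&` shift_set v Z) = shift_set (- v) Y `&` Z.
  by apply/seteqP; split => x; rewrite /shift_set/= subrK.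
rewrite E (_ : ~` shift_set v X = shift_set v (~` X))// E.
exact: mX.
Qed.

(** [G] is the intersection over n of the unions of covers whose total volume exceeds the outer
    measure by less than 1/(n+1). Finite total volume forces the members to be closed boxes or
    empty, which places [G] in the generated sigma-algebra. *)
Lemma leb_hull X : (lebesgue_outer X < +oo)%E ->
  exists G, [/\ <<s [set cbox l r | l in setT & r in setT] >> G, X `<=` G &
    (lebesgue_outer G <= lebesgue_outer X)%E].
Proof.
move=> Xoo.
have Xfin : lebesgue_outer X \is a fin_num.
  by rewrite ge0_fin_numE//; exact: cover_ext_ge0.
have h n : exists F : (set 'rV[R]_d)^nat, X `<=` \bigcup_k F k /\
    (\sum_(k <oo) box_vol (F k) < lebesgue_outer X + (n.+1%:R^-1)%:E)%E.
  have [|F XF Fs] := @cover_ext_adherent R _ (@box_vol R d) X n.+1%:R^-1 _ Xfin.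
    by rewrite invr_gt0.
  by exists F.
have [F FE] := choice h.
have foo n k : (box_vol (F n k) < +oo)%E.
  have [_ Fn] := FE n.
  apply: (@le_lt_trans _ _ (\sum_(k <oo) box_vol (F n k))%E); last first.
    apply: lt_trans Fn _; rewrite -(fineK Xfin) -EFinD; exact: ltry.
  by rewrite (nneseriesD1 (n := k))// leeDl// nneseries_ge0.
exists (\bigcap_n \bigcup_k F n k); split.
- set G := [set cbox l r | l in setT & r in setT].
  suff : @measurable _ (g_sigma_algebraType G) (\bigcap_n \bigcup_k F n k) by [].
  apply: bigcap_measurableType => n _; apply: bigcup_measurable => k _.
  have [->|[l [r ->]]] := box_vol_lty (foo n k); first exact: measurable0.
  by apply: sub_gen_smallest; exists l => //; exists r.
- by move=> x Xx n _; have [XF _] := FE n; exact: XF.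
- apply/lee_addgt0Pr => e e0.
  have [n ne] := exists_invS_lt e0; have [_ Fn] := FE n.
  apply: (@le_trans _ _ (lebesgue_outer (\bigcup_k F n k))).
    by apply: le_cover_ext => x; exact.
  apply: le_trans (@cover_ext_le R _ (@box_vol R d) (F n) _ (fun _ => id)) _.
  by apply: le_trans (ltW Fn) _; rewrite leeD2l// lee_fin ltW.
Qed.

End LebesgueTheory.

(** * Borel sets are Hausdorff measurable *)

Section MetricOuterMeasure.
Context {R : realType} {V : normedModType R}.
Variable mu : {outer_measure set V -> \bar R}.
Hypothesis mu_metric : forall (A B : set V) (e : R), 0 < e ->
  (forall a b, A a -> B b -> e <= `|a - b|) ->
  (mu A + mu B <= mu (A `|` B))%E.

(* Caratheodory's criterion: [A n] is the part of [X] at distance at least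
   1/(n+1) from [C].  Layers [S k] and [S l] with [k + 2 <= l] are a positive
   distance apart, so that the even and the odd layers have finite total
   measure, and [mu (A n)] tends to [mu (X `\` C)]. *)
Lemma closed_caratheodory (C : set V) : closed C -> mu.-caratheodory C.
Proof.
move=> cC; apply: le_caratheodory_measurable => X.
have [->|Xnoo] := eqVneq (mu X) +oo%E; first exact: leey.
have Xoo : (mu X < +oo)%E by rewrite ltey.
have mu0 Y : (0 <= mu Y)%E by exact: outer_measure_ge0.
pose A n : set V := [set x | X x /\ forall c, C c -> n.+1%:R^-1 <= `|x - c|].
pose S n := A n.+1 `\` A n.
have muXA n : (mu (X `&` C) + mu (A n) <= mu X)%E.
  apply: (@le_trans _ _ (mu ((X `&` C) `|` A n))).
    apply: (@mu_metric _ _ n.+1%:R^-1); first by rewrite invr_gt0.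
    by move=> a b [_ Ca] [_ /(_ _ Ca)]; rewrite distrC.
  by apply: le_outer_measure => x [[]|[]].
(* A point off the closed set [C] belongs to some [A m]; if it is not in [A n], the least such index
   beyond n determines its layer. *)
have XC n : X `&` ~` C `<=` A n `|` \bigcup_(k in [set k | (n <= k)%N]) S k.
  move=> x [Xx nCx].
  have [m Am] : exists m, A m x.
    have /nbhs_ballP[e /= e0 xe] : nbhs x (~` C).
      by apply: open_nbhs_nbhs; split => //; exact: closed_openC.
    have [m me] := exists_invS_lt e0; exists m; split => // c Cc.
    apply: (le_trans (ltW me)); rewrite leNgt; apply/negP => xce; apply: (xe c) => //.
    by rewrite -ball_normE.
  have [|nAn] := pselect (A n x); first by left.
  right; have nm : (n < m)%N.
    rewrite ltnNge; apply/negP => mn; apply: nAn; split => // c Cc.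
    have [_ /(_ c Cc)] := Am; apply: le_trans.
    by rewrite lef_pV2 ?posrE// ler_nat ltnS.
  have ex : exists k, `[< A (n + k)%N x >].
    by exists (m - n)%N; apply/asboolP; rewrite subnKC// ltnW.
  case: (ex_minnP ex) => -[|k] /asboolP Ak kmin.
    by exfalso; apply: nAn; rewrite addn0 in Ak.
  exists (n + k)%N; first exact: leq_addr.
  split; first by rewrite -addnS.
  by move=> /asboolP/kmin; rewrite ltnn.
have sep (p n : nat) : (\sum_(0 <= k < n) mu (S (k.*2 + p)%N) <=
    mu (\bigcup_(k in [set k | (k < n)%N]) S (k.*2 + p)%N))%E.
  elim: n => [|n IH]; first by rewrite big_nil.
  rewrite big_nat_recr//=.
  apply: (@le_trans _ _ (mu (\bigcup_(k in [set k | (k < n)%N]) S (k.*2 + p)%N) +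
     mu (S (n.*2 + p)%N))%E); first exact: leeD2r.
  case: n {IH} => [|n].
    rewrite (_ : \bigcup_(k in _) _ = set0) ?outer_measure0 ?add0e; last first.
      by rewrite -subset0 => x [].
    by apply: le_outer_measure => x Sx; exists 0%N.
  set N := (n.+1.*2 + p)%N.
  have N0 : (0 < N)%N by rewrite /N doubleS.
  apply: (@le_trans _ _
      (mu (\bigcup_(k in [set k | (k < n.+1)%N]) S (k.*2 + p)%N `|` S N))).
    (* Earlier layers of the same parity stay at distance at least 1/N from [C], while a point of
       [S N] is closer than 1/(N+1) to some point of [C]. *)
    apply: (@mu_metric _ _ (N%:R^-1 - N.+1%:R^-1)).
      by rewrite subr_gt0 ltf_pV2 ?posrE ?ltr0n// ltr_nat.
    move=> a b [k /= kn [[_ Aa] _]] [[Xb _] nAb].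
    have [c [Cc bc]] : exists c, C c /\ `|b - c| < N.+1%:R^-1.
      apply: contrapT => h; apply: nAb; split => // c Cc.
      by rewrite leNgt; apply/negP => bc; apply: h; exists c.
    have ac : N%:R^-1 <= `|a - c|.
      apply: le_trans (Aa c Cc); rewrite lef_pV2 ?posrE ?ltr0n// ler_nat.
      rewrite /N doubleS !addSn !ltnS leq_add2r leq_double.
      by rewrite -ltnS.
    rewrite lerBlDr (le_trans ac)// (le_trans (ler_distD b _ _))//.
    by rewrite lerD2l ltW.
  apply: le_outer_measure => x [[k /= kn Sx]|Sx].
    by exists k => //=; rewrite ltnS ltnW.
  by exists n.+1 => /=.
have SX n : S n `<=` X by move=> x [[]].
have sep2 (p n : nat) : (\sum_(0 <= k < n) mu (S (k.*2 + p)%N) <= mu X)%E.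
  apply: le_trans (sep p n) _; apply: le_outer_measure => x [k _]; exact: SX.
have sumS n : (\sum_(0 <= k < n) mu (S k) <= mu X + mu X)%E.
  apply: (@le_trans _ _ (\sum_(0 <= k < n.*2) mu (S k))%E).
    by apply: lee_sum_nneg_natr => //; rewrite -addnn leq_addr.
  rewrite (_ : (\sum_(0 <= k < n.*2) mu (S k) =
     \sum_(0 <= k < n) mu (S (k.*2 + 0)%N) + \sum_(0 <= k < n) mu (S (k.*2 + 1)%N))%E).
    exact: leeD.
  elim: n => [|n IH]; first by rewrite !big_nil adde0.
  rewrite doubleS !big_nat_recr//= IH addn0 addn1.
  by rewrite -!addeA; congr (_ + _)%E; rewrite addeCA.
have SumS : (\sum_(0 <= k <oo) mu (S k) < +oo)%E.
  apply: (@le_lt_trans _ _ (mu X + mu X)%E); last exact: lte_add_pinfty.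
  apply: lime_le; first exact: is_cvg_nneseries.
  exact: nearW.
have tail0 := nneseries_tail_cvg SumS (fun k _ => mu0 (S k)).
have key n : (mu (X `&` C) + mu (X `&` ~` C) <=
    mu X + \sum_(n <= k <oo) mu (S k))%E.
  apply: (@le_trans _ _ (mu (X `&` C) + (mu (A n) + \sum_(n <= k <oo) mu (S k)))%E).
    apply: leeD2l.
    pose F k := if k == 0%N then A n else S (n + k.-1)%N.
    have /le_trans : (mu (X `&` ~` C) <= mu (\bigcup_k F k))%E.
      apply: le_outer_measure => x /(XC n)[Ax|[k /= nk Sx]]; first by exists 0%N.
      by exists (k - n).+1 => //; rewrite /F /= subnKC.
    apply; apply: le_trans (outer_measure_sigma_subadditive mu F) _.
    rewrite nneseries_recl//= /F/= leeD2l//.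
    rewrite -(nneseries_addn 1) // -(nneseries_addn n)//.
    by apply: lee_nneseries => // k _; rewrite addn1/= addnC.
  by rewrite addeA leeD2r.
have : ((mu X + \sum_(n <= k <oo) mu (S k))%E @[n --> \oo] --> (mu X + 0)%E).
  apply: cvgeD => //; last exact: cvg_cst.
  by rewrite ge0_adde_def// inE.
rewrite adde0 => cv.
rewrite -(cvg_lim _ cv)//; apply: lime_ge; first by apply/cvg_ex; eexists; exact: cv.
exact: nearW.
Qed.

End MetricOuterMeasure.

Section HausdorffMeasurable.
Context {R : realType} {d : nat}.
Implicit Types (A B X : set 'rV[R]_d).

(** Diameters in the gauge are Euclidean, whereas separation in the metric criterion is measured in
    the sup norm; separation in the latter thus implies separation in the former. *)
Lemma le_norm_enorm (x : 'rV[R]_d) : `|x| <= enorm x.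
Proof.
change (mx_norm x <= enorm x); rewrite mx_normrE.
apply: bigmax_le => [|[i j] _]; first exact: sqrtr_ge0.
rewrite (ord1 i)/= -sqrtr_sqr ler_sqrt; last first.
  by apply: sumr_ge0 => k _; rewrite -expr2 sqr_ge0.
by rewrite /dotv (bigD1 j)//= -expr2 lerDl sumr_ge0// => k _; rewrite -expr2 sqr_ge0.
Qed.

Variable n : nat.

Lemma hausdorff_gauge_set0 (delta : R) :
  hausdorff_gauge n delta (set0 : set 'rV[R]_d) = 0%E.
Proof. by rewrite /hausdorff_gauge; case: asboolP. Qed.

Lemma hausdorff_gauge_ge0 (delta : R) X : (0 <= hausdorff_gauge n delta X)%E.
Proof.
rewrite /hausdorff_gauge; case: asboolP => [//|/eqP/set0P[x Xx]].
case: ifPn => _; last exact: leey.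
rewrite lee_fin mulr_ge0 ?fine_ge0// exprn_ge0// divr_ge0// fine_ge0//.
apply: ereal_sup_ubound; exists x, x; split => //.
rewrite subrr /enorm /dotv big1 ?sqrtr0// => i _.
by rewrite mxE mul0r.
Qed.
Local Hint Resolve hausdorff_gauge_ge0 : core.

Lemma hausdorff_gauge_anti (delta delta' : R) X : delta <= delta' ->
  (hausdorff_gauge n delta' X <= hausdorff_gauge n delta X)%E.
Proof.
move=> dd; rewrite /hausdorff_gauge; case: asboolP => // _.
case: (boolP (ediam X <= delta%:E)%E) => [Xd|_]; last exact: leey.
by rewrite (le_trans Xd) ?lee_fin.
Qed.

Lemma cover_ext_gauge_anti (delta delta' : R) X : delta <= delta' ->
  (cover_ext (hausdorff_gauge n delta') X <=
   cover_ext (hausdorff_gauge n delta) X)%E.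
Proof.
move=> dd; apply: le_cover_extP => F XF.
apply: le_trans (@cover_ext_le R _ (hausdorff_gauge n delta') _ _ XF) _.
by apply: lee_nneseries => // k _; exact: hausdorff_gauge_anti.
Qed.

(** A set of diameter at most [delta] cannot meet both [A] and [B], so a cover by sets of finite
    gauge splits into disjoint subfamilies covering [A] and [B]. A member meeting both has gauge
    +oo. *)
Lemma cover_ext_gauge_metric (delta e : R) A B : delta < e ->
  (forall a b, A a -> B b -> e <= `|a - b|) ->
  (cover_ext (hausdorff_gauge n delta) A + cover_ext (hausdorff_gauge n delta) B
   <= cover_ext (hausdorff_gauge n delta) (A `|` B))%E.
Proof.
move=> de ABe; apply: le_cover_extP => F ABF.
pose G (Y : set 'rV[R]_d) k := if `[< F k `&` Y !=set0 >] then F k else set0.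
have GY Y : Y `<=` A `|` B -> Y `<=` \bigcup_k G Y k.
  move=> YAB x Yx; have [k _ Fkx] := ABF _ (YAB _ Yx).
  by exists k => //; rewrite /G; case: asboolP => // -[]; exists x.
apply: (@le_trans _ _ (\sum_(0 <= k <oo) hausdorff_gauge n delta (G A k) +
   \sum_(0 <= k <oo) hausdorff_gauge n delta (G B k))%E).
  by apply: leeD; apply: cover_ext_le; apply: GY => x; [left|right].
rewrite -nneseriesD//; apply: lee_nneseries => [k _ _|k _]; first exact: adde_ge0.
rewrite /G; case: asboolP => [[a [Fa Aa]]|_]; last first.
  rewrite hausdorff_gauge_set0 add0e; case: asboolP => // _.
  by rewrite hausdorff_gauge_set0.
case: asboolP => [[b [Fb Bb]]|_]; last by rewrite hausdorff_gauge_set0 adde0.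
rewrite [leRHS]/hausdorff_gauge; case: asboolP => [F0|_]; first by rewrite F0 in Fa.
case: ifPn => [Fd|_]; last exact: leey.
exfalso; have : ((enorm (a - b))%:E <= delta%:E)%E.
  by apply: le_trans Fd; apply: ereal_sup_ubound; exists a, b.
rewrite lee_fin => abd.
by have := le_trans (ABe a b Aa Bb) (le_norm_enorm _); rewrite leNgt (le_lt_trans abd).
Qed.

Lemma ereal_sup_add_le (S : set (\bar R)) (b c : \bar R) : S !=set0 ->
  (0 <= b)%E -> (forall x, S x -> (0 <= x)%E /\ (x + b <= c)%E) ->
  (ereal_sup S + b <= c)%E.
Proof.
move=> [x0 Sx0] b0 h; have [x00 x0bc] := h _ Sx0.
have [boo|bnoo] := eqVneq b +oo%E.
  move: x0bc; rewrite boo !addey -?ltNye ?(lt_le_trans (ltNyr 0))//.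
  by rewrite (le_trans x00)//; apply: ereal_sup_ubound.
have bfin : b \is a fin_num by rewrite ge0_fin_numE// ltey.
rewrite -leeBrDr//; apply: ge_ereal_sup => x Sx.
by rewrite leeBrDr//; have [] := h _ Sx.
Qed.

Lemma hausdorff_outer_metric A B (e : R) : 0 < e ->
  (forall a b, A a -> B b -> e <= `|a - b|) ->
  (hausdorff_outer n A + hausdorff_outer n B <= hausdorff_outer n (A `|` B))%E.
Proof.
move=> e0 ABe.
have ge0 delta X := cover_ext_ge0 (@hausdorff_gauge_ge0 delta) X.
apply: ereal_sup_add_le.
- by exists (cover_ext (hausdorff_gauge n 1) A), 1 => /=.
- exact: hausdorff_outer_ge0.
move=> _ [d1 /= d10 <-]; split; first exact: ge0.
rewrite addeC; apply: ereal_sup_add_le; last move=> _ [d2 /= d20 <-].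
- by exists (cover_ext (hausdorff_gauge n 1) B), 1 => /=.
- exact: ge0.
split; first exact: ge0.
(* Covering measures grow as the mesh shrinks, so a mesh below [d1] and [d2] dominates both; [e / 2]
   keeps it strictly below [e]. *)
pose dl := Num.min (e / 2) (Num.min d1 d2).
have dl0 : 0 < dl by rewrite !lt_min d10 d20 divr_gt0.
apply: (@le_trans _ _ (cover_ext (hausdorff_gauge n dl) (A `|` B))); last first.
  by apply: ereal_sup_ubound; exists dl.
apply: le_trans (@cover_ext_gauge_metric dl e A B _ ABe).
  rewrite addeC; apply: leeD; apply: cover_ext_gauge_anti.
    by rewrite /dl !ge_min lexx !orbT.
  by rewrite /dl !ge_min lexx !orbT.
by rewrite /dl gt_min; apply/orP; left; lra.
Qed.

End HausdorffMeasurable.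

Section SurfaceMeasurable.
Context {R : realType} {d : nat}.

Lemma closed_measurable_Sd (C : set 'rV[R]_d) : closed C ->
  measurable (C : set (Sd R d)).
Proof.
move=> cC; have := @closed_caratheodory R 'rV[R]_d (@hausdorff_om R d d.-1).
by apply => // A B e e0; exact: hausdorff_outer_metric.
Qed.

Lemma open_measurable_Sd (U : set 'rV[R]_d) : open U ->
  measurable (U : set (Sd R d)).
Proof.
move=> oU; rewrite -[U]setCK; apply: measurableC; apply: closed_measurable_Sd.
exact: open_closedC.
Qed.

Lemma measurable_bdry (X : set 'rV[R]_d) : measurable (bdry X : set (Sd R d)).
Proof.
apply: measurableD; first by apply: closed_measurable_Sd; exact: closed_closure.
by apply: open_measurable_Sd; exact: open_interior.
Qed.

Lemma relatively_open_measurable (G X : set 'rV[R]_d) :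
  relatively_open G (bdry X) -> measurable (G : set (Sd R d)).
Proof.
move=> [U oU ->]; apply: measurableI; first exact: measurable_bdry.
exact: open_measurable_Sd.
Qed.

End SurfaceMeasurable.

(** * Smooth bump functions *)

Section FlatFunction.
Context {R : realType}.
Implicit Types s t : R.

(** The powers of [s^-1] are built in because differentiating exp(-1/s) produces them: the
    derivative of [flat k] is a combination of [flat k.+1] and [flat k.+2]. *)
Definition flat (k : nat) s : R :=
  if 0 < s then s^-1 ^+ k * expR (- s^-1) else 0.

Lemma flat_gt0E k s : 0 < s -> flat k s = s^-1 ^+ k * expR (- s^-1).
Proof. by move=> s0; rewrite /flat s0. Qed.

Lemma flat_le0E k s : s <= 0 -> flat k s = 0.
Proof. by move=> s0; rewrite /flat ltNge s0. Qed.

Lemma flat_ge0 k s : 0 <= flat k s.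
Proof.
rewrite /flat; case: ifPn => // s0.
by rewrite mulr_ge0 ?expR_ge0// exprn_ge0// invr_ge0 ltW.
Qed.

Lemma flat_le1 s : flat 0 s <= 1.
Proof.
rewrite /flat; case: ifPn => // s0.
by rewrite expr0 mul1r -expR0 ler_expR oppr_le0 invr_ge0 ltW.
Qed.

(** The exponential series gives exp y >= y^(k+1) / (k+1)! at y = 1/s. The linear bound is what
    controls the difference quotients at 0. *)
Lemma flat_bound k s : flat k s <= (k.+1)`!%:R * `|s|.
Proof.
rewrite /flat; case: ifPn => s0; last by rewrite mulr_ge0.
rewrite (gtr0_norm s0).
have y0 : 0 < s^-1 by rewrite invr_gt0.
have := expR_ge1Dxn k (ltW y0).
set f := (k.+1)`!%:R; have f0 : 0 < f :> R by rewrite ltr0n fact_gt0.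
move=> h.
have {}h : s^-1 ^+ k.+1 / f <= expR s^-1 by apply: le_trans h; rewrite lerDr.
rewrite expRN ler_pdivrMr ?expR_gt0//.
apply: (@le_trans _ _ (f * s * (s^-1 ^+ k.+1 / f))).
  rewrite exprS (_ : f * s * _ = s^-1 ^+ k)//.
  by field; rewrite !gt_eqF.
by rewrite ler_wpM2l// mulr_ge0// ltW.
Qed.

Lemma is_derive_flat k s :
  is_derive s 1 (flat k) (- k%:R * flat k.+1 s + flat k.+2 s).
Proof.
have [s0|s0|->] := ltgtP s 0.
- rewrite !flat_le0E ?ltW// mulr0 addr0.
  apply: (@near_eq_is_derive _ _ _ (cst 0)).
  near=> t; rewrite flat_le0E//; near: t.
  exact: lt_le_nbhsl.
- rewrite !flat_gt0E//.
  pose F := (fun t : R => t^-1) ^+ k * (expR \o (fun t => - t^-1)).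
  apply: (@near_eq_is_derive _ _ _ F).
    near=> t; rewrite /F /= flat_gt0E; first by rewrite exprfctE.
    near: t; exact: lt_nbhsr.
  have sn0 : s != 0 by rewrite gt_eqF.
  have dV : is_derive s 1 (fun t : R => t^-1) (- s ^- 2).
    have h := @derivableV R R id s 1 sn0 (@derivable_id R R s 1).
    apply: DeriveDef => //.
    rewrite (@deriveV R R id s 1 sn0 (@derivable_id R R s 1)).
    by rewrite derive_id /GRing.scale/= mulr1.
  have dN : is_derive s 1 (fun t : R => - t^-1) (s ^- 2).
    by apply: is_derive_eq (is_deriveN dV) _; rewrite opprK.
  have dE := @is_derive1_comp R expR (fun t => - t^-1) s _ _
    (is_derive_expR (- s^-1)) dN.
  apply: is_derive_eq (is_deriveM (is_deriveX k dV) dE) _ => /=.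
  rewrite exprfctE /GRing.scale/=.
  case: k {F} => [|k].
    by rewrite -!exprVn /=; ring.
  by rewrite -!exprVn /= !exprS; ring.
- have E k' : flat k' 0 = 0 by rewrite flat_le0E.
  rewrite !E mulr0 addr0.
  have cv : (fun h : R =>
      h^-1 *: ((flat k \o shift 0) (h *: 1) - flat k 0)) @ 0^' --> (0 : R).
    apply/cvgr0Pnorm_le => e e0.
    have f0 : 0 < (k.+2)`!%:R :> R by rewrite ltr0n fact_gt0.
    near=> h.
    rewrite /= addr0 E subr0 /GRing.scale/= mulr1.
    have [h0|h0] := leP h 0; first by rewrite flat_le0E// mulr0 normr0 ltW.
    (* Dividing by [h] turns [flat k] into [flat k.+1], which is O(h). *)
    rewrite flat_gt0E// mulrA -exprS -flat_gt0E// ger0_norm ?flat_ge0//.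
    apply: (le_trans (flat_bound _ _)).
    rewrite mulrC -ler_pdivlMr//.
    near: h; apply: dnbhs0_le; exact: divr_gt0.
  apply: DeriveDef; first by apply/cvg_ex; exists 0.
  exact: cvg_lim cv.
Unshelve. all: by end_near. Qed.

Lemma continuous_flat k : continuous (flat k).
Proof.
move=> s; apply/differentiable_continuous/derivable1_diffP.
by have [] := is_derive_flat k s.
Qed.

Lemma cvg_flat0 t : 0 < t -> flat 0 (n.+1%:R * t) @[n --> \oo] --> (1 : R).
Proof.
move=> t0.
have E n : flat 0 (n.+1%:R * t) = expR (- (n.+1%:R^-1 * t^-1)).
  by rewrite flat_gt0E ?mulr_gt0// expr0 mul1r invfM.
have H : expR (- (n.+1%:R^-1 * t^-1)) @[n --> \oo] --> expR (- (0 * t^-1)).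
  apply: continuous_cvg; first exact: continuous_expR.
  by apply: cvgN; apply: cvgMl; exact: cvg_harmonic.
move: H; rewrite mul0r oppr0 expR0; apply: cvg_trans.
by apply: near_eq_cvg; near=> n; rewrite E.
Unshelve. all: by end_near. Qed.

End FlatFunction.

Section LineDerivative.
Context {R : realType} {V : normedModType R}.

Lemma is_derive_lineP (f : V -> R) (x v : V) (t df : R) :
  is_derive (t *: v + x) v f df <->
  is_derive t 1 (fun h : R => f (h *: v + x)) df.
Proof.
have E : (fun h : R => h^-1 *: ((f \o shift (t *: v + x)) (h *: v) - f (t *: v + x))) =
  (fun h : R => h^-1 *: (((fun h : R => f (h *: v + x)) \o shift t) (h *: 1) -
     (fun h : R => f (h *: v + x)) t)).
  by apply/funext => h /=; rewrite /GRing.scale/= mulr1 addrA -scalerDl.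
split => -[H1 H2]; split.
- by rewrite /derivable -E.
- by rewrite /derive -E.
- by rewrite /derivable E.
- by rewrite /derive E.
Qed.

Lemma is_derive_comp_affine (g : R -> R) (L : V -> R) (x v : V) (w dg : R) :
  (forall h, L (h *: v + x) = h * w + L x) ->
  is_derive (L x) 1 g dg -> is_derive x v (fun y => g (L y)) (dg * w).
Proof.
move=> Lw gd; suff : is_derive (0 *: v + x) v (fun y => g (L y)) (dg * w).
  by rewrite scale0r add0r.
apply/is_derive_lineP.
rewrite (_ : (fun h => g (L (h *: v + x))) = g \o (fun h => h * w + L x)); last first.
  by apply/funext => h /=; rewrite Lw.
apply: is_derive1_comp; first by rewrite mul0r add0r.
have := @is_deriveD R R R ( w \o* id) (cst (L x)) 0 1 w 0.
rewrite addr0; apply.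
apply: is_derive_eq (is_deriveM (@is_derive_id R R 0 1) (@is_derive_cst R R R w 0 1)) _.
by rewrite /= scaler0 add0r /GRing.scale/= mulr1.
Qed.

(** Bounds difference quotients uniformly by the directional derivative, with derivability assumed
    in that direction alone. *)
Lemma derivable_line_MVT (f : V -> R) (x v : V) (t : R) : 0 < t ->
  (forall y, derivable f y v) ->
  exists c : R, f (t *: v + x) - f x = 'D_v f (c *: v + x) * t.
Proof.
move=> t0 df; pose g (h : R) := f (h *: v + x).
pose dg (h : R) := 'D_v f (h *: v + x).
have gd (h : R) : is_derive h 1 g (dg h).
  by apply/is_derive_lineP; exact: derivableP.
have [|c _ gE] := @MVT R g dg 0 t t0 (fun h _ => gd h).
  apply: continuous_subspaceT => h.
  by apply/differentiable_continuous/derivable1_diffP; have [] := gd h.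
by exists c; move: gE; rewrite /g scale0r add0r subr0.
Qed.

End LineDerivative.

Section SmoothBump.
Context {R : realType} {d : nat}.
Implicit Types (f g : 'rV[R]_d -> R) (x l r : 'rV[R]_d).

(* By [is_derive_flat] this class is closed under partial derivatives, which
   makes its members smooth. *)
Inductive flatgen : ('rV[R]_d -> R) -> Prop :=
| flatgen_cst c : flatgen (fun=> c)
| flatgen_flat k i a b : flatgen (fun x => flat k (a * x ord0 i + b))
| flatgen_add f g : flatgen f -> flatgen g -> flatgen (fun x => f x + g x)
| flatgen_mul f g : flatgen f -> flatgen g -> flatgen (fun x => f x * g x).

Lemma flatgen_continuous f : flatgen f -> continuous f.
Proof.
elim=> [c|k i a b|f1 f2 _ c1 _ c2|f1 f2 _ c1 _ c2] x; first exact: cst_continuous.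
- apply: (@continuous_comp _ _ _ (fun x : 'rV[R]_d => a * x ord0 i + b) (flat k)).
    apply: (@continuousD _ _ _ (fun x : 'rV[R]_d => a * x ord0 i) (fun=> b)).
      apply: (@continuousM _ _ (fun=> a) (fun x : 'rV[R]_d => x ord0 i)).
        exact: cst_continuous.
      exact: coord_continuous.
    exact: cst_continuous.
  exact: continuous_flat.
- by apply: continuousD; [exact: c1|exact: c2].
- by apply: continuousM; [exact: c1|exact: c2].
Qed.

Lemma flatgen_derive f (j : 'I_d) : flatgen f ->
  exists2 g, flatgen g & forall x, is_derive x (delta_mx ord0 j) f (g x).
Proof.
elim=> [c|k i a b|f1 f2 F1 [g1 G1 D1] F2 [g2 G2 D2]|
  f1 f2 F1 [g1 G1 D1] F2 [g2 G2 D2]].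
- by exists (fun=> 0); [exact: flatgen_cst|move=> x; exact: is_derive_cst].
- pose L (x : 'rV[R]_d) := a * x ord0 i + b.
  exists (fun x => (- k%:R * flat k.+1 (L x) + flat k.+2 (L x)) *
      (a * (i == j)%:R)).
    apply: flatgen_mul; last exact: flatgen_cst.
    apply: flatgen_add; last exact: flatgen_flat.
    by apply: flatgen_mul; [exact: flatgen_cst|exact: flatgen_flat].
  move=> x; apply: (@is_derive_comp_affine _ _ (flat k) L); last exact: is_derive_flat.
  by move=> h; rewrite /L !mxE eqxx/=; ring.
- exists (fun x => g1 x + g2 x); first exact: flatgen_add.
  by move=> x; exact: is_deriveD.
- exists (fun x => f1 x * g2 x + f2 x * g1 x).
    by apply: flatgen_add; exact: flatgen_mul.
  by move=> x; exact: is_deriveM.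
Qed.

Lemma flatgen_smooth f : flatgen f -> smooth f.
Proof.
move=> Ff s.
have : flatgen (foldr partial f s).
  elim: s => [//|j s IH] /=; have [g Fg gd] := flatgen_derive j IH.
  rewrite (_ : partial j _ = g)//; apply/funext => x.
  by have [_] := gd x.
move=> Fs; split; first exact: flatgen_continuous.
by move=> i x; have [g _ /(_ x)[]] := flatgen_derive i Fs.
Qed.

(** Each factor vanishes on its side of a face whatever n is, and the dilation drives it to 1 on the
    other side: the support stays in the box while the function tends to the indicator of its
    interior. *)
Definition flat_bump (n : nat) l r x : R :=
  \prod_(i < d) (flat 0 (n.+1%:R * (x ord0 i - l ord0 i)) *
                 flat 0 (n.+1%:R * (r ord0 i - x ord0 i))).

Lemma bump_flatgen n l r : flatgen (flat_bump n l r).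
Proof.
rewrite /flat_bump; elim: (index_enum _) => [|i s IH].
  by under eq_fun do rewrite big_nil; exact: flatgen_cst.
under eq_fun do rewrite big_cons.
apply: flatgen_mul => //; apply: flatgen_mul.
  under eq_fun do rewrite mulrBr; exact: flatgen_flat.
rewrite (_ : (fun _ => _) =
    (fun x => flat 0 ((- n.+1%:R) * x ord0 i + n.+1%:R * r ord0 i))).
  exact: flatgen_flat.
by apply/funext => x; congr flat; ring.
Qed.

Lemma bump_ge0 n l r x : 0 <= flat_bump n l r x.
Proof. by apply: prodr_ge0 => i _; rewrite mulr_ge0// flat_ge0. Qed.

Lemma bump_le1 n l r x : flat_bump n l r x <= 1.
Proof.
by apply: prodr_ile1 => i _; rewrite mulr_ge0 ?flat_ge0// mulr_ile1 ?flat_ge0 ?flat_le1.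
Qed.

Lemma bump_neq0 n l r x : flat_bump n l r x != 0 -> obox l r x.
Proof.
move=> /prodf_neq0 h i; have := h i isT; rewrite mulf_eq0 negb_or => /andP[h1 h2].
apply/andP; split; rewrite -subr_gt0 -(pmulr_rgt0 _ (ltr0Sn R n)) ltNge.
  by apply: contra h1 => /(flat_le0E 0) ->.
by apply: contra h2 => /(flat_le0E 0) ->.
Qed.

Lemma cvg_bump l r x : flat_bump n l r x @[n --> \oo] --> (\1_(obox l r) x : R).
Proof.
rewrite indicE; have [|] := boolP (x \in obox l r); rewrite ?inE => xlr.
  rewrite (_ : true%:R = \prod_(i < d) 1 :> R); last by rewrite big1.
  rewrite /flat_bump; elim: (index_enum _) => [|i s IH].
    by under eq_fun do rewrite big_nil; rewrite big_nil; exact: cvg_cst.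
  under eq_fun do rewrite big_cons.
  rewrite big_cons; apply: cvgM => //; rewrite -[X in _ --> X]mulr1.
  have /andP[lx xr] := xlr i.
  by apply: cvgM; apply: cvg_flat0; rewrite subr_gt0.
rewrite (_ : (fun n => _) = cst 0); first exact: cvg_cst.
apply/funext => n; apply/eqP; apply: contraNT xlr => /bump_neq0.
by rewrite inE.
Qed.

Lemma compact_cbox l r : compact (cbox l r).
Proof.
have := @rV_compact R d (fun i => `[l ord0 i, r ord0 i]%classic).
rewrite (_ : [set v | _] = cbox l r); last first.
  by apply/seteqP; split => x xlr i; have := xlr i; rewrite /= in_itv.
by apply => i; exact: segment_compact.
Qed.

Lemma closed_cbox l r : closed (cbox l r).
Proof. by apply: compact_closed; [exact: norm_hausdorff|exact: compact_cbox]. Qed.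

Lemma test_fun_bump n l r (Omega : set 'rV[R]_d) : cbox l r `<=` Omega ->
  test_fun Omega (flat_bump n l r).
Proof.
move=> lrO.
have H : closure [set x | flat_bump n l r x != 0] `<=` cbox l r.
  rewrite [X in _ `<=` X](closure_id _).1; last exact: closed_cbox.
  apply: closureS => x /= /bump_neq0 xlr i.
  by have /andP[/ltW-> /ltW->] := xlr i.
split.
- by apply: flatgen_smooth; exact: bump_flatgen.
- by apply: (subclosed_compact _ _ H); [exact: closed_closure|exact: compact_cbox].
- exact: subset_trans H lrO.
Qed.

End SmoothBump.

(** * Integration by parts *)

Section CompactlySupported.
Context {R : realType} {d : nat}.
Implicit Types (f g : 'rV[R]_d -> R) (x v : 'rV[R]_d).
Local Notation leb := (leb R d).

(** Continuous functions of compact support; the radius bound makes stability under translation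
    immediate. *)
Definition Cc f := continuous f /\ exists M : R, forall x, f x != 0 -> `|x| <= M.

Definition cube (M : R) : set 'rV[R]_d := cbox (const_mx (- M)) (const_mx M).

Lemma cubeP (M : R) x : `|x| <= M -> cube M x.
Proof.
move=> xM i; rewrite !mxE -ler_norml; apply: le_trans xM; exact: ler_coord_norm.
Qed.

Lemma continuous_cube_bounded f (M : R) : continuous f ->
  exists2 C, 0 <= C & forall x, cube M x -> `|f x| <= C.
Proof.
move=> cf.
have /compact_bounded[N [_ NE]] : compact (f @` cube M : set R^o).
  by apply: continuous_compact; [exact: continuous_subspaceT|exact: compact_cbox].
exists (`|N| + 1) => [|x xM]; first by rewrite addr_ge0.
by apply: NE; [rewrite (le_lt_trans (ler_norm _))// ltrDl|exists x].
Qed.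

Lemma Cc_bounded f : Cc f -> exists2 C, 0 <= C & forall x, `|f x| <= C.
Proof.
move=> [cf [M fM]]; have [C C0 fC] := continuous_cube_bounded M cf.
exists C => // x; have [->|/fM xM] := eqVneq (f x) 0; first by rewrite normr0.
exact/fC/cubeP.
Qed.

Lemma Cc_integrable f : Cc f -> leb.-integrable setT (EFin \o (f : Rd R d -> R)).
Proof.
move=> ccf; have [cf [M fM]] := ccf; have [C C0 fC] := Cc_bounded ccf.
have mf := measurable_fun_continuous cf.
have mK : measurable (cube M : set (Rd R d)) by exact: measurable_cbox.
rewrite (_ : EFin \o f = (EFin \o f) \_ (cube M)); last first.
  apply/funext => x; rewrite patchE; case: ifPn => //= /negP xM.
  have [->//|/fM/cubeP/mem_set//] := eqVneq (f x) 0.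
apply/(integrable_mkcond _ mK); apply: measurable_bounded_integrable => //.
- exact: leb_cbox_lty.
- exact: measurable_funTS.
- exists C; split => [|y Cy x _ /=]; first exact: num_real.
  by rewrite (le_trans (fC x))// ltW.
Qed.

Lemma Cc_L2 (Omega : set 'rV[R]_d) f : measurable (Omega : set (Rd R d)) ->
  (leb Omega < +oo)%E -> Cc f -> L2 leb Omega (f : Rd R d -> R).
Proof.
move=> mO Ooo ccf; have [cf _] := ccf; have [C C0 fC] := Cc_bounded ccf.
have mf := measurable_fun_continuous cf.
by apply: L2_bounded => //; exact: measurable_funTS.
Qed.

Lemma Cc_shift f v : Cc f -> Cc (fun x => f (x + v)).
Proof.
move=> [cf [M fM]]; split.
  move=> x; apply: (@continuous_comp _ _ _ (fun x => x + v) f); last exact: cf.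
  apply: (@continuousD _ _ _ (fun x => x) (fun=> v)); first exact: cvg_id.
  exact: cst_continuous.
exists (M + `|v|) => x /fM xM.
by rewrite -(addrK v x) (le_trans (ler_normB _ _))// lerD2r.
Qed.

Lemma Cc_mul f g : Cc f -> continuous g -> Cc (fun x => f x * g x).
Proof.
move=> [cf [M fM]] cg; split.
  by move=> x; apply: continuousM; [exact: cf|exact: cg].
by exists M => x; rewrite mulf_eq0 negb_or => /andP[/fM].
Qed.

Lemma Cc_partial f i : Cc f -> continuous (partial i f) -> Cc (partial i f).
Proof.
move=> [cf [M fM]] cd; split => //; exists M => x; rewrite leNgt.
apply: contra => Mx; apply/eqP.
rewrite /partial (@near_eq_derive _ _ _ f (cst 0)) ?derive_cst//.
have : nbhs x [set y | M < `|y|].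
  apply: open_nbhs_nbhs; split => //.
  apply: (@open_comp _ _ (fun y : 'rV[R]_d => `|y|) [set t | M < t]).
    by move=> y _; exact: norm_continuous.
  exact: open_gt.
apply: filterS => y /= My; apply/eqP; apply: contraTT My => /fM.
by rewrite -leNgt.
Qed.

Lemma integral_shift f v : Cc f ->
  (\int[leb]_x (f (x + v)%R)%:E = \int[leb]_x (f x)%:E)%E.
Proof.
move=> ccf; have [cf _] := ccf.
have mf := measurable_fun_continuous cf.
apply: (@integral_measure_preserving _ _ (Rd R d) leb (fun x => x + v) _ _ (EFin \o f)).
- exact: measurable_shift.
- by move=> A _; exact: (lebesgue_outer_shift v A).
- exact/measurable_EFinP.
- exact: Cc_integrable (Cc_shift v ccf).
Qed.

(* The difference quotients have integral 0 by translation invariance, and they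
   converge boundedly to the partial derivative. *)
Lemma integral_partial0 f (i : 'I_d) : Cc f ->
  (forall x, derivable f x (delta_mx ord0 i)) -> continuous (partial i f) ->
  (\int[leb]_x (partial i f x)%:E = 0)%E.
Proof.
move=> ccf df cpf; have [cf [M fM]] := ccf.
set e : 'rV[R]_d := delta_mx ord0 i.
have ccp := Cc_partial ccf cpf; have [C C0 pC] := Cc_bounded ccp.
pose h (m : nat) : R := m.+1%:R^-1.
have h0 m : 0 < h m by rewrite invr_gt0.
have h1 m : h m <= 1 by rewrite invf_le1// ler1n.
pose q m x := (h m)^-1 * (f (x + h m *: e) - f x).
have e1 : `|e| <= 1.
  change (mx_norm e <= 1); rewrite mx_normrE; apply: bigmax_le => // -[a b] _ /=.
  by rewrite mxE; case: (_ && _); rewrite ?normr1 ?normr0.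
have intq m : (\int[leb]_x (q m x)%:E = 0)%E.
  have I1 := Cc_integrable (Cc_shift (h m *: e) ccf).
  have I2 := Cc_integrable ccf.
  rewrite /q; under eq_integral do rewrite EFinM.
  rewrite integralZl//; last first.
    by have := integrableB measurableT I1 I2.
  under eq_integral do rewrite EFinB.
  rewrite integralB// integral_shift// subee ?mule0//.
  exact: integrable_fin_num.
have qC m x : `|q m x| <= C.
  have [c cE] := derivable_line_MVT x (h0 m) df.
  rewrite /q (addrC x) cE mulrC mulfK; last by rewrite gt_eqF.
  exact: pC.
(* The steps [h m] are at most 1, so all quotients vanish off the cube enlarged by 1; a constant on
   that cube is then an integrable majorant. *)
have q0 m x : ~ cube (M + 1) x -> q m x = 0.
  move=> nx.
  have Mx : M + 1 < `|x| by rewrite ltNge; apply/negP => /cubeP.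
  have f0 y : M < `|y| -> f y = 0.
    by move=> My; apply/eqP; apply: contraTT My => /fM; rewrite -leNgt.
  have Mx0 : M < `|x| by apply: lt_trans Mx; rewrite ltrDl.
  have he1 : `|h m *: e| <= 1.
    by rewrite normrZ gtr0_norm// mulr_ile1// ltW.
  rewrite /q (f0 x)// (f0 (x + h m *: e)) ?subrr ?mulr0//.
  have := ler_normB (x + h m *: e) (h m *: e); rewrite addrK => xh.
  by move: Mx xh he1; clear; lra.
pose G := (fun x : Rd R d => C%:E) \_ (cube (M + 1)).
have mK : measurable (cube (M + 1) : set (Rd R d)) by exact: measurable_cbox.
have := @dominated_convergence _ (Rd R d) R leb setT measurableT
  (fun m x => (q m x)%:E) (fun x => (partial i f x)%:E) G.
case.
- move=> m; apply/measurable_EFinP; apply: measurable_funM; first exact: measurable_cst.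
  apply: measurable_funB; last exact: measurable_fun_continuous.
  by have [c _] := Cc_shift (h m *: e) ccf; exact: measurable_fun_continuous.
- by apply/measurable_EFinP; exact: measurable_fun_continuous.
- apply: aeW => x _; apply: cvg_EFin; first exact: nearW.
  have := df x => /cvg_ex[/= l fl].
  have pl : partial i f x = l by exact: cvg_lim fl.
  rewrite pl.
  have hc : h @ \oo --> (0 : R)^'.
    move=> A [eps /= eps0 epsA].
    have := @cvg_harmonic R => /cvgr0Pnorm_lt /(_ _ eps0).
    apply: filterS => n /= hn; apply: epsA => /=; first by rewrite sub0r normrN.
    by rewrite gt_eqF// h0.
  have := cvg_comp _ _ hc fl.
  apply: cvg_trans; apply: near_eq_cvg; near=> n.
  by rewrite /q /= /GRing.scale/= (addrC x).
- apply/(integrable_mkcond (cst C%:E) mK).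
  by apply: integrable_cst_finite => //; exact: leb_cbox_lty.
- apply: aeW => x m _; rewrite /G patchE; case: ifPn => [_|/negP xK].
    by rewrite lee_fin.
  by rewrite q0 ?abse0// => Kx; apply: xK; exact: mem_set.
move=> _ _; rewrite (_ : (fun n => _) = cst 0%E); last first.
  by apply/funext => n; exact: intq.
by move=> /cvg_lim <-//; rewrite lim_cst.
Unshelve. all: by end_near. Qed.

End CompactlySupported.

Section TestFunctions.
Context {R : realType} {d : nat}.
Variable Omega : set 'rV[R]_d.
Implicit Types (phi psi : 'rV[R]_d -> R).

Lemma test_fun_supp phi x : test_fun Omega phi -> phi x != 0 -> Omega x.
Proof. by move=> [_ _ pO] px; apply/pO/subset_closure. Qed.

Lemma test_fun_Cc phi : test_fun Omega phi -> Cc phi.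
Proof.
move=> [sm /compact_bounded[M [_ MK]] _]; split.
  by have [c _] := sm [::].
exists (`|M| + 1) => x px; apply: MK.
  by rewrite (le_lt_trans (ler_norm _))// ltrDl.
exact: subset_closure.
Qed.

Lemma test_fun_derivable phi i x : test_fun Omega phi ->
  derivable phi x (delta_mx ord0 i).
Proof. by move=> [sm _ _]; have [_] := sm [::]; exact. Qed.

Lemma test_fun_partial_continuous phi i : test_fun Omega phi ->
  continuous (partial i phi).
Proof. by move=> [sm _ _]; have [] := sm [:: i]. Qed.

Lemma test_fun_partial_Cc phi i : test_fun Omega phi -> Cc (partial i phi).
Proof.
move=> tp; apply: Cc_partial; first exact: test_fun_Cc.
exact: test_fun_partial_continuous.
Qed.

Hypotheses (mO : measurable (Omega : set (Rd R d))) (Ooo : (leb R d Omega < +oo)%E).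

(** Apply [integral_partial0] to the product [phi * psi] and expand by Leibniz. Both factors vanish
    off Omega, so the integrals over Omega and over the whole space agree. *)
Lemma test_fun_weak_grad phi : test_fun Omega phi ->
  is_weak_grad Omega phi (fun x => \row_i partial i phi x).
Proof.
move=> tphi psi tpsi i.
have [c1 _] := test_fun_Cc tphi; have [c2 _] := test_fun_Cc tpsi.
have L1 := Cc_L2 mO Ooo (test_fun_Cc tphi).
have L2 := Cc_L2 mO Ooo (test_fun_Cc tpsi).
have L3 := Cc_L2 mO Ooo (test_fun_partial_Cc i tphi).
have L4 := Cc_L2 mO Ooo (test_fun_partial_Cc i tpsi).
have d1 (x : 'rV[R]_d) := derivableP (@test_fun_derivable phi i x tphi).
have d2 (x : 'rV[R]_d) := derivableP (@test_fun_derivable psi i x tpsi).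
pose f x := phi x * psi x.
have fd x : is_derive x (delta_mx ord0 i) f
    (phi x * partial i psi x + psi x * partial i phi x).
  exact: is_deriveM (d1 x) (d2 x).
have fE : partial i f = fun x => phi x * partial i psi x + psi x * partial i phi x.
  by apply/funext => x; have [_] := fd x.
have ccf : Cc f by apply: Cc_mul => //; exact: test_fun_Cc.
have df x : derivable f x (delta_mx ord0 i).
  by have [] := fd x.
have cpf : continuous (partial i f).
  have p1 := @test_fun_partial_continuous phi i tphi.
  have p2 := @test_fun_partial_continuous psi i tpsi.
  rewrite fE => x.
  apply: (@continuousD _ _ _ (fun x => phi x * partial i psi x)
    (fun x => psi x * partial i phi x)).
    by apply: continuousM; [exact: c1|exact: p2].
  by apply: continuousM; [exact: c2|exact: p1].
have := integral_partial0 ccf df cpf; rewrite fE => I0.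
apply/eqP; rewrite -addr_eq0; apply/eqP.
rewrite /ip -RintegralD//; try exact: L2_mul_integrable; last first.
  under eq_fun do rewrite mxE; exact: L2_mul_integrable.
rewrite /Rintegral -[RHS]/(fine 0%E) -I0; congr fine.
rewrite integral_mkcond; apply: eq_integral => x _; rewrite patchE.
case: ifPn => [_|/negP xO]; first by rewrite mxE [X in _ + X]mulrC.
have -> : phi x = 0.
  by apply/eqP; apply/negP => /negP/(test_fun_supp tphi)/mem_set.
have -> : psi x = 0.
  by apply/eqP; apply/negP => /negP/(test_fun_supp tpsi)/mem_set.
by rewrite !mul0r addr0.
Qed.

Lemma test_fun_H1 phi : test_fun Omega phi -> H1 Omega phi.
Proof.
move=> tphi; split; first exact: Cc_L2 (test_fun_Cc tphi).
exists (fun x => \row_i partial i phi x); split; last exact: test_fun_weak_grad.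
move=> i; under eq_fun do rewrite mxE.
exact: Cc_L2 (test_fun_partial_Cc i tphi).
Qed.

End TestFunctions.

(** * Uniqueness of weak derivatives *)

Section VanishingIntegrals.
Context {R : realType} {disp : measure_display} {T : measurableType disp}.
Variables (mu : {measure set T -> \bar R}) (B : set T) (q : T -> \bar R)
  (G : set (set T)).
Hypotheses (mB : measurable B) (intq : mu.-integrable B q)
  (mG : G `<=` measurable) (GI : setI_closed G)
  (B0 : (\int[mu]_(x in B) q x = 0)%E)
  (G0 : forall A, G A -> (\int[mu]_(x in A `&` B) q x = 0)%E).

Let sGm : <<s G >> `<=` measurable.
Proof. exact: smallest_sub (@sigma_algebra_measurable _ T) mG. Qed.

(** Dynkin's pi-lambda argument: the sets [A] with vanishing integral are closed under complement
    and countable disjoint union. *)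
Lemma integral0_sigma_algebra (A : set T) : <<s G >> A ->
  (\int[mu]_(x in A `&` B) q x = 0)%E.
Proof.
apply: (@dynkin_induction _ (g_sigma_algebraType G) G
  (fun A => (\int[mu]_(x in A `&` B) q x = 0)%E)) => //.
- by rewrite setTI.
- move=> S sS S0; have mS : measurable (S : set T) by exact: sGm.
  have mSB : measurable (S `&` B : set T) by exact: measurableI.
  have mCB : measurable (~` S `&` B : set T).
    by apply: measurableI => //; exact: measurableC.
  have BE : B = (S `&` B) `|` (~` S `&` B) by rewrite -setIUl setUCr setTI.
  have := B0; rewrite {1}BE integral_setU//.
  + by rewrite S0 add0e.
  + by rewrite -BE; exact: measurable_int intq.
  + by apply/disj_setPS => x [[Sx _] [nSx _]].
- move=> F mF tF F0; rewrite setI_bigcupl integral_bigcup.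
  + by rewrite eseries0.
  + by apply: trivIset_setIr.
  + by move=> k; apply: measurableI => //; apply: sGm; exact: mF.
  + rewrite -setI_bigcupl; apply: (integrableS mB) => //.
    apply: measurableI => //; apply: bigcup_measurable => k _; apply: sGm; exact: mF.
Qed.

(** The hull hypothesis carries the vanishing of integrals from the generated sigma-algebra to every
    measurable subset of [B], as needed for the larger Lebesgue sigma-algebra. *)
Lemma ae_eq0_pi_system :
  (forall E, measurable E -> E `<=` B -> exists H, [/\ <<s G >> H, E `<=` H &
     mu ((H `&` B) `\` E) = 0]) ->
  ae_eq mu B q (cst 0%E).
Proof.
move=> hull; apply: integral_ae_eq => // E EB mE; rewrite integral0.
have [H [sH EH HE]] := hull E mE EB.
have mHB : measurable (H `&` B) by apply: measurableI => //; exact: sGm.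
have mD : measurable ((H `&` B) `\` E) by exact: measurableD.
have HBE : H `&` B = E `|` ((H `&` B) `\` E).
  by rewrite setUDr setDv setD0 setUidr// => x Ex; split; [exact: EH|exact: EB].
have := integral0_sigma_algebra sH; rewrite {1}HBE integral_setU//.
- rewrite (null_set_integral mD)// ?adde0//.
  by apply: measurable_funS (measurable_int _ intq) => // x [[]].
- by rewrite -HBE; apply: measurable_funS (measurable_int _ intq) => // x [].
- by apply/disj_setPS => x [Ex [_ nEx]].
Qed.

End VanishingIntegrals.

Section DuBoisReymond.
Context {R : realType} {d : nat}.
Local Notation leb := (leb R d).
Implicit Types (l r x : 'rV[R]_d) (q : 'rV[R]_d -> R).

Let oboxes : set (set 'rV[R]_d) := [set obox l r | l in setT & r in setT].

(** Lebesgue hulls are built from closed boxes, whereas bumps exhaust open ones; enlarging by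
    1/(n+1) on every side links the two. *)
Lemma cbox_sigma_oboxes l r : <<s oboxes >> (cbox l r).
Proof.
pose e n : 'rV[R]_d := const_mx n.+1%:R^-1.
have -> : cbox l r = \bigcap_n obox (l - e n) (r + e n).
  apply/seteqP; split => x.
    move=> xlr n _ i; have /andP[lx xr] := xlr i; rewrite !mxE.
    have h : 0 < n.+1%:R^-1 :> R by rewrite invr_gt0.
    by rewrite ltrBlDr (le_lt_trans lx) ?ltrDl//= (le_lt_trans xr)// ltrDl.
  move=> xlr i.
  have H (a b : R) : (forall n : nat, a < b + n.+1%:R^-1) -> a <= b.
    move=> ab; apply/ler_addgt0Pr => eps eps0.
    have [n nE] := exists_invS_lt eps0.
    by rewrite (le_trans (ltW (ab n)))// lerD2l ltW.
  apply/andP; split; apply: H => n; have := xlr n I i; rewrite !mxE.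
    by rewrite ltrBlDr => /andP[].
  by move=> /andP[].
suff : @measurable _ (g_sigma_algebraType oboxes)
  (\bigcap_n obox (l - e n) (r + e n)) by [].
apply: bigcap_measurableType => n _; apply: sub_gen_smallest.
by exists (l - e n) => //; exists (r + e n).
Qed.

Lemma obox_setI l r l' r' : obox l r `&` obox l' r' =
  obox (\row_i Num.max (l ord0 i) (l' ord0 i)) (\row_i Num.min (r ord0 i) (r' ord0 i)).
Proof.
apply/seteqP; split => x.
  move=> [h h'] i; rewrite !mxE gt_max lt_min.
  by have /andP[a b] := h i; have /andP[a' b'] := h' i; rewrite a b a' b'.
by move=> h; split => i; have := h i; rewrite !mxE gt_max lt_min =>
  /andP[/andP[a a'] /andP[b b']]; rewrite ?a ?a' ?b ?b'.
Qed.

Variable Omega : set 'rV[R]_d.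
Hypotheses (oO : open Omega) (Ooo : (leb Omega < +oo)%E).

Let mO : measurable (Omega : set (Rd R d)).
Proof. exact: open_measurable_Rd. Qed.

Variable q : 'rV[R]_d -> R.
Hypotheses (Lq : L2 leb Omega q)
  (q0 : forall phi, test_fun Omega phi -> ip Omega q phi = 0).

Let intq : leb.-integrable Omega (EFin \o q).
Proof.
have L1 : L2 leb Omega (fun=> 1 : R).
  by apply: (@L2_bounded _ _ _ _ _ mO _ 1) => // x _; rewrite normr1.
have := L2_mul_integrable mO Lq L1.
by apply: eq_integrable => // x _ /=; rewrite mulr1.
Qed.

(** Dominated convergence along the bumps: they are test functions on Omega with values in [0, 1],
    so |q| is a majorant. *)
Lemma integral_obox0 l r : cbox l r `<=` Omega ->
  (\int[leb]_(x in obox l r) (q x)%:E = 0)%E.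
Proof.
move=> lrO; have [mq _] := Lq.
have mb n : measurable_fun setT (flat_bump n l r : Rd R d -> R).
  by apply: measurable_fun_continuous; apply: flatgen_continuous; exact: bump_flatgen.
have := @dominated_convergence _ (Rd R d) R leb Omega mO
  (fun n x => (q x * flat_bump n l r x)%:E) (fun x => (q x * \1_(obox l r) x)%:E)
  (fun x => `|(q x)%:E|%E).
case.
- move=> n; apply/measurable_EFinP; apply: measurable_funM => //.
  exact: measurable_funTS.
- apply/measurable_EFinP; apply: measurable_funM => //.
  by apply: measurable_indic; exact: measurable_obox.
- apply: aeW => x _; apply: cvg_EFin; first exact: nearW.
  by apply: cvgMr; exact: cvg_bump.
- exact: integrable_abse.
- apply: aeW => x n _; rewrite lee_fin normrM ler_piMr//.
  by rewrite ger0_norm ?bump_ge0 ?bump_le1.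
move=> _ _; rewrite (_ : (fun n => _) = cst 0%E); last first.
  apply/funext => n.
  have tb := test_fun_bump n lrO.
  have Lb := Cc_L2 mO Ooo (test_fun_Cc tb).
  have qb := L2_mul_integrable mO Lq Lb.
  have := q0 tb; rewrite /ip /Rintegral => h.
  by rewrite -(fineK (integrable_fin_num mO qb)) h.
move=> /cvg_lim; rewrite lim_cst// => /(_ (@ereal_hausdorff R)) I0; rewrite [RHS]I0.
have lrE : Omega `&` obox l r = obox l r.
  apply/setIidr => x xlr; apply: lrO => i.
  by have /andP[/ltW-> /ltW->] := xlr i.
rewrite -{1}lrE integral_mkcondr; apply: eq_integral => x _.
by rewrite patchE indicE; case: (x \in obox l r); rewrite /= ?mulr1 ?mulr0.
Qed.

(** The pi-system argument is confined to one box because its intersection with any open box is an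
    open box whose closed box still lies in Omega; a box that merely meets Omega need not carry test
    functions. *)
Lemma ae0_obox l r : cbox l r `<=` Omega ->
  \forall x \ae leb, obox l r x -> q x = 0.
Proof.
move=> lrO.
have lrO' : obox l r `<=` Omega.
  by move=> x xlr; apply: lrO => i; have /andP[/ltW-> /ltW->] := xlr i.
have mB : measurable (obox l r : set (Rd R d)) by exact: measurable_obox.
have intB : leb.-integrable (obox l r) (EFin \o q).
  exact: integrableS intq.
suff : ae_eq leb (obox l r) (EFin \o q) (cst 0%E).
  by apply: filterS => x /= h /h[].
apply: (@ae_eq0_pi_system R _ (Rd R d) leb (obox l r) (EFin \o q) oboxes) => //.
- by move=> _ [l' _ [r' _ <-]]; exact: measurable_obox.
- move=> _ _ [l1 _ [r1 _ <-]] [l2 _ [r2 _ <-]]; rewrite obox_setI.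
  by eexists => //; eexists.
- exact: integral_obox0.
- move=> _ [l' _ [r' _ <-]]; rewrite obox_setI; apply: integral_obox0.
  apply: subset_trans lrO => x h i; have := h i; rewrite !mxE ge_max le_min.
  by move=> /andP[/andP[_ ->] /andP[_ ->]].
- move=> E mE EB.
  have Eoo : (lebesgue_outer E < +oo)%E.
    apply: le_lt_trans Ooo; apply: le_cover_ext; exact: subset_trans lrO'.
  have [H [sH EH HE]] := leb_hull Eoo.
  have sH' : <<s oboxes >> H.
    move: H sH {EH HE}; apply: smallest_sub; first exact: smallest_sigma_algebra.
    by move=> _ [l' _ [r' _ <-]]; exact: cbox_sigma_oboxes.
  exists H; split => //.
  have mH : measurable (H : set (Rd R d)).
    move: H sH' {EH HE sH}; apply: smallest_sub; first exact: sigma_algebra_measurable.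
    by move=> _ [l' _ [r' _ <-]]; exact: measurable_obox.
  apply/eqP; rewrite -measure_le0.
  apply: (@le_trans _ _ (leb (H `\` E))).
    by apply: le_outer_measure => x [[]].
  have -> : leb (H `\` E) = (leb H - leb (H `&` E))%E.
    by apply: measureD => //; exact: le_lt_trans Eoo.
  by rewrite setIidr// sube_le0.
Qed.

(** Countably many rational boxes exhaust Omega, so the exceptional null sets add up to a null
    set. *)
Theorem du_bois_reymond : \forall x \ae leb, Omega x -> q x = 0.
Proof.
pose N (pq : 'rV[rat]_d * 'rV[rat]_d) : set 'rV[R]_d :=
  [set x | cbox (map_mx ratr pq.1) (map_mx ratr pq.2) `<=` Omega /\
    obox (map_mx ratr pq.1) (map_mx ratr pq.2) x /\ q x <> 0].
have Nneg pq : leb.-negligible (N pq : set (Rd R d)).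
  have [pqO|npqO] := pselect (cbox (map_mx ratr pq.1) (map_mx ratr pq.2) `<=` Omega).
    apply: negligibleS (ae0_obox pqO) => x [_ [xpq qx]] /= h; exact: qx (h xpq).
  by rewrite (_ : N pq = set0); [exact: negligible_set0|rewrite -subset0 => x []].
pose F k := if unpickle k is Some pq then N pq else set0.
have Fneg k : leb.-negligible (F k : set (Rd R d)).
  by rewrite /F; case: unpickle => [pq|]; [exact: Nneg|exact: negligible_set0].
have := negligible_bigcup Fneg; apply: negligibleS => x /= /not_implyP[Ox qx].
have [p [q' [xpq pqO]]] := open_cover_obox oO Ox.
by exists (pickle (p, q')) => //; rewrite /F pickleK.
Qed.

End DuBoisReymond.

Section WeakDerivatives.
Context {R : realType} {d : nat}.
Local Notation leb := (leb R d).
Variable Omega : set 'rV[R]_d.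
Hypotheses (oO : open Omega) (Ooo : (leb Omega < +oo)%E).
Implicit Types (u v : 'rV[R]_d -> R) (F G : 'rV[R]_d -> 'rV[R]_d).

Let mO : measurable (Omega : set (Rd R d)).
Proof. exact: open_measurable_Rd. Qed.

Local Notation "f =ae g" := (\forall x \ae leb, Omega x -> f x = g x)
  (at level 70).

Lemma ae_eq_test_fun (q q' : 'rV[R]_d -> R) : L2 leb Omega q -> L2 leb Omega q' ->
  (forall phi, test_fun Omega phi -> ip Omega q phi = ip Omega q' phi) ->
  q =ae q'.
Proof.
move=> Lq Lq' qq'.
have Lqq' := L2B mO Lq Lq'.
have := @du_bois_reymond R d Omega oO Ooo _ Lqq'.
case=> [phi tp|N [mN N0 NE]].
  have Lp := Cc_L2 mO Ooo (test_fun_Cc tp).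
  have := L2ipDl mO Lq (L2N mO Lq') Lp; rewrite L2ipNl// /L2ip => E.
  by rewrite /ip E; move: (qq' _ tp); rewrite /ip => ->; rewrite subrr.
exists N; split => //; apply: subset_trans NE => x /= h h'; apply: h => Ox.
by apply/eqP; rewrite -subr_eq0; apply/eqP/h'.
Qed.

Lemma weak_grad_unique u G G' : L2v Omega G -> L2v Omega G' ->
  is_weak_grad Omega u G -> is_weak_grad Omega u G' ->
  forall i, (fun x => G x ord0 i) =ae (fun x => G' x ord0 i).
Proof.
move=> LG LG' wG wG' i; apply: ae_eq_test_fun => // phi tp.
by apply: oppr_inj; rewrite -wG// -wG'.
Qed.

Lemma weak_div_unique F q q' : L2 leb Omega q -> L2 leb Omega q' ->
  is_weak_div Omega F q -> is_weak_div Omega F q' -> q =ae q'.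
Proof.
move=> Lq Lq' wq wq'; apply: ae_eq_test_fun => // phi tp.
by apply: oppr_inj; rewrite -wq// -wq'.
Qed.

Lemma wgradP u : H1 Omega u ->
  L2v Omega (wgrad Omega u) /\ is_weak_grad Omega u (wgrad Omega u).
Proof. by move=> [_ hG]; exact: (getPex hG). Qed.

Lemma wdivP F : Hdiv Omega F ->
  L2 leb Omega (wdiv Omega F) /\ is_weak_div Omega F (wdiv Omega F).
Proof. by move=> [_ hq]; exact: (getPex hq). Qed.

Lemma wgrad_unique u G : H1 Omega u -> L2v Omega G -> is_weak_grad Omega u G ->
  forall i, (fun x => wgrad Omega u x ord0 i) =ae (fun x => G x ord0 i).
Proof. by move=> /wgradP[L w] LG wG; exact: (weak_grad_unique L LG w wG). Qed.

Lemma wdiv_unique F q : L2v Omega F -> L2 leb Omega q -> is_weak_div Omega F q ->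
  wdiv Omega F =ae q.
Proof.
move=> LF Lq wq; have [L w] : L2 leb Omega (wdiv Omega F) /\
    is_weak_div Omega F (wdiv Omega F).
  by apply: wdivP; split => //; exists q.
exact: (weak_div_unique L Lq w wq).
Qed.

Lemma weak_grad_sub u v G H : L2 leb Omega u -> L2 leb Omega v ->
  L2v Omega G -> L2v Omega H ->
  is_weak_grad Omega u G -> is_weak_grad Omega v H ->
  is_weak_grad Omega (u - v) (G - H).
Proof.
move=> Lu Lv LG LH wG wH phi tp i.
have Lp := Cc_L2 mO Ooo (test_fun_Cc tp).
have Lpp := Cc_L2 mO Ooo (test_fun_partial_Cc i tp).
have E1 := L2ipDl mO Lu (L2N mO Lv) Lpp; rewrite L2ipNl// in E1.
have E2 := L2ipDl mO (LG i) (L2N mO (LH i)) Lp; rewrite L2ipNl// in E2.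
have E3 : ip Omega (u - v) (partial i phi) =
    ip Omega u (partial i phi) - ip Omega v (partial i phi) by exact: E1.
have E4 : ip Omega (fun x => (G - H) x ord0 i) phi =
    ip Omega (fun x => G x ord0 i) phi - ip Omega (fun x => H x ord0 i) phi.
  rewrite -[RHS]E2; congr ip; apply/funext => x.
  by rewrite !mxE.
by rewrite E3 E4 wG// wH// opprB addrC opprK.
Qed.

Lemma H1B u v : H1 Omega u -> H1 Omega v -> H1 Omega (u - v).
Proof.
move=> Hu Hv; have [Lu _] := Hu; have [Lv _] := Hv.
have [LG wG] := wgradP Hu; have [LH wH] := wgradP Hv.
split; first by rewrite (_ : u - v = (fun x => u x - v x))//; exact: L2B.
exists (wgrad Omega u - wgrad Omega v); split; last exact: weak_grad_sub.
move=> i; rewrite (_ : (fun x => _) =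
      (fun x => wgrad Omega u x ord0 i - wgrad Omega v x ord0 i)).
  exact: (L2B mO (LG i) (LH i)).
by apply/funext => x; rewrite !mxE.
Qed.

Lemma wgradB u v : H1 Omega u -> H1 Omega v ->
  forall i, (fun x => wgrad Omega (u - v) x ord0 i) =ae
    (fun x => wgrad Omega u x ord0 i - wgrad Omega v x ord0 i).
Proof.
move=> Hu Hv i; have [Lu _] := Hu; have [Lv _] := Hv.
have [LG wG] := wgradP Hu; have [LH wH] := wgradP Hv.
have L : L2v Omega (wgrad Omega u - wgrad Omega v).
  move=> j; rewrite (_ : (fun x => _) =
      (fun x => wgrad Omega u x ord0 j - wgrad Omega v x ord0 j)).
    exact: (L2B mO (LG j) (LH j)).
  by apply/funext => x; rewrite !mxE.
have := wgrad_unique (H1B Hu Hv) L (weak_grad_sub Lu Lv LG LH wG wH) i.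
by apply: ae_imply => x h Ox; rewrite h// !mxE.
Qed.

Lemma wgrad_test_fun phi : test_fun Omega phi ->
  forall i, (fun x => wgrad Omega phi x ord0 i) =ae partial i phi.
Proof.
move=> tp i.
have L : L2v Omega (fun x => \row_i partial i phi x).
  move=> j; under eq_fun do rewrite mxE; exact: Cc_L2 (test_fun_partial_Cc j tp).
have := wgrad_unique (test_fun_H1 mO Ooo tp) L (test_fun_weak_grad mO Ooo tp) i.
by apply: ae_imply => x h Ox; rewrite h// mxE.
Qed.

End WeakDerivatives.

(** * Sobolev functions and traces *)

Section BoundaryValueProblem.
Context {R : realType} {d : nat}.
Variable P : bvp R d.
Hypothesis SA : standing_assumptions P.
Local Notation O := (Omega P).
Local Notation leb := (leb R d).
Local Notation surf := (surf R d).
Local Notation grad u := (wgrad O u).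
Implicit Types (t s u v w z : 'rV[R]_d -> R) (F G tau rho : 'rV[R]_d -> 'rV[R]_d).

Lemma open_Omega : open O.
Proof. by have [_ ? _ _ _] := sa_dom SA. Qed.

Lemma measurable_Omega : measurable (O : set (Rd R d)).
Proof. exact: open_measurable_Rd open_Omega. Qed.
Local Notation mO := measurable_Omega.

Lemma Omega_lty : (leb O < +oo)%E.
Proof. by apply: bounded_leb_lty mO; have [_ _ _ ? _] := sa_dom SA. Qed.

Lemma measurable_GammaN : measurable (GammaN P : set (Sd R d)).
Proof. exact: relatively_open_measurable (sa_openN SA). Qed.

Lemma H1_L2 u : H1 O u -> L2 leb O u.
Proof. by case. Qed.

Lemma H1_grad_L2 u : H1 O u -> vL2 leb O (grad u).
Proof. by move=> Hu; have [] := wgradP Hu. Qed.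

Lemma L2norm_le_norm1 u : L2norm leb O u <= norm1 O u.
Proof.
rewrite -[leLHS]ger0_norm ?sqrtr_ge0// -sqrtr_sqr ler_sqrt ?lerDl ?sqr_ge0//.
by rewrite addr_ge0 ?sqr_ge0.
Qed.

Lemma vnorm_grad_le_norm1 u : vnorm leb O (grad u) <= norm1 O u.
Proof.
rewrite -[leLHS]ger0_norm ?sqrtr_ge0// -sqrtr_sqr ler_sqrt ?lerDr ?sqr_ge0//.
by rewrite addr_ge0 ?sqr_ge0.
Qed.

Lemma ae_gradB u w : H1 O u -> H1 O w ->
  \forall x \ae leb, O x -> grad (u - w) x = (grad u - grad w) x.
Proof.
move=> Hu Hw; apply: (@ae_rowP R _ (Rd R d) leb O d) => i.
have := wgradB open_Omega Omega_lty Hu Hw i.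
by apply: ae_imply => x h Ox; rewrite h// !mxE.
Qed.

Lemma H1_sub u w : H1 O u -> H1 O w -> H1 O (u - w).
Proof. exact: H1B open_Omega Omega_lty _ _. Qed.

Lemma grad_sub_L2 u w : H1 O u -> H1 O w -> vL2 leb O (grad u - grad w).
Proof.
move=> /H1_grad_L2 Lu /H1_grad_L2 Lw.
exact: (vL2D mO Lu (vL2N mO Lw)).
Qed.

Lemma ipB u w v : L2 leb O u -> L2 leb O w -> L2 leb O v ->
  ip O (u - w) v = ip O u v - ip O w v.
Proof.
move=> Lu Lw Lv; have E := L2ipDl mO Lu (L2N mO Lw) Lv.
by rewrite (L2ipNl mO Lw Lv) in E.
Qed.

Lemma ipC u v : ip O u v = ip O v u.
Proof. exact: L2ipC. Qed.

Lemma ipv_gradBr F u w : vL2 leb O F -> H1 O u -> H1 O w ->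
  ipv O F (grad (u - w)) = ipv O F (grad u) - ipv O F (grad w).
Proof.
move=> LF Hu Hw; have Lu := H1_grad_L2 Hu; have Lw := H1_grad_L2 Hw.
have LB := grad_sub_L2 Hu Hw; have LuB := H1_grad_L2 (H1_sub Hu Hw).
transitivity (vip leb O F (grad u - grad w)).
  apply: (ae_eq_vip mO LF LuB LF LB).
  by apply: ae_imply (ae_gradB Hu Hw) => x h Ox; rewrite h.
by rewrite (vipDr mO Lu (vL2N mO Lw) LF) (vipNr mO Lw LF).
Qed.

Section Traces.
Variable psi : 'rV[R]_d -> R.
Hypothesis Lpsi : L2 surf (GammaN P) psi.

Lemma H1_trace_L2 u : H1 O u -> L2 surf (GammaN P) (tr P u).
Proof.
move=> Hu; have [trL _ _ _] := sa_trace SA.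
apply: (L2_subset (measurable_bdry O) measurable_GammaN _ (trL u Hu)).
by have [U _ ->] := sa_openN SA; move=> x [].
Qed.

Lemma ae_traceB u w : H1 O u -> H1 O w ->
  \forall x \ae surf, bdry O x -> tr P (u - w) x = tr P u x - tr P w x.
Proof.
move=> Hu Hw; have [_ trD _ _] := sa_trace SA.
have -> : u - w = (fun y => -1 * w y + u y).
  by apply/funext => y; rewrite mulN1r addrC.
have := trD (-1) w u Hw Hu; apply: ae_imply => x h bx.
by rewrite h// mulN1r addrC.
Qed.

Lemma GammaN_bdry : GammaN P `<=` bdry O.
Proof. by have [U _ ->] := sa_openN SA; move=> x []. Qed.

Lemma GammaD_bdry : GammaD P `<=` bdry O.
Proof. by have [U _ ->] := sa_openD SA; move=> x []. Qed.

Let pairNE u : pairN P psi u = L2ip surf (GammaN P) (tr P u) psi.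
Proof. exact: (@L2ipC _ _ (Sd R d) surf). Qed.

Lemma pairNB u w : H1 O u -> H1 O w ->
  pairN P psi (u - w) = pairN P psi u - pairN P psi w.
Proof.
move=> Hu Hw; have mN := measurable_GammaN.
have Lu := H1_trace_L2 Hu; have Lw := H1_trace_L2 Hw.
have Luw := H1_trace_L2 (H1_sub Hu Hw).
have LB := L2B mN Lu Lw.
rewrite !pairNE -(L2ipNl mN Lw Lpsi) -(L2ipDl mN Lu (L2N mN Lw) Lpsi).
apply: ae_eq_L2ip; [exact: mN|by case: Luw|by case: Lpsi|by case: LB|by case: Lpsi| |].
  apply: ae_imply (ae_traceB Hu Hw) => x h Nx; exact/h/GammaN_bdry.
by apply: aeW.
Qed.

(** The trace of a continuous function is its restriction, and the support lies in the open set
    Omega, away from the boundary. *)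
Lemma ae_trace_test_fun phi : test_fun O phi ->
  \forall x \ae surf, bdry O x -> tr P phi x = 0.
Proof.
move=> tp; have [_ _ _ trc] := sa_trace SA.
have Hp := test_fun_H1 mO Omega_lty tp.
have [cp _] := test_fun_Cc tp.
have := trc phi Hp (continuous_subspaceT cp).
apply: ae_imply => x h bx; rewrite h//.
apply/eqP; apply/negP => /negP/(test_fun_supp tp) Ox.
by case: bx => _; apply; rewrite (interior_id _).1//; exact: open_Omega.
Qed.

Lemma pairN_test_fun phi : test_fun O phi -> pairN P psi phi = 0.
Proof.
move=> tp; have mN := measurable_GammaN.
have Hp := test_fun_H1 mO Omega_lty tp.
have Lp := H1_trace_L2 Hp; have L0 := @L2_0 _ _ _ surf (GammaN P).
have -> : pairN P psi phi = L2ip surf (GammaN P) (fun=> 0) psi.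
  rewrite pairNE.
  apply: ae_eq_L2ip; [exact: mN|by case: Lp|by case: Lpsi|by case: L0|by case: Lpsi| |].
    apply: ae_imply (ae_trace_test_fun tp) => x h Nx; exact/h/GammaN_bdry.
  by apply: aeW.
rewrite /L2ip; under eq_Rintegral do rewrite mul0r.
by rewrite Rintegral_cst// mul0r.
Qed.

End Traces.

Lemma XD_sub phi u w : XD P phi u -> XD P phi w -> H1D P (u - w).
Proof.
move=> [Hu uD] [Hw wD]; split; first exact: H1_sub.
have h : \forall x \ae surf, GammaD P x -> tr P u x = tr P w x.
  by apply: ae_imply2 uD wD => x hu hw Dx; rewrite hu// hw.
apply: ae_imply2 (ae_traceB Hu Hw) h => x h1 h2 Dx.
by rewrite h1 ?h2 ?subrr//; exact: GammaD_bdry.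
Qed.


End BoundaryValueProblem.

(** * The forms of the boundary value problem *)

Section Forms.
Context {R : realType} {d : nat}.
Variable P : bvp R d.
Hypothesis SA : standing_assumptions P.
Local Notation O := (Omega P).
Local Notation leb := (leb R d).
Local Notation grad u := (wgrad O u).
Implicit Types (t s u v w z : 'rV[R]_d -> R) (F G tau rho : 'rV[R]_d -> 'rV[R]_d).
Local Notation mO := (measurable_Omega SA).

Let sub3_sub (a b c e f g : R) :
  (a - b) - (c - e) - (f - g) = (a - c - f) - (b - e - g).
Proof. by ring. Qed.

Lemma ae_elliptic : exists2 a0 : R, 0 < a0 & \forall x \ae leb, O x ->
  forall xi, a0 * enorm xi ^+ 2 <= dotv xi (mxapp (cA P x) xi).
Proof.
have [a0 [a1 [a00 _ ell]]] := sa_Aell SA; exists a0 => //.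
by apply: ae_imply ell => x h Ox xi; have /andP[] := h Ox xi.
Qed.

Lemma Linfty_invA i j : Linfty leb O (fun x => invmx (cA P x) i j).
Proof.
split.
  by apply: (measurable_fun_invmx mO) => a b; have [] := sa_Abnd SA a b.
have [a0 a00 ell] := ae_elliptic; exists a0^-1.
by apply: ae_imply ell => x h Ox; exact: elliptic_invmx_le a00 (h Ox) i j.
Qed.

Lemma AappD F G : Aapp P (F + G) = Aapp P F + Aapp P G.
Proof. by apply/funext => x; exact: mxappD. Qed.

Lemma AappN F : Aapp P (- F) = - Aapp P F.
Proof. by apply/funext => x; exact: mxappN. Qed.

Lemma AinvD F G : Ainv P (F + G) = Ainv P F + Ainv P G.
Proof. by apply/funext => x; exact: mxappD. Qed.

Lemma Aapp_L2 F : vL2 leb O F -> vL2 leb O (Aapp P F).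
Proof. by move=> LF; exact: (vL2_mxapp mO (sa_Abnd SA) LF). Qed.

Lemma Ainv_L2 F : vL2 leb O F -> vL2 leb O (Ainv P F).
Proof. by move=> LF; exact: (vL2_mxapp mO Linfty_invA LF). Qed.

Lemma bscale_L2 v : L2 leb O v -> vL2 leb O (bscale P v).
Proof. by move=> Lv; exact: (vL2_scale mO (sa_b SA) Lv). Qed.

Lemma ipv_Ainv_sym F G : vL2 leb O F -> vL2 leb O G ->
  ipv O (Ainv P F) G = ipv O F (Ainv P G).
Proof.
move=> LF LG; apply: (ae_eq_vip mO (Ainv_L2 LF) LG LF (Ainv_L2 LG)).
apply: ae_imply (sa_Asym SA) => x h Ox.
by rewrite /Ainv dotv_mxapp trmx_inv h.
Qed.

(** Symmetry moves A to the right factor, and ellipticity makes it invertible there almost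
    everywhere. *)
Lemma ipv_Aapp_Ainv F G : vL2 leb O F -> vL2 leb O G ->
  ipv O (Aapp P F) (Ainv P G) = ipv O F G.
Proof.
move=> LF LG; apply: (ae_eq_vip mO (Aapp_L2 LF) (Ainv_L2 LG) LF LG).
have [a0 a00 ell] := ae_elliptic.
apply: ae_imply2 (sa_Asym SA) ell => x h e Ox.
rewrite /Aapp /Ainv dotv_mxapp (h Ox) mxapp_Kinv//.
exact: elliptic_unitmx a00 (e Ox).
Qed.

(** The terms of order at most one of the differential operator, in the form in which they occur in
    [aform]. *)
Definition lower u : 'rV[R]_d -> R :=
  fun x => dotv (cb P x) (grad u x) + cc P x * u x.

Lemma lower_L2 u : H1 O u -> L2 leb O (lower u).
Proof.
move=> Hu.
have L1 := L2_dotv_Linfty mO (sa_b SA) (H1_grad_L2 Hu).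
exact: (L2D mO L1 (L2_Linfty_mul mO (sa_c SA) (H1_L2 Hu))).
Qed.

Lemma ip_lowerB u w s : H1 O u -> H1 O w -> H1 O s ->
  ip O (lower (u - w)) s = ip O (lower u) s - ip O (lower w) s.
Proof.
move=> Hu Hw Hs; have Luw := lower_L2 (H1_sub SA Hu Hw).
have Lu := lower_L2 Hu; have Lw := lower_L2 Hw.
have LB := L2B mO Lu Lw; have Ls := H1_L2 Hs.
rewrite -(ipB SA Lu Lw Ls).
apply: (@ae_eq_L2ip _ _ (Rd R d) leb O mO);
  [by case: Luw|by case: Ls|by case: LB|by case: Ls| |by apply: aeW].
apply: ae_imply (ae_gradB SA Hu Hw) => x h Ox; rewrite /lower h//.
rewrite (_ : (lower u - lower w) x = lower u x - lower w x)// /lower.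
rewrite (_ : (grad u - grad w) x = grad u x - grad w x)//.
rewrite (_ : (u - w) x = u x - w x)//.
rewrite (_ : dotv _ (_ - _) = dotv (cb P x) (grad u x) - dotv (cb P x) (grad w x)).
  by ring.
by rewrite /dotv -sumrB; apply: eq_bigr => i _; rewrite !mxE mulrBr.
Qed.

Lemma aform_subl u w s : H1 O u -> H1 O w -> H1 O s ->
  aform P (u - w) s = aform P u s - aform P w s.
Proof.
move=> Hu Hw Hs.
have Lu := H1_grad_L2 Hu; have Lw := H1_grad_L2 Hw; have Ls := H1_grad_L2 Hs.
have LB := grad_sub_L2 SA Hu Hw; have LuB := H1_grad_L2 (H1_sub SA Hu Hw).
have E1 : ipv O (Aapp P (grad (u - w))) (grad s) =
    ipv O (Aapp P (grad u)) (grad s) - ipv O (Aapp P (grad w)) (grad s).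
  transitivity (vip leb O (Aapp P (grad u - grad w)) (grad s)).
    apply: (ae_eq_vip mO (Aapp_L2 LuB) Ls (Aapp_L2 LB) Ls).
    by apply: ae_imply (ae_gradB SA Hu Hw) => x h Ox; rewrite /Aapp h.
  rewrite AappD AappN (vipDl mO (Aapp_L2 Lu) (vL2N mO (Aapp_L2 Lw)) Ls).
  by rewrite (vipNl mO (Aapp_L2 Lw) Ls).
by rewrite /aform E1 -!/(lower _) ip_lowerB// opprD addrACA.
Qed.

Lemma ipB_r f u w : L2 leb O f -> H1 O u -> H1 O w ->
  ip O f (u - w) = ip O f u - ip O f w.
Proof.
by move=> Lf /H1_L2 Lu /H1_L2 Lw; rewrite ipC (ipB SA Lu Lw Lf) ipC (ipC P w).
Qed.

Lemma aform_subr t u w : H1 O t -> H1 O u -> H1 O w ->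
  aform P t (u - w) = aform P t u - aform P t w.
Proof.
move=> Ht Hu Hw; rewrite /aform -!/(lower _).
rewrite (ipv_gradBr SA (Aapp_L2 (H1_grad_L2 Ht)) Hu Hw).
by rewrite (ipB_r (lower_L2 Ht) Hu Hw) opprD addrACA.
Qed.

Lemma ell_sub u w : H1 O u -> H1 O w -> ell P (u - w) = ell P u - ell P w.
Proof.
move=> Hu Hw; rewrite /ell (ipB_r (sa_f1 SA) Hu Hw).
by rewrite (ipv_gradBr SA (sa_f2 SA) Hu Hw) (pairNB SA (sa_psip SA) Hu Hw) sub3_sub.
Qed.

Lemma mfun_sub u w : H1 O u -> H1 O w ->
  Defs.mfun P (u - w) = Defs.mfun P u - Defs.mfun P w.
Proof.
move=> Hu Hw; rewrite /Defs.mfun (ipB_r (sa_g1 SA) Hu Hw).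
by rewrite (ipv_gradBr SA (sa_g2 SA) Hu Hw) (pairNB SA (sa_psid SA) Hu Hw) sub3_sub.
Qed.

Lemma flux_p_L2 u : H1 O u -> vL2 leb O (flux_p P u).
Proof.
move=> /H1_grad_L2/Aapp_L2 Lu.
exact: (vL2D mO (vL2N mO Lu) (vL2N mO (sa_f2 SA))).
Qed.

Lemma ipv_flux_p u G : H1 O u -> vL2 leb O G ->
  ipv O (flux_p P u) G = - ipv O (Aapp P (grad u)) G - ipv O (f2 P) G.
Proof.
move=> /H1_grad_L2/Aapp_L2 Lu LG; have Lf := sa_f2 SA.
have := vipDl mO (vL2N mO Lu) (vL2N mO Lf) LG.
by rewrite (vipNl mO Lu LG) (vipNl mO Lf LG).
Qed.

Lemma test_fun_H1D phi : test_fun O phi -> H1D P phi.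
Proof.
move=> tp; split; first exact: (test_fun_H1 mO (Omega_lty SA) tp).
apply: ae_imply (ae_trace_test_fun SA tp) => x h Dx; apply: h.
exact: GammaD_bdry Dx.
Qed.

(* Testing the primal equation with smooth compactly supported functions
   identifies [div sigma] as [f1 - b . grad u - c u]. *)
Lemma weak_div_flux_p u : primal_solution P u ->
  is_weak_div O (flux_p P u) (fun x => f1 P x - lower u x).
Proof.
move=> [[Hu _] eqn]; have Lu := H1_grad_L2 Hu; have Lf := sa_f1 SA.
have Ll := lower_L2 Hu.
move=> phi tp; have HDp := test_fun_H1D tp; have [Hp _] := HDp.
have Lp := H1_grad_L2 Hp; have Lphi := H1_L2 Hp.
have Lrow : vL2 leb O (fun x => \row_i partial i phi x).
  move=> i; under eq_fun do rewrite mxE.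
  exact: (Cc_L2 mO (Omega_lty SA) (test_fun_partial_Cc i tp)).
have gE : \forall x \ae leb, O x -> grad phi x = \row_i partial i phi x.
  apply: (@ae_rowP R _ (Rd R d) leb O d (grad phi)
    (fun x => \row_i partial i phi x)) => i.
  have := wgrad_test_fun (open_Omega SA) (Omega_lty SA) tp i.
  by apply: ae_imply => x h Ox; rewrite mxE h.
have LF := flux_p_L2 Hu.
have -> : ipv O (flux_p P u) (fun x => \row_i partial i phi x) =
    ipv O (flux_p P u) (grad phi).
  apply: (ae_eq_vip mO LF Lrow LF Lp).
  by apply: ae_imply gE => x h Ox; rewrite h.
rewrite (ipv_flux_p Hu Lp).
have := eqn _ HDp; rewrite /aform /ell -/(lower u).
rewrite (pairN_test_fun SA (sa_psip SA) tp).
have E : ip O (fun x => f1 P x - lower u x) phi =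
    ip O (f1 P) phi - ip O (lower u) phi := ipB SA Lf Ll Lphi.
rewrite E subr0 opprB.
move: (ipv _ _ _) (ipv _ _ _) (ip _ _ _) (ip _ _ _) => a b c e.
by move=> /(canRL (addrK _)) ->; ring.
Qed.

(** Uniqueness of the weak divergence replaces the chosen representative by [f1 P x - lower u x].
    For v in H^1_D the right-hand side is 0 by the primal equation, which is why the pairing depends
    on v only through its trace on Gamma_D. *)
Lemma normal_pairing_flux_p u v : primal_solution P u -> H1 O v ->
  normal_pairing P (flux_p P u) (psip P) v = ell P v - aform P u v.
Proof.
move=> pu Hv; have [[Hu _] _] := pu.
have Lv := H1_L2 Hv; have Lf := sa_f1 SA; have Ll := lower_L2 Hu.
have Lq : L2 leb O (fun x => f1 P x - lower u x) := L2B mO Lf Ll.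
have LF := flux_p_L2 Hu; have wq := weak_div_flux_p pu.
have [Ld _] : L2 leb O (wdiv O (flux_p P u)) /\
    is_weak_div O (flux_p P u) (wdiv O (flux_p P u)).
  by apply: wdivP; split; [exact: LF|exists (fun x => f1 P x - lower u x)].
rewrite /normal_pairing (ipv_flux_p Hu (H1_grad_L2 Hv)).
have -> : ip O (wdiv O (flux_p P u)) v = ip O (f1 P) v - ip O (lower u) v.
  rewrite -(ipB SA Lf Ll Lv).
  apply: (@ae_eq_L2ip _ _ (Rd R d) leb O mO);
    [by case: Ld|by case: Lv|by case: Lq|by case: Lv| |by apply: aeW].
  exact: (wdiv_unique (open_Omega SA) (Omega_lty SA) LF Lq wq).
rewrite /ell /aform -/(lower u).
by move: (ipv _ _ _) (ipv _ _ _) (ip _ _ _) (ip _ _ _) (pairN _ _ _) => a b c e f; ring.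
Qed.

End Forms.

(** * Error representation *)

Lemma ler_mul_bound (R : realType) (K x y n : R) : 0 <= K ->
  x <= K * y -> y <= n -> x <= K * n.
Proof. by move=> K0 xy yn; apply: (le_trans xy); rewrite ler_wpM2l. Qed.

(* The algebra behind gamma_1 - gamma_0, over an abstract space of
   square-integrable fields; [I] and [A] stand for the pointwise actions of
   A^-1 and A. *)
Lemma correction_identity (R : realType) (V : zmodType) (L : V -> Prop)
    (B : V -> V -> R) (I A : V -> V) :
  (forall F G, L F -> L G -> L (F + G)) ->
  (forall F G H, L F -> L G -> L H -> B (F + G) H = B F H + B G H) ->
  (forall F G, B F G = B G F) ->
  (forall F G, I (F + G) = I F + I G) ->
  (forall F, L F -> L (I F)) -> (forall F, L F -> L (A F)) ->
  (forall F G, L F -> L G -> B (I F) G = B F (I G)) ->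
  (forall F G, L F -> L G -> B (A F) (I G) = B F G) ->
  forall tau rho f g b Gw Gv,
  L tau -> L rho -> L f -> L g -> L b -> L Gw -> L Gv ->
  B (I (tau + f)) g + B f (I (rho + b + g)) - B (I (tau + f)) (rho + g)
  + B (tau + A Gw + f) (I rho) + B (I tau) (rho + g + A Gv + b)
  = B (I (tau + f + A Gw)) (rho + g + b + A Gv)
    - B g Gw - B f Gv - B (A Gw) Gv - B Gw b.
Proof.
move=> LD BDl BC ID LI LA IS AI tau rho f g b Gw Gv Lt Lr Lf Lg Lb Lw Lv.
have BDr F G H : L F -> L G -> L H -> B H (F + G) = B H F + B H G.
  by move=> LF LG LH; rewrite BC BDl// BC (BC G).
have IA F : L F -> B (I F) (A Gv) = B F Gv.
  by move=> LF; rewrite BC AI// BC.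
have AIw G : L G -> B (I (A Gw)) G = B Gw G.
  by move=> LG; rewrite IS ?AI//; exact: LA.
(* Normal form: everything expanded, [I] moved to the left factor and cancelled against [A]. *)
rewrite !ID !(BDl, BDr) -?IS ?IA ?AIw.
1: by rewrite (BC g Gw); ring.
all: by repeat first [assumption | apply LI | apply LA | apply LD].
Qed.

Section ErrorRepresentation.
Context {R : realType} {d : nat}.
Variable P : bvp R d.
Hypothesis SA : standing_assumptions P.
Local Notation O := (Omega P).
Local Notation leb := (leb R d).
Local Notation grad u := (wgrad O u).
Implicit Types (t s u v w z : 'rV[R]_d -> R) (F G tau rho : 'rV[R]_d -> 'rV[R]_d).
Local Notation mO := (measurable_Omega SA).

(** The primal equation tested with zd - v trades the arbitrary lift zd for v, so that gamma = m(u)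
    + l(v) - a(u, v). Subtracting gamma_0(w, v) leaves m(u - w) - a(u - w, v), and the adjoint
    equation tested with u - w turns m(u - w) into a(u - w, z). *)
Lemma gamma0_error zd u z w v : primal_solution P u -> adjoint_solution P z ->
  Xd P zd -> Xp P w -> Xd P v ->
  Jp P zd u - gamma0 P w v = aform P (u - w) (z - v).
Proof.
move=> pu [Xz eqz] Xzd Xw Xv; have [Xu eqn] := pu.
have [Hu _] := Xu; have [Hz _] := Xz; have [Hzd _] := Xzd.
have [Hw _] := Xw; have [Hv _] := Xv.
have Huw := H1_sub SA Hu Hw.
have E1 := eqn _ (XD_sub SA Xzd Xv).
have E2 := eqz _ (XD_sub SA Xu Xw).
rewrite /Jp (normal_pairing_flux_p SA pu Hzd) /gamma0 -/(Defs.mfun P u).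
move: E1; rewrite (ell_sub SA Hzd Hv) (aform_subr SA Hu Hzd Hv) => E1.
rewrite (aform_subr SA Huw Hz Hv) E2 (mfun_sub SA Hu Hw) (aform_subl SA Hu Hw Hv).
move: E1; move: (ell P zd) (ell P v) (aform P u zd) (aform P u v) => a b c e.
move=> /eqP; rewrite subr_eq => /eqP ->.
by move: (Defs.mfun P u) (Defs.mfun P w) (aform P w v); clear => *; ring.
Qed.

Definition residual_p w tau := tau + f2 P + Aapp P (grad w).
Definition residual_d v rho := rho + g2 P + bscale P v + Aapp P (grad v).

Lemma residual_p_L2 w tau : H1 O w -> vL2 leb O tau -> vL2 leb O (residual_p w tau).
Proof.
move=> Hw Lt.
exact: (vL2D mO (vL2D mO Lt (sa_f2 SA)) (Aapp_L2 SA (H1_grad_L2 Hw))).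
Qed.

Lemma residual_d_L2 v rho : H1 O v -> vL2 leb O rho -> vL2 leb O (residual_d v rho).
Proof.
move=> Hv Lr.
exact: (vL2D mO (vL2D mO (vL2D mO Lr (sa_g2 SA)) (bscale_L2 SA (H1_L2 Hv)))
  (Aapp_L2 SA (H1_grad_L2 Hv))).
Qed.

(** Purely algebraic: neither weak problem enters, and the fluxes are arbitrary square-integrable
    fields. [correction_identity] handles the field pairings; the remaining terms cancel. *)
Lemma gamma1_gamma0 w tau v rho : H1 O w -> H1 O v ->
  vL2 leb O tau -> vL2 leb O rho ->
  gamma1 P w tau v rho = gamma0 P w v +
    ipv O (Ainv P (residual_p w tau)) (residual_d v rho).
Proof.
move=> Hw Hv Lt Lr.
have Lf := sa_f2 SA; have Lg := sa_g2 SA.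
have LB := bscale_L2 SA (H1_L2 Hv).
have Lw := H1_grad_L2 Hw; have Lv := H1_grad_L2 Hv.
have := @correction_identity R _ (@vL2 _ _ (Rd R d) leb O d) (ipv O) (Ainv P) (Aapp P).
move=> /(_ (vL2D mO) (vipDl mO) (vipC leb O) (AinvD P) (Ainv_L2 SA) (Aapp_L2 SA)
  (ipv_Ainv_sym SA) (ipv_Aapp_Ainv SA) _ _ _ _ _ _ _ Lt Lr Lf Lg LB Lw Lv).
(* Convection moved to the adjoint side, (b . grad w, v) = (grad w, b v), which is the last pairing
   of [correction_identity]. *)
have B : ip O (lower P w) v = ipv O (grad w) (bscale P v) +
    ip O (fun x => cc P x * w x) v.
  have L1 := L2_dotv_Linfty mO (sa_b SA) Lw.
  have L3 := L2_Linfty_mul mO (sa_c SA) (H1_L2 Hw).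
  rewrite [LHS](L2ipDl mO L1 L3 (H1_L2 Hv)); congr (_ + _).
  apply: eq_Rintegral => x _; rewrite /bscale /dotv mulr_suml.
  by apply: eq_bigr => i _; rewrite mxE; ring.
rewrite /gamma1 /gamma0 /m_tilde /ell_tilde /a_tilde /Defs.mfun /ell /aform.
rewrite -/(lower P w) B.
rewrite -/(residual_p w tau) -/(residual_d v rho).
suff key (x1 x2 x3 x4 x5 y a b c e gw fv cw pd pp : R) :
    x1 + x2 - x3 + x4 + x5 = y - a - b - c - e ->
    gw + x1 - pd + (fv + x2 - pp) - (x3 + cw) + x4 + x5 =
    gw - a - pd + (fv - b - pp) - (c + (e + cw)) + y by exact: key.
by clear; lra.
Qed.

Lemma norm1_ge0 u : 0 <= norm1 O u.
Proof. exact: sqrtr_ge0. Qed.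

Lemma err1_ge0 sigma tau u w : 0 <= err1 P sigma tau u w.
Proof. exact: addr_ge0 (sqrtr_ge0 _) (sqrtr_ge0 _). Qed.

Lemma norm0v_le_err1 sigma tau u w :
  vnorm leb O (sigma - tau) <= err1 P sigma tau u w.
Proof. by have := norm1_ge0 (u - w); rewrite -(lerDl (norm0v O (sigma - tau))). Qed.

Lemma norm1_le_err1 sigma tau u w : norm1 O (u - w) <= err1 P sigma tau u w.
Proof.
by have := vnorm_ge0 leb O (sigma - tau); rewrite -(lerDr (norm1 O (u - w))).
Qed.

Lemma aform_bound : exists2 K : R, 0 <= K & forall e f, H1 O e -> H1 O f ->
  `|aform P e f| <= K * norm1 O e * norm1 O f.
Proof.
have [KA KA0 KAE] := vnorm_mxapp_le mO (sa_Abnd SA).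
have [Kb Kb0 KbE] := L2norm_dotv_le mO (sa_b SA).
have [Kc Kc0 KcE] := L2norm_Linfty_mul mO (sa_c SA).
exists (d%:R * KA + (Kb + Kc)); first by rewrite !addr_ge0// mulr_ge0.
move=> e f He Hf.
have Le := H1_L2 He; have Lf := H1_L2 Hf.
have Ge := H1_grad_L2 He; have Gf := H1_grad_L2 Hf.
have L1 := L2_dotv_Linfty mO (sa_b SA) Ge.
have L3 := L2_Linfty_mul mO (sa_c SA) Le.
have IA := ler_mul_bound KA0 (KAE _ Ge) (vnorm_grad_le_norm1 P e).
have Ib := ler_mul_bound Kb0 (KbE _ Ge) (vnorm_grad_le_norm1 P e).
have Ic := ler_mul_bound Kc0 (KcE _ Le) (L2norm_le_norm1 P e).
have Il := le_trans (sqrt_L2ip_triangle mO L1 L3) (lerD Ib Ic).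
have IAf := ler_pM (vnorm_ge0 _ _ _) (vnorm_ge0 _ _ _) IA (vnorm_grad_le_norm1 P f).
have Ilf := ler_pM (sqrtr_ge0 _) (sqrtr_ge0 _) Il (L2norm_le_norm1 P f).
have Iv := le_trans (vip_le mO (Aapp_L2 SA Ge) Gf) (ler_wpM2l (ler0n R d) IAf).
have Is := le_trans (L2_cauchy_schwarz mO (lower_L2 SA He) Lf) Ilf.
apply: (le_trans (ler_normD _ _)); apply: (le_trans (lerD Iv Is)).
move: (norm1 O e) (norm1 O f) => ne nf.
by rewrite !mulrDl !mulrA.
Qed.

Lemma residual_p_bound u : H1 O u -> exists2 K : R, 0 <= K & forall w tau,
  H1 O w -> vL2 leb O tau ->
  vnorm leb O (residual_p w tau) <= K * err1 P (flux_p P u) tau u w.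
Proof.
move=> Hu; have [KA KA0 KAE] := vnorm_mxapp_le mO (sa_Abnd SA).
exists (d%:R * (1 + KA)); first by rewrite mulr_ge0// addr_ge0.
move=> w tau Hw Lt.
have LF := flux_p_L2 SA Hu; have LB := grad_sub_L2 SA Hu Hw.
have Gd := H1_grad_L2 (H1_sub SA Hu Hw).
have Lst : vL2 leb O (flux_p P u - tau) := vL2D mO LF (vL2N mO Lt).
have LAB := Aapp_L2 SA LB.
have -> : residual_p w tau = - ((flux_p P u - tau) + Aapp P (grad u - grad w)).
  rewrite /residual_p /flux_p AappD AappN.
  move: (Aapp P (grad u)) (Aapp P (grad w)) (f2 P) => a b c.
  by apply/funext => x; apply/rowP => i; rewrite !mxE; ring.
rewrite vnormN; apply: (le_trans (vnormD_le mO Lst LAB)).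
rewrite -mulrA; apply: (ler_wpM2l (ler0n R d)); rewrite mulrDl mul1r.
apply: lerD; first exact: norm0v_le_err1.
apply: (ler_mul_bound KA0 (KAE _ LB)).
(* The chosen representative of the gradient of u - w agrees with the difference of the gradients
   only almost everywhere. *)
rewrite -(ae_eq_vnorm mO Gd LB (ae_gradB SA Hu Hw)).
exact: le_trans (vnorm_grad_le_norm1 P _) (norm1_le_err1 _ _ _ _).
Qed.

Lemma residual_d_bound z : H1 O z -> exists2 K : R, 0 <= K & forall v rho,
  H1 O v -> vL2 leb O rho ->
  vnorm leb O (residual_d v rho) <= K * err1 P (flux_d P z) rho z v.
Proof.
move=> Hz; have [KA KA0 KAE] := vnorm_mxapp_le mO (sa_Abnd SA).
have [Kb Kb0 KbE] := vnorm_scale_le mO (sa_b SA).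
(* The residual is a sum of three fields; the two uses of [vnormD_le] produce the nested factors
   d. *)
exists (d%:R * (d%:R * (1 + Kb) + KA)).
  by rewrite mulr_ge0// addr_ge0// mulr_ge0// addr_ge0.
move=> v rho Hv Lr.
have LF : vL2 leb O (flux_d P z).
  exact: (vL2N mO (vL2D mO (vL2D mO (Aapp_L2 SA (H1_grad_L2 Hz))
    (bscale_L2 SA (H1_L2 Hz))) (sa_g2 SA))).
have LB := grad_sub_L2 SA Hz Hv.
have Hzv := H1_sub SA Hz Hv.
have Gd := H1_grad_L2 Hzv.
have Lst : vL2 leb O (flux_d P z - rho) := vL2D mO LF (vL2N mO Lr).
have LAB := Aapp_L2 SA LB.
have Lb := bscale_L2 SA (H1_L2 Hzv).
have -> : residual_d v rho = - ((flux_d P z - rho) + bscale P (z - v)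
    + Aapp P (grad z - grad v)).
  rewrite /residual_d /flux_d AappD AappN.
  move: (Aapp P (grad z)) (Aapp P (grad v)) (g2 P) => a b c.
  apply/funext => x; apply/rowP => i.
  by rewrite /bscale !mxE (_ : (z - v) x = z x - v x)//; ring.
have Lsb := vL2D mO Lst Lb.
rewrite vnormN; apply: (le_trans (vnormD_le mO Lsb LAB)).
rewrite -mulrA; apply: (ler_wpM2l (ler0n R d)); rewrite mulrDl; apply: lerD; last first.
  apply: (ler_mul_bound KA0 (KAE _ LB)).
  rewrite -(ae_eq_vnorm mO Gd LB (ae_gradB SA Hz Hv)).
  exact: le_trans (vnorm_grad_le_norm1 P _) (norm1_le_err1 _ _ _ _).
apply: (le_trans (vnormD_le mO Lst Lb)).
rewrite -mulrA; apply: (ler_wpM2l (ler0n R d)); rewrite mulrDl mul1r.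
apply: lerD; first exact: norm0v_le_err1.
apply: (ler_mul_bound Kb0 (KbE _ (H1_L2 Hzv))).
exact: le_trans (L2norm_le_norm1 P _) (norm1_le_err1 _ _ _ _).
Qed.

(** [K] is quantified before the approximations, which makes it uniform in h and H. *)
Lemma gamma1_correction_bound u z : H1 O u -> H1 O z ->
  exists2 K : R, 0 <= K & forall w tau v rho,
    H1 O w -> vL2 leb O tau -> H1 O v -> vL2 leb O rho ->
  `|ipv O (Ainv P (residual_p w tau)) (residual_d v rho)| <=
    K * err1 P (flux_p P u) tau u w * err1 P (flux_d P z) rho z v.
Proof.
move=> Hu Hz; have [Kp Kp0 KpE] := residual_p_bound Hu.
have [Kd Kd0 KdE] := residual_d_bound Hz.
have [KI KI0 KIE] := vnorm_mxapp_le mO (Linfty_invA SA).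
exists (d%:R * (KI * Kp * Kd)); first by rewrite !mulr_ge0.
move=> w tau v rho Hw Lt Hv Lr.
have Lp := residual_p_L2 Hw Lt; have Ld := residual_d_L2 Hv Lr.
have I1 := ler_mul_bound KI0 (KIE _ Lp) (KpE _ _ Hw Lt).
have I2 := ler_pM (vnorm_ge0 _ _ _) (vnorm_ge0 _ _ _) I1 (KdE _ _ Hv Lr).
apply: (le_trans (le_trans (vip_le mO (Ainv_L2 SA Lp) Ld) (ler_wpM2l (ler0n R d) I2))).
move: (err1 _ _ _ _ _) (err1 _ _ _ _ _) => a b.
by rewrite le_eqVlt; apply/orP; left; apply/eqP; ring.
Qed.

End ErrorRepresentation.

(** * From products of errors to convergence rates *)

Section Rates.
Context {R : realType}.

(** The common end of both parts of the theorem: [E] and [F] are the actual errors, [ep] and [ed]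
    the best-approximation errors, [g] the error in the quantity of interest. *)
Lemma rate_bounds (K : R) (E F ep ed : R -> R) (g : R -> R -> R) : 0 <= K ->
  (forall h, 0 < h -> 0 <= E h) -> (forall h, 0 < h -> 0 <= F h) ->
  (forall h H, 0 < h -> 0 < H -> g h H <= K * E h * F H) ->
  (exists2 C : R, 0 < C & forall h, 0 < h -> E h <= C * ep h) ->
  (exists2 C : R, 0 < C & forall H, 0 < H -> F H <= C * ed H) ->
  (exists2 C : R, 0 < C & forall h H : R, 0 < h -> 0 < H ->
    g h H <= C * ep h * ed H) /\
  (forall sp sd : R,
    (exists2 C : R, 0 < C & forall h : R, 0 < h -> ep h <= C * h `^ sp) ->
    (exists2 C : R, 0 < C & forall H : R, 0 < H -> ed H <= C * H `^ sd) ->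
    exists2 C : R, 0 < C & forall h H : R, 0 < h -> 0 < H ->
      g h H <= C * h `^ sp * H `^ sd).
Proof.
move=> K0 E0 F0 gEF [C1 C10 EC] [C2 C20 FC].
have H (a b : R -> R) c1 c2 : 0 < c1 -> 0 < c2 ->
    (forall h, 0 < h -> E h <= c1 * a h) -> (forall h, 0 < h -> F h <= c2 * b h) ->
    exists2 C : R, 0 < C & forall h H : R, 0 < h -> 0 < H -> g h H <= C * a h * b H.
  (* The constant must be positive while [K] may be 0, hence [K + 1]. *)
  move=> c10 c20 Ea Fb; exists ((K + 1) * (c1 * c2)).
    by rewrite !mulr_gt0// ltr_wpDl.
  move=> h H h0 H0; apply: (le_trans (gEF h H h0 H0)).
  have -> : (K + 1) * (c1 * c2) * a h * b H = (K + 1) * (c1 * a h) * (c2 * b H) by ring.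
  apply: ler_pM; rewrite ?mulr_ge0 ?E0 ?F0 ?Fb//.
  by apply: ler_pM; rewrite ?E0 ?Ea// lerDl.
split; first exact: (H ep ed C1 C2).
move=> sp sd [D1 D10 epD] [D2 D20 edD].
apply: (H (fun h => h `^ sp) (fun h => h `^ sd) (C1 * D1) (C2 * D2)).
- exact: mulr_gt0.
- exact: mulr_gt0.
- by move=> h h0; rewrite -mulrA (le_trans (EC h h0))// ler_pM2l// epD.
- by move=> h h0; rewrite -mulrA (le_trans (FC h h0))// ler_pM2l// edD.
Qed.

End Rates.

Theorem corollary4p4 (R : realType) (d : nat) (P : bvp R d)
    (SA : standing_assumptions P)
    (Xph Xdh : R -> set ('rV[R]_d -> R))
    (Sph Sdh : R -> set ('rV[R]_d -> 'rV[R]_d))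
    (Xph_sub : forall h : R, 0 < h -> affine_space (Xph h) /\ Xph h `<=` Xp P)
    (Xdh_sub : forall H : R, 0 < H -> affine_space (Xdh H) /\ Xdh H `<=` Xd P)
    (Sph_sub : forall h : R, 0 < h -> Sph h `<=` Sigmap P)
    (Sdh_sub : forall H : R, 0 < H -> Sdh H `<=` Sigmad P)
    (u z zd : 'rV[R]_d -> R)
    (Hu : primal_solution P u) (Hz : adjoint_solution P z) (Hzd : Xd P zd) :
  let sigma := flux_p P u in
  let r := flux_d P z in
  let gamma := Jp P zd u in
  let ep0 := fun h : R => best0 P u (Xph h) in
  let ed0 := fun H : R => best0 P z (Xdh H) in
  let ep1 := fun h : R => best1 P sigma u (Sph h) (Xph h) in
  let ed1 := fun H : R => best1 P r z (Sdh H) (Xdh H) in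
  (forall uh zH : R -> 'rV[R]_d -> R,
     (forall h : R, 0 < h -> Xph h (uh h)) ->
     (forall H : R, 0 < H -> Xdh H (zH H)) ->
     (exists2 C : R, 0 < C &
        forall h : R, 0 < h -> err0 P u (uh h) <= C * ep0 h) ->
     (exists2 C : R, 0 < C &
        forall H : R, 0 < H -> err0 P z (zH H) <= C * ed0 H) ->
     (exists2 C : R, 0 < C & forall h H : R, 0 < h -> 0 < H ->
        `|gamma - gamma0 P (uh h) (zH H)| <= C * ep0 h * ed0 H) /\
     (forall sp0 sd0 : R,
        (exists2 C : R, 0 < C & forall h : R, 0 < h -> ep0 h <= C * h `^ sp0) ->
        (exists2 C : R, 0 < C & forall H : R, 0 < H -> ed0 H <= C * H `^ sd0) ->
        exists2 C : R, 0 < C & forall h H : R, 0 < h -> 0 < H ->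
          `|gamma - gamma0 P (uh h) (zH H)| <= C * h `^ sp0 * H `^ sd0))
  /\
  (forall (sh rH : R -> 'rV[R]_d -> 'rV[R]_d) (uh zH : R -> 'rV[R]_d -> R),
     (forall h : R, 0 < h -> Sph h (sh h) /\ Xph h (uh h)) ->
     (forall H : R, 0 < H -> Sdh H (rH H) /\ Xdh H (zH H)) ->
     (exists2 C : R, 0 < C &
        forall h : R, 0 < h -> err1 P sigma (sh h) u (uh h) <= C * ep1 h) ->
     (exists2 C : R, 0 < C &
        forall H : R, 0 < H -> err1 P r (rH H) z (zH H) <= C * ed1 H) ->
     (exists2 C : R, 0 < C & forall h H : R, 0 < h -> 0 < H ->
        `|gamma - gamma1 P (uh h) (sh h) (zH H) (rH H)| <= C * ep1 h * ed1 H) /\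
     (forall sp1 sd1 : R,
        (exists2 C : R, 0 < C & forall h : R, 0 < h -> ep1 h <= C * h `^ sp1) ->
        (exists2 C : R, 0 < C & forall H : R, 0 < H -> ed1 H <= C * H `^ sd1) ->
        exists2 C : R, 0 < C & forall h H : R, 0 < h -> 0 < H ->
          `|gamma - gamma1 P (uh h) (sh h) (zH H) (rH H)|
            <= C * h `^ sp1 * H `^ sd1)).
Proof.
move=> sigma r gamma ep0 ed0 ep1 ed1.
have [[Hu1 _] _] := Hu; have [[Hz1 _] _] := Hz.
have [Ka Ka0 KaE] := aform_bound SA.
have [Kc Kc0 KcE] := gamma1_correction_bound SA Hu1 Hz1.
have SigmaL2 psi tau : SigmaN P psi tau -> vL2 (leb R d) (Omega P) tau.
  by move=> [[]].
split.
- move=> uh zH uhX zHX Eu Ez.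
  have Xu h : 0 < h -> Xp P (uh h).
    by move=> h0; have [_ sub] := Xph_sub h h0; exact: sub _ (uhX h h0).
  have Xz h : 0 < h -> Xd P (zH h).
    by move=> h0; have [_ sub] := Xdh_sub h h0; exact: sub _ (zHX h h0).
  apply: (@rate_bounds R Ka (fun h => err0 P u (uh h)) (fun h => err0 P z (zH h))
    ep0 ed0 (fun h H => `|gamma - gamma0 P (uh h) (zH H)|) Ka0 _ _ _ Eu Ez).
  + by move=> h _; exact: norm1_ge0.
  + by move=> h _; exact: norm1_ge0.
  move=> h H h0 H0.
  rewrite (gamma0_error SA Hu Hz Hzd (Xu h h0) (Xz H H0)).
  have [Hw _] := Xu h h0; have [Hv _] := Xz H H0.
  exact: KaE _ _ (H1_sub SA Hu1 Hw) (H1_sub SA Hz1 Hv).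
- move=> sh rH uh zH suX rzX Eu Ez.
  have Xu h : 0 < h -> Xp P (uh h).
    by move=> h0; have [_ sub] := Xph_sub h h0; exact: sub _ (suX h h0).2.
  have Xz h : 0 < h -> Xd P (zH h).
    by move=> h0; have [_ sub] := Xdh_sub h h0; exact: sub _ (rzX h h0).2.
  have Ls h : 0 < h -> vL2 (leb R d) (Omega P) (sh h).
    by move=> h0; exact: SigmaL2 _ _ (Sph_sub h h0 _ (suX h h0).1).
  have Lr h : 0 < h -> vL2 (leb R d) (Omega P) (rH h).
    by move=> h0; exact: SigmaL2 _ _ (Sdh_sub h h0 _ (rzX h h0).1).
  (* gamma - gamma_1 is a(u - u_h, z - z_H) minus the residual pairing. The first is bounded with
     [Ka], its H^1 errors being dominated by [err1], and the second with [Kc]. *)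
  apply: (@rate_bounds R (Ka + Kc) (fun h => err1 P sigma (sh h) u (uh h))
    (fun h => err1 P r (rH h) z (zH h)) ep1 ed1
    (fun h H => `|gamma - gamma1 P (uh h) (sh h) (zH H) (rH H)|) _ _ _ _ Eu Ez).
  + exact: addr_ge0.
  + by move=> h _; exact: err1_ge0.
  + by move=> h _; exact: err1_ge0.
  move=> h H h0 H0.
  have [Hw _] := Xu h h0; have [Hv _] := Xz H H0.
  rewrite (gamma1_gamma0 SA Hw Hv (Ls h h0) (Lr H H0)) opprD addrA.
  rewrite (gamma0_error SA Hu Hz Hzd (Xu h h0) (Xz H H0)).
  apply: (le_trans (ler_normB _ _)); rewrite !mulrDl.
  apply: lerD; last exact: KcE _ _ _ _ Hw (Ls h h0) Hv (Lr H H0).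
  apply: (le_trans (KaE _ _ (H1_sub SA Hu1 Hw) (H1_sub SA Hz1 Hv))).
  apply: ler_pM; [exact: mulr_ge0 Ka0 (norm1_ge0 _ _)|exact: norm1_ge0| |].
    exact: ler_wpM2l Ka0 _ _ (norm1_le_err1 _ _ _ _ _).
  exact: norm1_le_err1.
Qed.
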